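(* Let $q$ be a prime power, $m,n\ge 1$ integers, and $R=R'_{2,2m}=\mathbb{F}_q[[T]]+T^m\mathbb{F}_{q^2}[[T]]$. Then, with $t:=q^{-s}$, $$\nu^R_{R^n}(s)=(t^2;q^2)_n\,\zeta^R_{R^n}(s)=\sum_{\lambda,\mu}(t^2;q^2)_{\mu_1'}\;g^{(m^n)}_{\mu}(q)\;B(m,n,\lambda,\mu,q)\;t^{mn+|\lambda|-2|\mu|},$$ where the sum runs over partitions $\lambda,\mu\subseteq(m^n)$.
   Context: Pochhammer symbols: $(A;x)_N:=\prod_{j=0}^{N-1}(1-Ax^j)$. The $q$-binomial coefficient ${N\brack M}_x$ is $\frac{(x;x)_N}{(x;x)_M(x;x)_{N-M}}$ if $0\le M\le N$, and $0$ otherwise. $\zeta_{R^n}^R(s):=\sum_{L}|R^n/L|^{-s}$, summed over finite-index $R$-submodules $L\subseteq R^n$, a formal power series in $t=q^{-s}$. With $\widetilde R=\mathbb{F}_{q^2}[[T]]$ the normalization of $R$, $\nu^R_{R^n}(s):=\zeta^R_{R^n}(s)/\zeta^{\widetilde R}_{\widetilde R^n}(s)$, where $\zeta^{\widetilde R}_{\widetilde R^n}(s)=(t^2;q^2)_n^{-1}$ is the analogous series counting $\widetilde R$-submodules of $\widetilde R^n$. For a partition $\lambda$, $\lambda'$ is its conjugate with parts $\lambda_i'$, $|\lambda|$ is its size, and $(m^n)$ is the partition with $n$ parts equal to $m$; $\lambda\subseteq(m^n)$ means that $\lambda$ has at most $n$ parts, each at most $m$. For partitions $\lambda,\mu$,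 $g^\lambda_\mu(x)\in\mathbb{Z}[x]$ is the universal polynomial such that for any DVR $V$ with uniformizer $\pi$ and residue field $\mathbb{F}_{Q}$, $g^\lambda_\mu(Q)$ is the number of $V$-submodules of $\bigoplus_i V/\pi^{\lambda_i}$ isomorphic to $\bigoplus_i V/\pi^{\mu_i}$; explicitly $$g^\lambda_\mu(x)=x^{\sum_{i\ge1}\mu_i'(\lambda_i'-\mu_i')}\prod_{i\ge 1}{\lambda_i'-\mu_{i+1}'\brack \lambda_i'-\mu_i'}_{x^{-1}}.$$ Set $a_\lambda(x):=x^{\sum_i\lambda_i'^2}\prod_{i\ge1}(x^{-1};x^{-1})_{\lambda_i'-\lambda_{i+1}'}$ and $$B(m,n,\lambda,\mu,q):=\frac{g^{(m^n)}_\lambda(q^2)\,g^\lambda_\mu(q)\,a_\lambda(q^2)/a_\lambda(q)}{g^{(m^n)}_\mu(q^2)\,a_\mu(q^2)/a_\mu(q)}.$$ *)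

(* Defs.v *)
From HB Require Import structures.
From mathcomp Require Import all_boot all_order all_algebra all_field.
From mathcomp Require Import finmap.
From mathcomp Require Import boolp classical_sets functions cardinality.

Set Implicit Arguments.
Unset Strict Implicit.
Unset Printing Implicit Defensive.

Import GRing.Theory.

Local Open Scope ring_scope.

(* Formal power series, as coefficient sequences with the Cauchy product.
   A record is used because [nat -> A] already carries the pointwise ring
   structure of mathcomp-classical. *)

Record fps (A : Type) := FPS { fps_coef :> nat -> A }.

Notation "{ 'fps' A }" := (fps A) (at level 0, format "{ 'fps'  A }") : type_scope.

HB.instance Definition _ (A : Type) := gen_eqMixin {fps A}.
HB.instance Definition _ (A : Type) := gen_choiceMixin {fps A}.

Lemma fpsP (A : Type) (f g : {fps A}) : (forall i, f i = g i) -> f = g.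
Proof. by case: f g => [f] [g] /= /funext ->. Qed.

Section FpsZmod.
Variable A : zmodType.
Implicit Types f g h : {fps A}.

Definition fps_zero : {fps A} := FPS (fun=> 0).
Definition fps_opp f : {fps A} := FPS (fun i => - f i).
Definition fps_add f g : {fps A} := FPS (fun i => f i + g i).

Fact fps_addA : associative fps_add.
Proof. by move=> f g h; apply: fpsP => i /=; rewrite addrA. Qed.
Fact fps_addC : commutative fps_add.
Proof. by move=> f g; apply: fpsP => i /=; rewrite addrC. Qed.
Fact fps_add0 : left_id fps_zero fps_add.
Proof. by move=> f; apply: fpsP => i /=; rewrite add0r. Qed.
Fact fps_addN : left_inverse fps_zero fps_opp fps_add.
Proof. by move=> f; apply: fpsP => i /=; rewrite addNr. Qed.

HB.instance Definition _ :=
  GRing.isZmodule.Build {fps A} fps_addA fps_addC fps_add0 fps_addN.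

Lemma fps_coef0 i : (0 : {fps A}) i = 0. Proof. by []. Qed.
Lemma fps_coefN f i : (- f) i = - f i. Proof. by []. Qed.
Lemma fps_coefD f g i : (f + g) i = f i + g i. Proof. by []. Qed.

End FpsZmod.

Section FpsRing.
Variable A : comNzRingType.
Implicit Types f g h : {fps A}.

Definition fpsC (a : A) : {fps A} := FPS (fun i => if i == 0%N then a else 0).
Definition fpsX : {fps A} := FPS (fun i => (i == 1%N)%:R).
Definition fps_mul f g : {fps A} :=
  FPS (fun n => \sum_(i < n.+1) f i * g (n - i)%N).

Let trunc n f : {poly A} := \poly_(i < n.+1) f i.

Let fps_mul_trunc n k f g :
  (k <= n)%N -> fps_mul f g k = (trunc n f * trunc n g)`_k.
Proof.
move=> kn; rewrite coefM /=; apply: eq_bigr => i _.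
have ik : (i <= k)%N by rewrite -ltnS.
by rewrite !coef_poly !ltnS (leq_trans ik kn) (leq_trans (leq_subr _ _) kn).
Qed.

Let coef_truncl n (p : {poly A}) f g : (forall i, (i <= n)%N -> f i = p`_i) ->
  fps_mul f g n = (p * trunc n g)`_n.
Proof.
move=> fp; rewrite coefM /=; apply: eq_bigr => i _.
have ik : (i <= n)%N by rewrite -ltnS.
by rewrite fp // coef_poly !ltnS leq_subr.
Qed.

Fact fps_mulC : commutative fps_mul.
Proof.
by move=> f g; apply: fpsP => n; rewrite !(fps_mul_trunc _ _ (leqnn n)) mulrC.
Qed.

Fact fps_mulA : associative fps_mul.
Proof.
move=> f g h; apply: fpsP => n.
have -> : fps_mul f (fps_mul g h) = fps_mul (fps_mul g h) f by rewrite fps_mulC.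
rewrite (@coef_truncl n (trunc n g * trunc n h)); last by move=> i /fps_mul_trunc.
rewrite (@coef_truncl n (trunc n f * trunc n g)); last by move=> i /fps_mul_trunc.
by rewrite mulrC mulrA.
Qed.

Fact fps_mul1 : left_id (fpsC 1) fps_mul.
Proof.
move=> f; apply: fpsP => n /=; rewrite big_ord_recl /= mul1r subn0.
by rewrite big1 ?addr0 // => i _; rewrite mul0r.
Qed.

Fact fps_mulD : left_distributive fps_mul (@fps_add A).
Proof.
move=> f g h; apply: fpsP => n /=; rewrite -big_split /=.
by apply: eq_bigr => i _; rewrite mulrDl.
Qed.

Fact fps_one_neq0 : fpsC 1 != 0.
Proof. by apply/eqP => /(congr1 (@fps_coef A ^~ 0%N)) /eqP; rewrite /= oner_eq0. Qed.

HB.instance Definition _ := GRing.Zmodule_isComNzRing.Build {fps A}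
  fps_mulA fps_mulC fps_mul1 fps_mulD fps_one_neq0.

Lemma fps_coef1 i : (1 : {fps A}) i = (i == 0%N)%:R.
Proof. by rewrite /=; case: eqP. Qed.
Lemma fps_coefM f g n : (f * g) n = \sum_(i < n.+1) f i * g (n - i)%N.
Proof. by []. Qed.

End FpsRing.

Section FpsUnit.
Variable A : comUnitRingType.
Implicit Types f g h : {fps A}.

(* The coefficients of index at most n of the inverse of f, computed from
   g_0 = f_0^-1 and g_n = - f_0^-1 * \sum_(1 <= i <= n) f_i g_(n-i). *)
Fixpoint fps_inv_seq f n : seq A :=
  if n is k.+1 then
    let s := fps_inv_seq f k in
    rcons s (- (f 0%N)^-1 * \sum_(i < n) f i.+1 * s`_(k - i))
  else [:: (f 0%N)^-1].

Definition fps_unit : {pred {fps A}} := [pred f : {fps A} | f 0%N \is a GRing.unit].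

Definition fps_inv f : {fps A} :=
  if f \in fps_unit then FPS (fun n => (fps_inv_seq f n)`_n) else f.

Let size_inv_seq f n : size (fps_inv_seq f n) = n.+1.
Proof. by elim: n => //= n IHn; rewrite size_rcons IHn. Qed.

Let nth_inv_seq f n k :
  (k <= n)%N -> (fps_inv_seq f n)`_k = (fps_inv_seq f k)`_k.
Proof.
elim: n => [|n IHn]; first by case: k.
rewrite leq_eqVlt => /orP [/eqP -> //|]; rewrite ltnS => kn.
by rewrite /= nth_rcons size_inv_seq ltnS kn IHn.
Qed.

Fact fps_mulV : {in fps_unit, left_inverse 1 fps_inv *%R}.
Proof.
move=> f fU; rewrite mulrC /fps_inv fU; move: fU; rewrite inE => fU.
apply: fpsP => n; rewrite fps_coefM big_ord_recl /= subn0.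
case: n => [|n]; first by rewrite big_ord0 addr0 mulrV.
rewrite /= nth_rcons size_inv_seq ltnn eqxx mulrA mulrN divrr // mulN1r.
apply/eqP; rewrite addrC subr_eq0; apply/eqP; apply: eq_bigr => i _.
by rewrite /bump /= add1n subSS (@nth_inv_seq f n) // leq_subr.
Qed.

Fact fps_unitP f g : g * f = 1 -> fps_unit f.
Proof.
move=> /(congr1 (@fps_coef A ^~ 0%N)); rewrite /= big_ord1 => gf.
by apply/unitrP; exists (g 0%N); split; rewrite // mulrC.
Qed.

Fact fps_inv_out : {in [predC fps_unit], fps_inv =1 id}.
Proof. by move=> f; rewrite inE /= /fps_inv => /negbTE ->. Qed.

HB.instance Definition _ := GRing.ComNzRing_hasMulInverse.Build {fps A}
  fps_mulV fps_unitP fps_inv_out.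

End FpsUnit.

(* (A; x)_N *)
Definition qpoch (S : pzRingType) (A x : S) (N : nat) : S :=
  \prod_(j < N) (1 - A * x ^+ j).

(* N and M are integers: M is negative for some i in [hallg] below when mu is
   not contained in lam, and [hallg] is then 0. Hence in terms with a nonzero
   coefficient the subtraction m * n + |lam| - 2 * |mu| is never truncated. *)
Definition qbinom (F : fieldType) (x : F) (N M : int) : F :=
  if (0 <= M) && (M <= N)
  then qpoch x x `|N|%N / (qpoch x x `|M|%N * qpoch x x `|N - M|%N)
  else 0.

(* Partitions are weakly decreasing sequences of naturals, in which trailing
   zeros are allowed and irrelevant. The partitions contained in (m^n) are
   represented by the sequences of length exactly n, padded with zeros. *)
Definition box_partitions (m n : nat) : seq (seq nat) :=
  [seq s <- [seq map val (val t) | t <- enum {: n.-tuple 'I_m.+1}]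
     | sorted geq s].

Lemma mem_box_partitions (m n : nat) (s : seq nat) :
  (s \in box_partitions m n) =
  [&& sorted geq s, size s == n & all (fun p => p <= m)%N s].
Proof.
rewrite mem_filter; congr (_ && _); apply/mapP/andP => [[t _ ->]|[/eqP sn sm]].
  rewrite size_map size_tuple eqxx; split=> //.
  by apply/allP => _ /mapP [i _ ->]; rewrite -ltnS ltn_ord.
have sz : size (map (@inord m) s) == n by rewrite size_map sn.
exists (Tuple sz); first by rewrite mem_enum.
rewrite /= -map_comp -[LHS]map_id; apply/eq_in_map => p /(allP sm) pm /=.
by rewrite inordK.
Qed.

Lemma uniq_box_partitions (m n : nat) : uniq (box_partitions m n).
Proof.
apply: filter_uniq; rewrite map_inj_uniq ?enum_uniq // => s t.
by move=> /(inj_map val_inj) /val_inj.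
Qed.

(* The i-th part of the conjugate partition, for i >= 1. *)
Definition conjpart (lam : seq nat) (i : nat) : nat := count (leq i) lam.

(* The products over i >= 1 below stop at the largest part: all later factors
   are equal to 1 and all later exponents are equal to 0. *)
Definition hallg (F : fieldType) (lam mu : seq nat) (x : F) : F :=
  let b := (maxn (head 0 lam) (head 0 mu)).+1%N in
  let l i := (conjpart lam i)%:Z in
  let u i := (conjpart mu i)%:Z in
  x ^ (\sum_(1 <= i < b) u i * (l i - u i)) *
  \prod_(1 <= i < b) qbinom x^-1 (l i - u i.+1) (l i - u i).

Definition aut_poly (F : fieldType) (lam : seq nat) (x : F) : F :=
  let b := (head 0 lam).+1%N in
  x ^+ (\sum_(1 <= i < b) conjpart lam i ^ 2)%N *
  \prod_(1 <= i < b)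
    qpoch x^-1 x^-1 (conjpart lam i - conjpart lam i.+1)%N.

Definition Bcoef (F : fieldType) (m n : nat) (lam mu : seq nat) (x : F) : F :=
  let box := nseq n m in
  (hallg box lam (x ^+ 2) * hallg lam mu x
     * (aut_poly lam (x ^+ 2) / aut_poly lam x)) /
  (hallg box mu (x ^+ 2) * (aut_poly mu (x ^+ 2) / aut_poly mu x)).

Local Open Scope classical_set_scope.
Local Open Scope card_scope.

Section Zeta.
Variable S : comNzRingType.

Definition free_module (A : set S) (n : nat) : set 'rV[S]_n :=
  [set v | forall j, A (v 0 j)].
Arguments free_module : clear implicits.

(* A is meant to be (the carrier of) a subring of S. *)
Definition is_submodule (A : set S) (n : nat) (M L : set 'rV[S]_n) : Prop :=
  [/\ L `<=` M, L 0,
      forall x y, L x -> L y -> L (x + y) &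
      forall a x, A a -> L x -> L (a *: x)].

Definition cosets (n : nat) (M L : set 'rV[S]_n) : set (set 'rV[S]_n) :=
  [set [set y | M y /\ L (y - x)] | x in M].

Definition submodules_of_index (A : set S) (n N : nat) :
    set (set 'rV[S]_n) :=
  [set L | is_submodule A (free_module A n) L /\
           cosets (free_module A n) L #= `I_N].
Arguments submodules_of_index : clear implicits.

(* The zeta function of A^n over A as a series in t = q^{-s}: a submodule of
   index q^k contributes q^{-ks} = t^k. This is the right encoding when every
   finite index is a power of q, as for algebras over a field with q elements,
   and when there are finitely many submodules of each index ([fset_set] sends
   infinite sets to the empty set); both hold for the two rings below. *)
Definition zeta (q : nat) (A : set S) (n : nat) : {fps rat} :=
  FPS (fun k => (#|` fset_set (submodules_of_index A n (q ^ k)%N)|)%:R).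

End Zeta.

Section Order.
Variables (F : finFieldType) (K : fieldExtType F).

(* F[[T]] + T^m K[[T]] inside K[[T]]; membership in 1%VS says that an element
   of K lies in the base field F. *)
Definition order_ring (m : nat) : set {fps K} :=
  [set f | exists g h : {fps K},
     (forall i, g i \in 1%VS) /\ f = g + fpsX K ^+ m * h].

Arguments order_ring : clear implicits.

Definition normalization : set {fps K} := setT.
Arguments normalization : clear implicits.

Definition nu (q m n : nat) : {fps rat} :=
  zeta q (order_ring m) n / zeta q normalization n.

End Order.

Arguments order_ring {F} K m _.
Arguments normalization {F} K _.
Arguments nu {F} K q m n.

(* Main.v *)
From HB Require Import structures.
From mathcomp Require Import all_boot all_order all_algebra all_fingroup all_field.
From mathcomp Require Import finmap.
From mathcomp Require Import boolp classical_sets cardinality.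
From mathcomp Require Import zify ring.
Require Import Defs.

Set Implicit Arguments.
Unset Strict Implicit.
Unset Printing Implicit Defensive.

Import Order.TTheory GRing.Theory Num.Theory.

Local Open Scope classical_set_scope.
Local Open Scope card_scope.
Local Open Scope ring_scope.

(** Write [q] for the order of [F] and [Q = q^2] for that of [K], and fix [alpha]
    in [K] outside [F], so that [K = F + alpha F]. The ring attached to [m] is
    [R = F[[T]] + T^m K[[T]]].

    Structure. Let [L] be a submodule of finite index in [R^n]. Among the families
    of [n] vectors of [L] with nonzero determinant, one whose determinant has the
    least valuation is a basis of [K[[T]] L], by Cramer's rule. Attach to each
    vector [b_i] of such a basis an exponent [lam_i <= m] such that [L] contains
    [alpha T^(lam_i) b_i]. When the sum of the [lam_i] is least, [L] is the direct
    sum of the [(F[[T]] + T^(lam_i) K[[T]]) b_i]. After rescaling, [L] is given by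
    its type [lam], a partition in the box, and by a frame: a matrix [b] whose row
    [i] has entries in [F[[T]] + T^(lam_i) K[[T]]] ([lattice_normal_form]). The type
    is unique, and the frame is unique up to the automorphism group of the type
    ([lat_eq_type]). If [\det b] has valuation [d], the index of [L] is
    [q^(2 d + m n - |lam|)] ([lat_index]).

    Counting. For the Haar measure on matrices over [K[[T]]], multiplication by a
    frame scales volumes by [Q^-(n d)]; so the number of submodules of type [lam]
    and valuation [d] is [Q^(n d)] times the volume of the frames, divided by the
    volume of the automorphism group ([card_lattices_type]). The latter is found by
    choosing the constant terms row by row; it is [a_lam(q)] times a Pochhammer
    symbol and a power of [q] ([vol_aut_closed]).

    Frames. A row for the largest part of [lam] is either unimodular, and column
    operations remove it, or divisible by [T], and division lowers that part and
    [d] by 1 ([frames_vol_step]). Treat in this way all the parts equal to the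
    maximum: the number of rows removed is distributed like the rank of a random
    matrix over [F]. Iterating until all the parts are 0 gives a sum over the
    partitions [mu] whose parts equal to [k] are the rows removed when the maximum
    was [k] ([peel_layers]); this is the origin of [mu] in the formula. The
    [n - mu'_1] rows left have entries in [K[[T]]], and their series is a product of
    geometric series whose denominators are the last factors of [(t^2; q^2)_n]
    ([qpoch_frame_series]); what remains of that symbol is [(t^2; q^2)_(mu'_1)].

    The coefficients agree with those of the formula because the product of
    [g^(m^n)_mu(x)] by [a_mu(x)], the number of injections of a module of type [mu]
    into a free one, is elementary ([hall_aut_poly], [coef_identity]). All of this
    holds for [m = 0] as well, where it evaluates the series of the normalization. *)

(** * Matrices of power series over a finite field *)

Section Constants.
Variable A : comNzRingType.

Fact fpsC_additive : zmod_morphism (@fpsC A).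
Proof. by move=> a b; apply: fpsP => l /=; case: eqP => //; rewrite subr0. Qed.
Fact fpsC_multiplicative : monoid_morphism (@fpsC A).
Proof.
split=> // a b; apply: fpsP => l.
rewrite fps_coefM /= big_ord_recl /= subn0 big1 ?addr0; last by move=> i _; rewrite mul0r.
by case: eqP => //; rewrite mulr0.
Qed.
HB.instance Definition _ := GRing.isZmodMorphism.Build A {fps A} (@fpsC A) fpsC_additive.
HB.instance Definition _ := GRing.isMonoidMorphism.Build A {fps A} (@fpsC A) fpsC_multiplicative.

Lemma coef_fpsCM (a : A) (f : {fps A}) l : (fpsC a * f) l = a * f l.
Proof.
rewrite fps_coefM big_ord_recl /= subn0 big1 ?addr0 // => i _.
by rewrite mul0r.
Qed.

Lemma coef_fpsXM (f : {fps A}) l : (fpsX A * f) l = if l is l'.+1 then f l' else 0.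
Proof.
rewrite fps_coefM; case: l => [|l].
  by rewrite big_ord1 /= mul0r.
rewrite big_ord_recl /= mul0r add0r big_ord_recl /= mul1r subn1 /=.
by rewrite big1 ?addr0 // => i _; rewrite mul0r.
Qed.

Lemma coef_fpsXnM d (f : {fps A}) l :
  (fpsX A ^+ d * f) l = if (l < d)%N then 0 else f (l - d)%N.
Proof.
elim: d l => [|d IHd] l; first by rewrite expr0 mul1r subn0.
by rewrite exprS -mulrA coef_fpsXM; case: l => [//|l]; rewrite IHd subSS ltnS.
Qed.

Lemma coef_fpsXn d l : (fpsX A ^+ d) l = (l == d)%:R.
Proof.
rewrite -[fpsX A ^+ d]mulr1 coef_fpsXnM fps_coef1 subn_eq0.
by case: ltngtP.
Qed.

End Constants.

Section Series.
Variable K : finFieldType.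
Implicit Types (f g h : {fps K}) (d l : nat).

Lemma fps_coefC (a : K) l : fpsC a l = if l == 0%N then a else 0.
Proof. by []. Qed.

Definition fps_shift d f : {fps K} := FPS (fun l => f (d + l)%N).

Lemma fps_shiftE d f l : fps_shift d f l = f (d + l)%N. Proof. by []. Qed.

Lemma fpsXn_shift d f :
  (forall l, (l < d)%N -> f l = 0) -> f = fpsX K ^+ d * fps_shift d f.
Proof.
move=> f0; apply: fpsP => l; rewrite coef_fpsXnM.
by case: ltnP => [/f0 //|dl]; rewrite fps_shiftE subnKC.
Qed.

Lemma fps_unitE f : (f \is a GRing.unit) = (f 0%N != 0).
Proof. by rewrite -unitfE. Qed.

Lemma fps_coef0M f g : (f * g) 0%N = f 0%N * g 0%N.
Proof. by rewrite fps_coefM big_ord1. Qed.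

Definition has_val d f := (forall l, (l < d)%N -> f l = 0) /\ f d != 0.

Lemma has_valP d f :
  has_val d f <-> exists2 u, u \is a GRing.unit & f = fpsX K ^+ d * u.
Proof.
split=> [[f0 fd]|[u uU ->]].
  exists (fps_shift d f); last exact: fpsXn_shift.
  by rewrite fps_unitE fps_shiftE addn0.
split=> [l ld|]; first by rewrite coef_fpsXnM ld.
by rewrite coef_fpsXnM ltnn subnn -fps_unitE.
Qed.

Lemma has_val0 f : has_val 0 f <-> f \is a GRing.unit.
Proof. by rewrite fps_unitE; split=> [[]|] //; split. Qed.

Lemma has_val_unitM d u f :
  u \is a GRing.unit -> has_val d (u * f) <-> has_val d f.
Proof.
move=> uU; rewrite !has_valP; split=> -[v vU e].
  by exists (u^-1 * v); rewrite ?unitrM ?unitrV ?uU // mulrCA -e mulKr.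
by exists (u * v); rewrite ?unitrM ?uU // e mulrCA.
Qed.

Lemma has_val_XnM d e f : has_val (d + e) (fpsX K ^+ d * f) <-> has_val e f.
Proof.
split=> -[f0 fd]; split.
- move=> l le; move: (f0 (d + l)%N); rewrite coef_fpsXnM ltn_add2l.
  by rewrite [(_ + _ < d)%N]ltnNge leq_addr /= addKn => ->.
- by move: fd; rewrite coef_fpsXnM ltnNge leq_addr /= addKn.
- move=> l lde; rewrite coef_fpsXnM; case: ltnP => // dl.
  by apply: f0; rewrite ltn_subLR.
by rewrite coef_fpsXnM ltnNge leq_addr /= addKn.
Qed.

Lemma has_val_XM d f : has_val d.+1 (fpsX K * f) <-> has_val d f.
Proof. by have := has_val_XnM 1 d f; rewrite expr1. Qed.

Lemma has_valM d e f g : has_val d f -> has_val e g -> has_val (d + e) (f * g).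
Proof.
move=> /has_valP[u uU ->] ge; rewrite -mulrA has_val_XnM.
by rewrite has_val_unitM.
Qed.

Lemma has_val_exists f : f != 0 -> exists d, has_val d f.
Proof.
move=> fn0; have ex : exists l, f l != 0.
  apply: contrapT => /forallNP H; case/eqP: fn0; apply: fpsP => l.
  by apply/eqP; apply: contrapT => /negP; apply: H.
exists (ex_minn ex); case: ex_minnP => d fd dmin; split=> // l ld.
by apply/eqP/negPn/negP => /dmin; rewrite leqNgt ld.
Qed.

Lemma has_val_neq0 d f : has_val d f -> f != 0.
Proof. by move=> [_ fd]; apply: contraNneq fd => ->. Qed.

Lemma has_val_lreg d f : has_val d f -> GRing.lreg f.
Proof.
move=> /has_valP[u uU ->] g h /(congr1 ( *%R u^-1)).
rewrite -!mulrA ![u^-1 * (fpsX K ^+ d * _)]mulrCA !mulKr // => e.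
apply: fpsP => l; move: (congr1 (fun k : {fps K} => k (d + l)%N) e).
by rewrite !coef_fpsXnM ltnNge leq_addr /= addKn.
Qed.

Lemma has_val_dvd d f g :
  has_val d f -> (forall l, (l < d)%N -> g l = 0) -> exists h, g = f * h.
Proof.
move=> /has_valP[u uU ->] /fpsXn_shift ->.
by exists (u^-1 * fps_shift d g); rewrite mulrA mulrK ?mulrA // mulrK.
Qed.

Definition coef0 f : K := f 0%N.
Fact coef0_additive : zmod_morphism coef0. Proof. by []. Qed.
Fact coef0_multiplicative : monoid_morphism coef0.
Proof. by split=> // f g; rewrite /coef0 fps_coef0M. Qed.
HB.instance Definition _ := GRing.isZmodMorphism.Build {fps K} K coef0 coef0_additive.
HB.instance Definition _ := GRing.isMonoidMorphism.Build {fps K} K coef0 coef0_multiplicative.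

Fact layer_key : unit. Proof. by []. Qed.

Section Layers.
Variables p n : nat.
Implicit Types x y : 'M[{fps K}]_(p, n).

Definition layer l x : 'M[K]_(p, n) := \matrix_(i, j) x i j l.

Lemma layerD l x y : layer l (x + y) = layer l x + layer l y.
Proof. by apply/matrixP => i j; rewrite !mxE. Qed.

Definition mxT x := locked_with layer_key (fpsX K *: x).
Definition mxTn e x := locked_with layer_key (fpsX K ^+ e *: x).
Definition mxC (c : 'M[K]_(p, n)) : 'M[{fps K}]_(p, n) :=
  locked_with layer_key (map_mx (@fpsC K) c).

Lemma mxTE x : mxT x = fpsX K *: x. Proof. by rewrite /mxT unlock. Qed.
Lemma mxTnE e x : mxTn e x = fpsX K ^+ e *: x. Proof. by rewrite /mxTn unlock. Qed.
Lemma mxCE c : mxC c = map_mx (@fpsC K) c. Proof. by rewrite /mxC unlock. Qed.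

Lemma layer_mxTn e l x :
  layer l (mxTn e x) = if (l < e)%N then 0 else layer (l - e) x.
Proof.
by rewrite mxTnE; apply/matrixP => i j; rewrite !mxE coef_fpsXnM; case: ltnP; rewrite mxE.
Qed.

Lemma layer0_mxT x : layer 0 (mxT x) = 0.
Proof. by rewrite mxTE; apply/matrixP => i j; rewrite !mxE coef_fpsXM. Qed.

Lemma layerS_mxT l x : layer l.+1 (mxT x) = layer l x.
Proof. by rewrite mxTE; apply/matrixP => i j; rewrite !mxE coef_fpsXM. Qed.

Lemma layer_mxC l c : layer l (mxC c) = if l == 0%N then c else 0.
Proof. by rewrite mxCE; apply/matrixP => i j; rewrite !mxE fps_coefC; case: eqP; rewrite ?mxE. Qed.

(** Congruence modulo [T^e]; see [eqmP]. *)
Definition eqm e x y := forall l, (l < e)%N -> layer l x = layer l y.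

Lemma eqmP e x y : eqm e x y <-> exists w, x = y + mxTn e w.
Proof.
split=> [exy|[w ->] l le].
  exists (map_mx (fps_shift e) (x - y)); rewrite mxTnE; apply/matrixP => i j.
  rewrite !mxE -fpsXn_shift; first by rewrite addrC subrK.
  move=> l /exy /matrixP /(_ i j); rewrite !mxE => exyl.
  by rewrite fps_coefD fps_coefN exyl subrr.
by rewrite layerD layer_mxTn le addr0.
Qed.

Lemma eqm_refl e x : eqm e x x. Proof. by []. Qed.
Lemma eqm_sym e x y : eqm e x y -> eqm e y x.
Proof. by move=> exy l le; rewrite exy. Qed.
Lemma eqm_trans e x y z : eqm e x y -> eqm e y z -> eqm e x z.
Proof. by move=> exy eyz l le; rewrite exy // eyz. Qed.
Lemma eqmW e e' x y : (e <= e')%N -> eqm e' x y -> eqm e x y.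
Proof. by move=> ee exy l le; apply: exy; apply: leq_trans ee. Qed.
Lemma eqmE e x y i j l : eqm e x y -> (l < e)%N -> x i j l = y i j l.
Proof. by move=> exy /exy /matrixP /(_ i j); rewrite !mxE. Qed.

End Layers.

Lemma eqmM p n r e (x x' : 'M[{fps K}]_(p, n)) (y y' : 'M[{fps K}]_(n, r)) :
  eqm e x x' -> eqm e y y' -> eqm e (x *m y) (x' *m y').
Proof.
move=> /eqmP[w ex] /eqmP[v ey]; apply: (@eqm_trans _ _ e _ (x' *m y)).
  by apply/eqmP; exists (w *m y); rewrite ex mulmxDl !mxTnE -scalemxAl.
by apply/eqmP; exists (x' *m v); rewrite ey mulmxDr !mxTnE -scalemxAr.
Qed.

Lemma eqm_det n e (x y : 'M[{fps K}]_n) l :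
  eqm e x y -> (l < e)%N -> (\det x) l = (\det y) l.
Proof.
move=> exy le.
pose eqf (f g : {fps K}) := forall k, (k < e)%N -> f k = g k.
suff : eqf (\det x) (\det y) by apply.
apply: (big_ind2 eqf) => // [f f' g g' ef eg k ke|s _].
  by rewrite !fps_coefD ef ?eg.
have: eqf (\prod_i x i (s i)) (\prod_i y i (s i)).
  apply: (big_ind2 eqf) => // [f f' g g' ef eg k ke|i _ k ke].
    rewrite !fps_coefM; apply: eq_bigr => -[i /= ik] _.
    by rewrite ef ?eg //; lia.
  exact: eqmE exy ke.
move=> H k ke; rewrite !fps_coefM; apply: eq_bigr => -[i /= ik] _.
by rewrite H //; lia.
Qed.

Lemma unitmx_layer0 n (g : 'M[{fps K}]_n) :
  (g \in unitmx) = (layer 0 g \in unitmx).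
Proof.
rewrite !unitmxE fps_unitE unitfE.
have -> : layer 0 g = map_mx coef0 g by apply/matrixP => i j; rewrite !mxE.
by rewrite det_map_mx.
Qed.

Lemma unitmx_val0 n (g : 'M[{fps K}]_n) : g \in unitmx <-> has_val 0 (\det g).
Proof. by rewrite unitmxE has_val0. Qed.

(** Multiplying by the adjugate of [b] leaves the scalar [\det b] to cancel. *)
Lemma mulmx_rcancel p n d (b : 'M[{fps K}]_n) (x y : 'M_(p, n)) :
  has_val d (\det b) -> x *m b = y *m b -> x = y.
Proof.
move=> vb /(congr1 (mulmxr (\adj b))) /=; rewrite -!mulmxA mul_mx_adj.
rewrite !mul_mx_scalar => /matrixP e; apply/matrixP => i j.
by move: (e i j); rewrite !mxE; apply: (has_val_lreg vb).
Qed.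

Lemma mxC_unit n (c : 'M[K]_n) : (mxC c \in unitmx) = (c \in unitmx).
Proof. by rewrite unitmx_layer0 layer_mxC eqxx. Qed.

Lemma layer0M p n r (x : 'M[{fps K}]_(p, n)) (y : 'M[{fps K}]_(n, r)) :
  layer 0 (x *m y) = layer 0 x *m layer 0 y.
Proof.
have E p' n' (z : 'M[{fps K}]_(p', n')) : layer 0 z = map_mx coef0 z.
  by apply/matrixP => i j; rewrite !mxE.
by rewrite !E map_mxM.
Qed.

End Series.

(** * Volumes of sets of matrices *)

Section Volume.
Variable K : finFieldType.
Local Notation Q := (#|K|).
Local Notation "''N_' ( p , n )" := 'M[{fps K}]_(p, n) (at level 8, p, n at level 200).

Section Truncation.
Variables p n : nat.
Implicit Types (x y : 'N_(p, n)) (S : set 'N_(p, n)).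

Definition trunc e x : {ffun 'I_e -> 'M[K]_(p, n)} := [ffun l : 'I_e => layer l x].

Definition lift_trunc e (c : {ffun 'I_e -> 'M[K]_(p, n)}) : 'N_(p, n) :=
  \matrix_(i, j) FPS (fun l => if insub l is Some l' then c l' i j else 0).

Lemma trunc_eq e x y : trunc e x = trunc e y <-> eqm e x y.
Proof.
split=> [/ffunP exy l le|exy].
  by move: (exy (Ordinal le)); rewrite !ffunE.
by apply/ffunP => l; rewrite !ffunE; apply: exy.
Qed.

Lemma lift_truncK e : cancel (@lift_trunc e) (trunc e).
Proof.
move=> c; apply/ffunP => l; rewrite ffunE; apply/matrixP => i j.
by rewrite !mxE /= valK.
Qed.

Lemma trunc_lift e x : eqm e (lift_trunc (trunc e x)) x.
Proof. by apply/trunc_eq; rewrite lift_truncK. Qed.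

(** Sets that are unions of cosets of [T^e] for some [e]. They are the open and
    closed sets that occur below, and [vol] is the Haar measure of total mass 1
    on them; its value does not depend on the level [e], by [volE]. *)
Definition stable_at e S := forall x y, eqm e x y -> S x -> S y.
Definition stable S := exists e, stable_at e S.

Lemma stable_at_stable e S : stable_at e S -> stable S. Proof. by exists e. Qed.

Lemma stable_atW e e' S : (e <= e')%N -> stable_at e S -> stable_at e' S.
Proof. by move=> ee eS x y /(eqmW ee); apply: eS. Qed.

Definition cnt e S : nat :=
  #|[set c : {ffun 'I_e -> 'M[K]_(p, n)} | `[< S (lift_trunc c) >]]%SET|.
Definition vol_at e S : rat := (cnt e S)%:R / (Q ^ (p * n * e))%:R.
Definition vol S : rat := vol_at (xget 0%N [set e | stable_at e S]) S.

Lemma card_truncs e : #|{ffun 'I_e -> 'M[K]_(p, n)}| = (Q ^ (p * n * e))%N.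
Proof. by rewrite card_ffun card_mx card_ord -expnM. Qed.

Lemma Q_gt0 k : (0 < Q ^ k)%N.
Proof. by rewrite expn_gt0; apply/orP; left; apply/card_gt0P; exists 0. Qed.

Lemma Q_neq0 k : (Q ^ k)%:R != 0 :> rat.
Proof. by rewrite pnatr_eq0 -lt0n Q_gt0. Qed.

(** Representatives modulo [T^e] may be chosen freely, in particular along any
    change of variables. *)
Lemma cnt_reindex e S (X : finType) (r : X -> 'N_(p, n)) :
  stable_at e S -> injective (fun u => trunc e (r u)) ->
  #|X| = (Q ^ (p * n * e))%N ->
  cnt e S = #|[set u : X | `[< S (r u) >]]%SET|.
Proof.
move=> eS rinj cX.
have rbij : bijective (fun u => trunc e (r u)).
  by apply: (inj_card_bij rinj); rewrite card_truncs cX.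
rewrite /cnt -(on_card_preimset (onW_bij _ rbij)).
apply: eq_card => u; rewrite !inE; apply/asboolP/asboolP.
  by apply: eS; apply: trunc_lift.
by apply: eS; apply/eqm_sym; apply: trunc_lift.
Qed.

Lemma vol_at_succ e S : stable_at e S -> vol_at e.+1 S = vol_at e S.
Proof.
move=> eS; rewrite /vol_at.
pose r (u : 'M[K]_(p, n) * {ffun 'I_e -> 'M[K]_(p, n)}) : 'N_(p, n) :=
  lift_trunc u.2 + mxTn e (mxC u.1).
have rE (u : _ * _) : eqm e (lift_trunc u.2) (r u).
  by apply/eqm_sym/eqmP; exists (mxC u.1).
have rinj : injective (fun u => trunc e.+1 (r u)).
  move=> [c u] [c' u'] /trunc_eq E; have uu : u = u'.
    rewrite -(lift_truncK u) -(lift_truncK u'); apply/trunc_eq.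
    apply: eqm_trans (rE (c, u)) _; apply: eqm_trans (eqmW (leqnSn e) E) _.
    exact/eqm_sym/(rE (c', u')).
  rewrite -uu in E *; congr pair.
  have L v : layer e (r (v, u)) = layer e (lift_trunc u) + v.
    by rewrite layerD layer_mxTn ltnn subnn layer_mxC.
  exact: addrI (etrans (esym (L c)) (etrans (E e (ltnSn e)) (L c'))).
have cX : #|{: 'M[K]_(p, n) * {ffun 'I_e -> 'M[K]_(p, n)}}| = (Q ^ (p * n * e.+1))%N.
  by rewrite card_prod card_mx card_truncs -expnD -mulnS.
rewrite (cnt_reindex (stable_atW (leqnSn e) eS) rinj cX).
have -> : [set u | `[< S (r u) >]]%SET =
    finset.setX [set: 'M[K]_(p, n)]%SET [set c | `[< S (lift_trunc c) >]]%SET.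
  apply/setP => u; rewrite !inE /=; apply/asboolP/asboolP => H.
    by apply: eS H; apply/eqm_sym/rE.
  by apply: eS H; apply/rE.
rewrite cardsX cardsT card_mx natrM /cnt mulnS expnD natrM.
by rewrite -mulf_div divff ?mul1r ?Q_neq0.
Qed.

Lemma vol_at_level e e' S :
  stable_at e S -> (e <= e')%N -> vol_at e' S = vol_at e S.
Proof.
move=> eS /subnKC <-; elim: (e' - e)%N => [|k IHk]; first by rewrite addn0.
by rewrite addnS vol_at_succ //; apply: stable_atW eS; apply: leq_addr.
Qed.

Lemma volE e S : stable_at e S -> vol S = vol_at e S.
Proof.
move=> eS; rewrite /vol; set e0 := xget _ _.
have e0S : stable_at e0 S by apply: (@xgetPex _ 0%N [set e | stable_at e S]); exists e.
by case: (leqP e e0) => [|/ltnW] h; rewrite (vol_at_level _ h).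
Qed.

Lemma eq_vol S S' : (forall x, S x <-> S' x) -> vol S = vol S'.
Proof. by move=> H; congr vol; apply/funext => x; apply/propext. Qed.

Lemma vol_set0 S : (forall x, ~ S x) -> vol S = 0.
Proof.
move=> S0; rewrite (@volE 0) /vol_at; last by move=> x y _ /S0.
rewrite /cnt eq_card0 ?mul0r // => c; rewrite !inE.
by apply/negP => /asboolP /S0.
Qed.

Lemma vol_setT S : (forall x, S x) -> vol S = 1.
Proof.
move=> ST; rewrite (@volE 0) /vol_at; last by move=> x y _ _.
rewrite /cnt (@eq_card _ _ predT) ?card_truncs ?divff ?Q_neq0 // => c.
by rewrite !inE; apply/asboolP.
Qed.

Lemma stableI S S' : stable S -> stable S' -> stable (fun x => S x /\ S' x).
Proof.
move=> [e eS] [e' eS']; exists (maxn e e') => x y exy [H H']; split.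
  by apply: eS H; apply: eqmW exy; rewrite leq_maxl.
by apply: eS' H'; apply: eqmW exy; rewrite leq_maxr.
Qed.

Lemma vol_disjointU S S' :
  stable S -> stable S' -> (forall x, S x -> S' x -> False) ->
  vol (fun x => S x \/ S' x) = vol S + vol S'.
Proof.
move=> [e0 eS] [e1 eS'] dis; pose e := maxn e0 e1.
have {}eS : stable_at e S by apply: stable_atW eS; rewrite leq_maxl.
have {}eS' : stable_at e S' by apply: stable_atW eS'; rewrite leq_maxr.
have eU : stable_at e (fun x => S x \/ S' x).
  by move=> x y exy [/(eS _ _ exy)|/(eS' _ _ exy)]; [left|right].
rewrite !(volE eS, volE eS', volE eU) /vol_at -mulrDl -natrD /cnt.
rewrite -[in RHS]cardsUI [X in (_ + X)%N]eq_card0 ?addn0; last first.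
  by move=> c; rewrite !inE; apply/negP => /andP[/asboolP a /asboolP /(dis _ a)].
congr (_%:R / _); apply: eq_card => c.
by rewrite !inE; apply/asboolP/orP => -[/asboolP|/asboolP]; tauto.
Qed.

(** This replaces Lagrange's theorem in the proof that an inclusion of lattices
    is an equality: at a common level, the two sets of truncations are finite,
    nested and of the same cardinal. *)
Lemma vol_sub_eq S S' :
  stable S -> stable S' -> (forall x, S x -> S' x) -> vol S = vol S' ->
  forall x, S' x -> S x.
Proof.
move=> [e0 eS] [e1 eS'] sub; pose e := maxn e0 e1.
have {}eS : stable_at e S by apply: stable_atW eS; rewrite leq_maxl.
have {}eS' : stable_at e S' by apply: stable_atW eS'; rewrite leq_maxr.
rewrite (volE eS) (volE eS') /vol_at => /(mulIf _) H x S'x.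
have {}H : cnt e S = cnt e S'.
  by apply/eqP; rewrite -(eqr_nat rat); apply/eqP/H; rewrite invr_eq0 Q_neq0.
have : [set c | `[< S (lift_trunc c) >]]%SET ==
       [set c : {ffun 'I_e -> _} | `[< S' (lift_trunc c) >]]%SET.
  rewrite eqEcard; move: H; rewrite /cnt => ->; rewrite leqnn andbT.
  apply/fintype.subsetP => c; rewrite !inE; exact: sub.
move=> /eqP/setP /(_ (trunc e x)); rewrite !finset.in_set => E.
have Sx' : S' (lift_trunc (trunc e x)).
  by apply: eS' S'x; apply/eqm_sym; apply: trunc_lift.
have Sx : S (lift_trunc (trunc e x)) by apply/asboolP; rewrite E; apply/asboolP.
exact: (eS _ _ (@trunc_lift e x) Sx).
Qed.

(** The first layer of a random matrix is uniform and independent of the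
    following ones. *)
Lemma vol_layers (A : set 'M[K]_(p, n)) S S' :
  stable S' -> (forall c x, S (mxC c + mxT x) <-> A c /\ S' x) ->
  stable S /\
  vol S = #|[set c | `[< A c >]]%SET|%:R / (Q ^ (p * n))%:R * vol S'.
Proof.
move=> [e eS'] SE.
have dec x : x = mxC (layer 0 x) + mxT (map_mx (fps_shift 1) x).
  rewrite mxCE mxTE; apply/matrixP => i j; rewrite !mxE; apply: fpsP => -[|l].
    by rewrite fps_coefD coef_fpsXM /= addr0.
  by rewrite fps_coefD coef_fpsXM /= add0r add1n.
have SE' x : S x <-> A (layer 0 x) /\ S' (map_mx (fps_shift 1) x).
  by rewrite {1}(dec x).
have eS : stable_at e.+1 S.
  move=> x y exy /SE'[Ac S'x]; apply/SE'; rewrite -(exy 0%N) //; split=> //.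
  apply: eS' S'x => l le; apply/matrixP => i j.
  by rewrite !mxE !fps_shiftE add1n; apply: eqmE exy _.
split; first by exists e.+1.
rewrite (volE eS) (volE eS') /vol_at.
pose r (u : 'M[K]_(p, n) * {ffun 'I_e -> 'M[K]_(p, n)}) : 'N_(p, n) :=
  mxC u.1 + mxT (lift_trunc u.2).
have r0 u : layer 0 (r u) = u.1.
  by rewrite layerD layer0_mxT addr0 layer_mxC eqxx.
have rS u l : layer l.+1 (r u) = layer l (lift_trunc u.2).
  by rewrite layerD layerS_mxT layer_mxC add0r.
have rinj : injective (fun u => trunc e.+1 (r u)).
  move=> [c u] [c' u'] /trunc_eq E; congr pair.
    exact: etrans (esym (r0 (c, u))) (etrans (E 0%N isT) (r0 (c', u'))).
  rewrite -(lift_truncK u) -(lift_truncK u'); apply/trunc_eq => l le.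
  exact: etrans (esym (rS (c, u) l)) (etrans (E l.+1 le) (rS (c', u') l)).
have cX : #|{: 'M[K]_(p, n) * {ffun 'I_e -> 'M[K]_(p, n)}}| = (Q ^ (p * n * e.+1))%N.
  by rewrite card_prod card_mx card_truncs -expnD -mulnS.
rewrite (cnt_reindex eS rinj cX).
have -> : [set u | `[< S (r u) >]]%SET =
    finset.setX [set c | `[< A c >]]%SET [set c | `[< S' (lift_trunc c) >]]%SET.
  apply/setP => u; rewrite !inE /=; apply/asboolP/andP; rewrite /r SE.
    by move=> [? ?]; split; apply/asboolP.
  by move=> [/asboolP ? /asboolP].
by rewrite cardsX natrM /cnt mulnS expnD natrM mulf_div.
Qed.

End Truncation.

(** An invertible matrix permutes the residues modulo [T^e]. *)
Lemma vol_mulr p n (g : 'M[{fps K}]_n) (S : set 'N_(p, n)) :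
  g \in unitmx -> stable S -> vol (fun x => S (x *m g)) = vol S.
Proof.
move=> gU [e eS].
have eS' : stable_at e (fun x => S (x *m g)).
  by move=> x y exy; apply: eS; apply: eqmM exy _.
rewrite (volE eS) (volE eS') /vol_at; congr (_%:R / _).
have rinj : injective (fun c => trunc e (@lift_trunc p n e c *m g)).
  move=> c c' /trunc_eq H.
  have := eqmM H (@eqm_refl _ _ _ e (invmx g)).
  rewrite -!mulmxA mulmxV // !mulmx1 => H'.
  by rewrite -(lift_truncK c) -(lift_truncK c'); apply/trunc_eq/H'.
by rewrite (cnt_reindex eS rinj (card_truncs p n e)).
Qed.

Lemma stable_mulr p n r (g : 'M[{fps K}]_(n, r)) (S : set 'N_(p, r)) :
  stable S -> stable (fun x => S (x *m g)).
Proof. by move=> [e eS]; exists e => x y exy; apply: eS; apply: eqmM exy _. Qed.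

Lemma eqm_tr p n e (x y : 'N_(p, n)) : eqm e x y -> eqm e x^T y^T.
Proof. by move=> exy l le; apply/matrixP => i j; rewrite !mxE; apply: eqmE le. Qed.

Lemma vol_tr p n (S : set 'N_(p, n)) :
  stable S -> stable (fun x => S x^T) /\ vol (fun x => S x^T) = vol S.
Proof.
move=> [e eS]; have eS' : stable_at e (fun x => S x^T).
  by move=> x y /eqm_tr; apply: eS.
split; first by exists e.
rewrite (volE eS) (volE eS') /vol_at [(n * p)%N]mulnC; congr (_%:R / _).
have rinj : injective (fun c => trunc e (@lift_trunc n p e c)^T).
  move=> c c' /trunc_eq /eqm_tr; rewrite !trmxK => H.
  by rewrite -(lift_truncK c) -(lift_truncK c'); apply/trunc_eq/H.
have cX : #|{ffun 'I_e -> 'M[K]_(n, p)}| = (Q ^ (p * n * e))%N.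
  by rewrite card_truncs [(n * p)%N]mulnC.
by rewrite (cnt_reindex eS rinj cX).
Qed.

Lemma vol_mull p n (g : 'M[{fps K}]_p) (S : set 'N_(p, n)) :
  g \in unitmx -> stable S -> vol (fun x => S (g *m x)) = vol S.
Proof.
move=> gU sS; have [sS' <-] := vol_tr sS.
rewrite -(@vol_mulr _ _ g^T) ?unitmx_tr //.
have [_ <-] := vol_tr (stable_mulr g^T sS').
by apply: eq_vol => x; rewrite trmx_mul !trmxK.
Qed.

Lemma eqm_col p1 p2 n e (x x' : 'N_(p1, n)) (y y' : 'N_(p2, n)) :
  eqm e (col_mx x y) (col_mx x' y') <-> eqm e x x' /\ eqm e y y'.
Proof.
have L l : layer l (col_mx x y) = col_mx (layer l x) (layer l y).
  by apply/matrixP => i j; rewrite !mxE; case: fintype.split => k; rewrite !mxE.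
have L' l : layer l (col_mx x' y') = col_mx (layer l x') (layer l y').
  by apply/matrixP => i j; rewrite !mxE; case: fintype.split => k; rewrite !mxE.
split=> [H|[H H'] l le]; last by rewrite L L' H ?H'.
by split=> l le; move: (H l le); rewrite L L' => /eq_col_mx[].
Qed.

Section Fubini.
Variables p1 p2 n : nat.
Implicit Types S : set 'N_(p1 + p2, n).

Lemma stable_at_colu e S y : stable_at e S -> stable_at e (fun x => S (col_mx x y)).
Proof. by move=> eS x x' exx; apply: eS; apply/eqm_col. Qed.

Lemma stable_at_cold e S x : stable_at e S -> stable_at e (fun y => S (col_mx x y)).
Proof. by move=> eS y y' eyy; apply: eS; apply/eqm_col. Qed.

Let r e (u : {ffun 'I_e -> 'M[K]_(p1, n)} * {ffun 'I_e -> 'M[K]_(p2, n)}) : 'N_(p1 + p2, n) :=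
  col_mx (lift_trunc u.1) (lift_trunc u.2).

Let cnt_r e S : stable_at e S -> cnt e S = #|[set u | `[< S (@r e u) >]]%SET|.
Proof.
move=> eS; apply: cnt_reindex => //.
  move=> [c u] [c' u'] /trunc_eq /eqm_col[/trunc_eq E /trunc_eq E'].
  by rewrite !lift_truncK /= in E, E'; rewrite E E'.
by rewrite card_prod !card_truncs -expnD !mulnDl.
Qed.

Lemma cnt_fubiniu e S : stable_at e S ->
  cnt e S = (\sum_c cnt e (fun x => S (col_mx x (@lift_trunc p2 n e c))))%N.
Proof.
move=> /cnt_r ->; rewrite cardsE -sum1_card /=.
under [RHS]eq_bigr do rewrite /cnt cardsE -sum1_card.
rewrite (exchange_big_dep xpredT) //= pair_big_dep /=.
by apply: eq_bigl => -[u c].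
Qed.

Lemma cnt_fubinid e S : stable_at e S ->
  cnt e S = (\sum_c cnt e (fun y => S (col_mx (@lift_trunc p1 n e c) y)))%N.
Proof.
move=> /cnt_r ->; rewrite cardsE -sum1_card /=.
under [RHS]eq_bigr do rewrite /cnt cardsE -sum1_card.
by rewrite pair_big_dep /=; apply: eq_bigl => -[u c].
Qed.

Lemma vol_fubiniu e S : stable_at e S ->
  vol S = (\sum_c vol (fun x => S (col_mx x (@lift_trunc p2 n e c)))) / (Q ^ (p2 * n * e))%:R.
Proof.
move=> eS; rewrite (volE eS) /vol_at cnt_fubiniu //.
under [in RHS]eq_bigr do rewrite (volE (stable_at_colu eS)) /vol_at.
rewrite -mulr_suml natr_sum -mulrA; congr (_ * _).
by rewrite -invfM -natrM -expnD !mulnDl addnC.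
Qed.

Lemma vol_fubinid e S : stable_at e S ->
  vol S = (\sum_c vol (fun y => S (col_mx (@lift_trunc p1 n e c) y))) / (Q ^ (p1 * n * e))%:R.
Proof.
move=> eS; rewrite (volE eS) /vol_at cnt_fubinid //.
under [in RHS]eq_bigr do rewrite (volE (stable_at_cold eS)) /vol_at.
rewrite -mulr_suml natr_sum -mulrA; congr (_ * _).
by rewrite -invfM -natrM -expnD !mulnDl addnC.
Qed.

Lemma vol_col_scale (k : rat) S S' : stable S -> stable S' ->
  (forall y, vol (fun x => S (col_mx x y)) = k * vol (fun x => S' (col_mx x y))) ->
  vol S = k * vol S'.
Proof.
move=> [e0 eS] [e1 eS'] H; pose e := maxn e0 e1.
have {}eS : stable_at e S by apply: stable_atW eS; rewrite leq_maxl.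
have {}eS' : stable_at e S' by apply: stable_atW eS'; rewrite leq_maxr.
rewrite (vol_fubiniu eS) (vol_fubiniu eS') mulrA; congr (_ / _).
by rewrite mulr_sumr; apply: eq_bigr => c _; rewrite H.
Qed.

Lemma vol_col_const (w : rat) (A : set 'N_(p1, n)) S : stable S -> stable A ->
  (forall x y, S (col_mx x y) -> A x) ->
  (forall x, A x -> vol (fun y => S (col_mx x y)) = w) ->
  vol S = vol A * w.
Proof.
move=> [e0 eS] [e1 eA] SA H; pose e := maxn e0 e1.
have {}eS : stable_at e S by apply: stable_atW eS; rewrite leq_maxl.
have {}eA : stable_at e A by apply: stable_atW eA; rewrite leq_maxr.
rewrite (vol_fubinid eS) (volE eA) /vol_at mulrAC; congr (_ / _).
rewrite /cnt cardsE -sum1_card natr_sum mulr_suml [RHS]big_mkcond /=.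
apply: eq_bigr => c _; rewrite unfold_in /=; case: asboolP => [/H ->|nA].
  by rewrite mul1r.
by apply: vol_set0 => y /SA.
Qed.

End Fubini.

Lemma vol_colM p1 p2 n (A : set 'N_(p1, n)) (B : set 'N_(p2, n)) :
  stable A -> stable B ->
  let S := fun x => A (usubmx x) /\ B (dsubmx x) in
  stable S /\ vol S = vol A * vol B.
Proof.
move=> sA sB S.
have sS : stable S.
  have [[e eA] [e' eB]] := (sA, sB); exists (maxn e e') => x y.
  rewrite -[x]vsubmxK -[y]vsubmxK eqm_col /S !col_mxKu !col_mxKd => -[E E'] [H H'].
  split; [apply: eA H|apply: eB H'].
    by apply: eqmW E; rewrite leq_maxl.
  by apply: eqmW E'; rewrite leq_maxr.
split=> //; apply: vol_col_const => //.
  by move=> x y []; rewrite col_mxKu.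
by move=> x Ax; apply: eq_vol => y; rewrite /S col_mxKu col_mxKd; tauto.
Qed.

End Volume.

(** * Effect of matrix multiplication on volumes *)

Section Scaling.
Variable K : finFieldType.
Local Notation Q := (#|K|).
Local Notation "''N_' ( p , n )" := 'M[{fps K}]_(p, n) (at level 8, p, n at level 200).

Lemma layerP p n (x y : 'N_(p, n)) : (forall l, layer l x = layer l y) -> x = y.
Proof.
move=> H; apply/matrixP => i j; apply: fpsP => l.
by move/matrixP/(_ i j): (H l); rewrite !mxE.
Qed.

Lemma mxT_inj p n : injective (@mxT K p n).
Proof. by move=> x y E; apply: layerP => l; rewrite -!(layerS_mxT l) E. Qed.

Lemma mxT_shift p n (x : 'N_(p, n)) :
  layer 0 x = 0 -> x = mxT (map_mx (fps_shift 1) x).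
Proof.
move=> x0; apply: layerP => -[|l]; first by rewrite layer0_mxT.
by rewrite layerS_mxT; apply/matrixP => i j; rewrite !mxE fps_shiftE add1n.
Qed.

Lemma eqm_mxT p n e (x y : 'N_(p, n)) : eqm e.+1 (mxT x) (mxT y) <-> eqm e x y.
Proof.
split=> [E l le|E [|l] le]; last by rewrite !layerS_mxT; apply: E.
  by rewrite -2!(layerS_mxT l); apply: E.
by rewrite !layer0_mxT.
Qed.

Lemma mxCT_eq p n (c c' : 'M[K]_(p, n)) (x x' : 'N_(p, n)) :
  mxC c + mxT x = mxC c' + mxT x' -> c = c' /\ x = x'.
Proof.
have L0 (d : 'M[K]_(p, n)) (y : 'N_(p, n)) : layer 0 (mxC d + mxT y) = d.
  by rewrite layerD layer0_mxT addr0 layer_mxC eqxx.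
have LS (d : 'M[K]_(p, n)) (y : 'N_(p, n)) l : layer l.+1 (mxC d + mxT y) = layer l y.
  by rewrite layerD layerS_mxT layer_mxC add0r.
move=> E; split; first by rewrite -(L0 c x) E L0.
by apply: layerP => l; rewrite -(LS c x) E LS.
Qed.

Lemma mxC0 p n : mxC (0 : 'M[K]_(p, n)) = 0.
Proof. by rewrite mxCE map_mx0. Qed.

Lemma vol_layer0 p n (S S' : set 'N_(p, n)) :
  stable S' -> (forall x, S x <-> exists2 y, S' y & x = mxT y) ->
  stable S /\ vol S = (Q ^ (p * n))%:R^-1 * vol S'.
Proof.
move=> sS' SE.
have [|sS ->] := @vol_layers _ p n (fun c => c = 0) S S' sS'.
  move=> c x; rewrite SE; split=> [[y S'y]|[-> S'x]].
    by rewrite -[mxT y]add0r -mxC0 => /mxCT_eq[-> ->].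
  by exists x; rewrite // mxC0 add0r.
split=> //; congr (_ * _); rewrite (_ : #|_| = 1%N) ?mul1r //.
by apply/eqP/cards1P; exists 0; apply/setP => c; rewrite finset.in_set finset.in_set1; apply/asboolP/eqP.
Qed.

Lemma vol_scale_row p n e (S S' : set 'N_(1 + p, n)) : stable_at e S ->
  (forall x, S' x <-> S (col_mx (map_mx (fps_shift 1) (usubmx x)) (dsubmx x))
                      /\ layer 0 (usubmx x) = 0) ->
  stable_at e.+1 S' /\ vol S' = (Q ^ n)%:R^-1 * vol S.
Proof.
move=> eS SE; have sS : stable S by exists e.
have eS' : stable_at e.+1 S'.
  move=> x y; rewrite -[x]vsubmxK -[y]vsubmxK; move: (usubmx x) (dsubmx x) (usubmx y) (dsubmx y).
  move=> a b a' b'; rewrite eqm_col !SE !col_mxKu !col_mxKd => -[Ea Eb] [Sx a0].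
  have a'0 : layer 0 a' = 0 by rewrite -(Ea 0%N).
  split=> //; apply: eS Sx; apply/eqm_col; split; last exact: eqmW Eb.
  by apply/eqm_mxT; rewrite -!mxT_shift.
split=> //; apply: vol_col_scale => //; first by exists e.+1.
move=> y; set A := fun x => S (col_mx x y).
have sA : stable A by exists e; apply: stable_at_colu.
have [|_ ->] := @vol_layer0 _ _ (fun x => S' (col_mx x y)) A sA; last by rewrite mul1n.
move=> x; rewrite SE col_mxKu col_mxKd; split=> [[H x0]|[z Az ->]].
  by exists (map_mx (fps_shift 1) x) => //; apply: mxT_shift.
rewrite layer0_mxT; split=> //.
by rewrite -[map_mx _ _](mxT_inj (mxT_shift (layer0_mxT z))).
Qed.

Lemma vol_scale_col p n e (S S' : set 'N_(p, 1 + n)) : stable_at e S ->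
  (forall x, S' x <-> S (row_mx (map_mx (fps_shift 1) (lsubmx x)) (rsubmx x))
                      /\ layer 0 (lsubmx x) = 0) ->
  stable_at e.+1 S' /\ vol S' = (Q ^ p)%:R^-1 * vol S.
Proof.
move=> eS SE; have [_ <-] := vol_tr (stable_at_stable eS).
have eSt : stable_at e (fun x => S x^T) by move=> x y /eqm_tr; apply: eS.
have [|eSt' <-] := @vol_scale_row n p e (fun x => S x^T) (fun x => S' x^T) eSt.
  move=> x; rewrite SE tr_col_mx matrix.map_trmx trmx_usub trmx_dsub.
  have L (a : 'N_(1, p)) : (layer 0 a^T = 0) <-> (layer 0 a = 0).
    by split=> /matrixP H; apply/matrixP => i j; move: (H j i); rewrite !mxE.
  by rewrite -trmx_usub L.
have eS' : stable_at e.+1 S'.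
  by move=> x y /eqm_tr /eSt'; rewrite !trmxK.
split=> //; have [_ <-] := vol_tr (stable_at_stable eSt').
by apply: eq_vol => x; rewrite trmxK.
Qed.

Lemma det_mxT_row n (u : 'N_(1, 1 + n)) (v : 'N_(n, 1 + n)) :
  \det (col_mx (mxT u) v) = fpsX K * \det (col_mx u v).
Proof.
have -> : col_mx (mxT u) v = block_mx (fpsX K)%:M 0 0 1%:M *m col_mx u v.
  by rewrite mul_block_col !mul0mx addr0 add0r mul1mx mul_scalar_mx mxTE.
by rewrite det_mulmx det_ublock det1 mulr1 det_scalar1.
Qed.

(** A nonunit determinant loses a factor [T] after an invertible row operation:
    iterating, every nonsingular matrix is a product of invertible matrices and
    of matrices [diag(T, 1, ..., 1)]. *)
Lemma split_valuation n d (b : 'M[{fps K}]_(1 + n)) : has_val d.+1 (\det b) ->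
  exists P b', [/\ P \in unitmx, has_val d (\det b') &
    P *m b = col_mx (mxT (usubmx b')) (dsubmx b')].
Proof.
move=> [b0 bd].
have : layer 0 b \notin unitmx.
  by rewrite -unitmx_layer0 unitmxE fps_unitE b0 // eqxx.
rewrite -row_free_unit -kermx_eq0 => /rowV0Pn[u /sub_kermxP ub un0].
have ur : \rank u = 1%N by rewrite rank_rV un0.
pose P := row_ebase u : 'M_(1 + n).
have Pb : usubmx P *m layer 0 b = 0.
  have uE : u = (col_ebase u 0 0) *: usubmx P.
    have pP : pid_mx 1 *m P = usubmx P.
      rewrite -[P in LHS]vsubmxK [pid_mx 1](_ : _ = row_mx 1%:M 0) ?pid_mx_row //.
      by rewrite mul_row_col mul1mx mul0mx addr0.
    rewrite -[LHS]mulmx_ebase ur -mulmxA pP [col_ebase u]mx11_scalar.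
    by rewrite mul_scalar_mx !mxE.
  have c0 : col_ebase u 0 0 != 0.
    by apply: contraNneq un0 => c0; rewrite uE c0 scale0r.
  apply/eqP; rewrite -(inj_eq (scalerI c0)) scaler0 scalemxAl -uE.
  by rewrite ub.
pose c := mxC P *m b.
have PU : mxC P \in unitmx by rewrite mxC_unit row_ebase_unit.
have c0 : layer 0 (usubmx c) = 0.
  have -> : layer 0 (usubmx c) = usubmx (layer 0 c).
    by apply/matrixP => i j; rewrite !mxE.
  by rewrite layer0M layer_mxC eqxx -mul_usub_mx.
exists (mxC P), (col_mx (map_mx (fps_shift 1) (usubmx c)) (dsubmx c)).
split=> //; last by rewrite col_mxKu col_mxKd -mxT_shift // vsubmxK.
rewrite -has_val_XM -det_mxT_row -mxT_shift // vsubmxK.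
by rewrite det_mulmx has_val_unitM // -unitmxE.
Qed.

Lemma mulmx_mxT p n r (x : 'N_(p, n)) (y : 'N_(n, r)) : x *m mxT y = mxT x *m y.
Proof. by rewrite !mxTE -scalemxAr scalemxAl. Qed.

(** By [split_valuation], multiplication by [b] is a composition of bijections
    and of [d] multiplications of one column by [T], each of which divides
    volumes by [Q^p]. *)
Lemma vol_image_mulr p n d e (b : 'M[{fps K}]_n) (S S' : set 'N_(p, n)) :
  stable_at e S -> has_val d (\det b) ->
  (forall x, S' x <-> exists2 y, S y & x = y *m b) ->
  stable_at (e + d) S' /\ vol S' = (Q ^ (p * d))%:R^-1 * vol S.
Proof.
elim: d e n b S S' => [|d IHd] e n b S S' sS bd SE.
  have bU : b \in unitmx by apply/unitmx_val0.
  have E x : S' x <-> S (x *m invmx b).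
    rewrite SE; split=> [[y Sy ->]|H]; first by rewrite mulmxK.
    by exists (x *m invmx b); rewrite ?mulmxKV.
  rewrite addn0 muln0 invr1 mul1r -(@vol_mulr _ _ _ (invmx b) S) ?unitmx_inv //; last by exists e.
  split; last by apply: eq_vol => x; apply: E.
  by move=> x y exy /E Sx; apply/E; apply: sS Sx; apply: eqmM exy _.
case: n b S S' sS bd SE => [|n] b S S' sS bd SE.
  by move: bd; rewrite det_mx00 => -[/(_ 0%N isT)] /eqP; rewrite fps_coef1 oner_eq0.
have [P [b' [PU b'd Pb]]] := split_valuation bd.
have bE : b = invmx P *m col_mx (mxT (usubmx b')) (dsubmx b').
  by rewrite -Pb mulKmx.
pose S1 (x : 'N_(p, 1 + n)) := S (x *m P).
pose S2 (x : 'N_(p, 1 + n)) :=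
  S1 (row_mx (map_mx (fps_shift 1) (lsubmx x)) (rsubmx x)) /\ layer 0 (lsubmx x) = 0.
have sS1 : stable_at e S1 by move=> x y exy; apply: sS; apply: eqmM exy _.
have [|sS2 vS2] := @vol_scale_col p n e S1 S2 sS1; first by move=> x.
have [|sS' ->] := IHd _ _ b' S2 S' sS2 b'd.
  move=> x; rewrite SE; split=> [[y Sy ->]|[z [S1z z0] ->]].
    pose w := y *m invmx P : 'N_(p, 1 + n).
    exists (row_mx (mxT (lsubmx w)) (rsubmx w)).
      rewrite /S2 row_mxKl row_mxKr layer0_mxT; split=> //.
      rewrite -[map_mx _ _](mxT_inj (mxT_shift (layer0_mxT (lsubmx w)))).
      by rewrite /S1 hsubmxK mulmxKV.
    rewrite bE mulmxA -/w -[w in LHS]hsubmxK -[b' in RHS]vsubmxK !mul_row_col.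
    by rewrite mulmx_mxT.
  exists (row_mx (map_mx (fps_shift 1) (lsubmx z)) (rsubmx z) *m P) => //.
  rewrite bE mulmxA mulmxK // -[z in LHS]hsubmxK -[b' in LHS]vsubmxK !mul_row_col.
  by rewrite mulmx_mxT -mxT_shift.
rewrite addnS -addSn; split=> //; rewrite vS2 vol_mulr //; last by exists e.
rewrite mulrA; congr (_ * _).
by rewrite -invfM -natrM -expnD mulnS addnC.
Qed.

End Scaling.

(** * Series with initial coefficients in a subfield *)

(** Both the cosets of a lattice and the lattices of a given type are enumerated
    by matrices truncated at a fixed level; this extracts their number. *)
Lemma card_uniform_fibers (X : finType) (T : choiceType) (A : {set X})
    (f : X -> T) (S : set T) (k : nat) :
  (forall y, S y <-> exists2 x, x \in A & f x = y) -> (0 < k)%N ->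
  {in A, forall x, #|[set y in A | f x == f y]%SET| = k} ->
  exists2 N, S #= `I_N & (N * k)%N = #|A|.
Proof.
move=> SE k0 fib; pose S0 := [fset f x | x in A]%fset.
have -> : S = [set` S0].
  apply/funext => y; apply/propext; rewrite SE; split=> [[x xA <-]|].
    by apply/imfsetP; exists x.
  by move=> /imfsetP[x /= xA ->]; exists x.
exists #|` S0|; first exact/card_eq_fsetP.
transitivity (\sum_(y <- S0) \sum_(x in A) (f x == y))%N.
  transitivity (\sum_(y <- S0) k)%N.
    by rewrite big_const_seq count_predT iter_addn_0 mulnC.
  rewrite big_seq [RHS]big_seq; apply: eq_bigr => y /imfsetP[x /= xA ->].
  rewrite -(fib x xA) -sum1_card big_mkcond [RHS]big_mkcond /=.
  by apply: eq_bigr => z _; rewrite !inE eq_sym; case: (z \in A); case: eqP.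
rewrite exchange_big -sum1_card; apply: eq_bigr => x xA /=.
have fx : f x \in S0 by apply/imfsetP; exists x.
have := count_uniq_mem (f x) (fset_uniq S0); rewrite fx /= => <-.
rewrite -sum1_count [RHS]big_mkcond; apply: eq_bigr => y _.
by rewrite /= eq_sym; case: eqP.
Qed.

Section Profile.
Variables (F K : finFieldType) (iota : {rmorphism F -> K}).
Local Notation q := (#|F|).
Local Notation Q := (#|K|).
Local Notation "''N_' ( p , n )" := 'M[{fps K}]_(p, n) (at level 8, p, n at level 200).

Definition base_field : {pred K} := [pred a | a \in codom iota].

Lemma base_fieldP a : reflect (exists c, a = iota c) (a \in base_field).
Proof. exact: codomP. Qed.

Fact base_field_closed : divring_closed base_field.
Proof.
split; first by apply/base_fieldP; exists 1; rewrite rmorph1.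
- by move=> _ _ /base_fieldP[a ->] /base_fieldP[b ->]; apply/base_fieldP; exists (a - b); rewrite rmorphB.
by move=> _ _ /base_fieldP[a ->] /base_fieldP[b ->]; apply/base_fieldP; exists (a / b); rewrite fmorph_div.
Qed.

HB.instance Definition _ := GRing.isDivringClosed.Build K base_field base_field_closed.

Lemma card_base_field : #|base_field| = q.
Proof. by rewrite card_codom //; apply: fmorph_inj. Qed.

(** For [u <= w], this is membership in [T^u F[[T]] + T^w K[[T]]]. All the
    modules below are described entry by entry by such conditions. *)
Definition profile u w (f : {fps K}) : Prop :=
  forall l, ((l < u)%N -> f l = 0) /\ ((l < w)%N -> f l \in base_field).

Lemma profileW u w u' w' f :
  (u' <= u)%N -> (w' <= w)%N -> profile u w f -> profile u' w' f.
Proof.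
by move=> uu ww fP l; have [f0 fB] := fP l; split=> H; [apply: f0|apply: fB]; apply: leq_trans H _.
Qed.

Lemma profileD u w f g : profile u w f -> profile u w g -> profile u w (f + g).
Proof.
move=> fP gP l; have [[f0 fB] [g0 gB]] := (fP l, gP l); rewrite fps_coefD.
by split=> H; [rewrite f0 ?g0 ?addr0|rewrite rpredD ?fB ?gB].
Qed.

Lemma profileN u w f : profile u w f -> profile u w (- f).
Proof.
move=> fP l; have [f0 fB] := fP l; rewrite fps_coefN.
by split=> H; [rewrite f0 ?oppr0|rewrite rpredN fB].
Qed.

Lemma profile0 u w : profile u w 0.
Proof. by move=> l; rewrite fps_coef0 rpred0. Qed.

Lemma profile_sum u w (I : Type) (r : seq I) (P : pred I) (G : I -> {fps K}) :
  (forall i, P i -> profile u w (G i)) -> profile u w (\sum_(i <- r | P i) G i).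
Proof.
by move=> H; elim/big_ind: _ => //; [exact: profile0|move=> f g; exact: profileD].
Qed.

Lemma profileM u1 w1 u2 w2 f g : profile u1 w1 f -> profile u2 w2 g ->
  profile (u1 + u2) (minn (u1 + w2) (u2 + w1)) (f * g).
Proof.
move=> fP gP l; rewrite fps_coefM; split=> H.
  apply: big1 => -[i /= il] _; have [iu|iu] := ltnP i u1.
    by rewrite (fP i).1 // mul0r.
  by rewrite (gP _).1 ?mulr0 //; lia.
apply: rpred_sum => -[i /= il] _; have [iu|iu] := ltnP i u1.
  by rewrite (fP i).1 // mul0r rpred0.
have [ju|ju] := ltnP (l - i) u2.
  by rewrite (gP _).1 // mulr0 rpred0.
by rewrite rpredM ?(fP i).2 ?(gP (l - i)%N).2 //; move: H; rewrite leq_min; lia.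
Qed.

Lemma profileXn d u w f : profile (d + u) (d + w) (fpsX K ^+ d * f) <-> profile u w f.
Proof.
split=> fP l.
  have := fP (d + l)%N; rewrite coef_fpsXnM [(_ + _ < d)%N]ltnNge leq_addr /= addKn.
  by rewrite !ltn_add2l.
rewrite coef_fpsXnM; case: (ltnP l d) => [_|dl]; first by split=> // _; apply: rpred0.
by have := fP (l - d)%N; rewrite !ltn_subLR.
Qed.

(** The condition that [profile u w] puts on the constant term; the other terms
    satisfy [profile u.-1 w.-1]. *)
Definition digit u w : pred K :=
  [pred c | ((0 < u)%N ==> (c == 0)) && ((0 < w)%N ==> (c \in base_field))].

(** Multiplied out, so that the three cases (no condition, being in [F], being
    0) read alike. *)
Lemma card_digit u w : (u <= w)%N -> #|K| = (q ^ 2)%N ->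
  (#|digit u w| * q ^ (u + w) = Q * q ^ (u.-1 + w.-1))%N.
Proof.
move=> uw QE; case: w uw => [|w].
  rewrite leqn0 => /eqP ->; have -> // : #|digit 0 0| = #|K|.
  by apply: eq_card => c; rewrite !inE.
case: u => [|u] _.
  rewrite (@eq_card _ _ base_field); last by move=> c; rewrite !inE /=.
  by rewrite card_base_field QE /= !add0n !expnS expn0; ring.
rewrite (@fintype.eq_card1 _ (0 : K)); last first.
  by move=> c; rewrite !inE /= andb_idr // => /eqP ->; apply: (rpred0 base_field).
by rewrite QE addSn addnS /= !expnS expn0; ring.
Qed.

Lemma card_mx_family p n (D : 'I_p -> 'I_n -> pred K) :
  #|[set c : 'M[K]_(p, n) | `[< forall i j, D i j (c i j) >]]%SET| =
  (\prod_i \prod_j #|D i j|)%N.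
Proof.
pose E (ij : 'I_p * 'I_n) : pred K := D ij.1 ij.2.
rewrite pair_big /= -(card_in_imset (f := fun c : 'M[K]_(p, n) => [ffun ij => c ij.1 ij.2])); last first.
  move=> c c' _ _ /ffunP H; apply/matrixP => i j.
  by move: (H (i, j)); rewrite !ffunE.
transitivity #|(family E : simpl_pred {ffun 'I_p * 'I_n -> K})|; last first.
  by rewrite card_family foldrE big_map big_enum.
apply: eq_card => f; apply/imsetP/familyP => [[c]|fE].
  by rewrite finset.in_set => /asboolP H -> ij; rewrite ffunE; apply: H.
exists (\matrix_(i, j) f (i, j)).
  by rewrite finset.in_set; apply/asboolP => i j; rewrite mxE; exact: (fE (i, j)).
by apply/ffunP => -[i j]; rewrite !ffunE mxE.
Qed.

Definition box p n (u w : 'I_p -> 'I_n -> nat) : set 'N_(p, n) :=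
  fun x => forall i j, profile (u i j) (w i j) (x i j).

Lemma box_stable_at p n e (u w : 'I_p -> 'I_n -> nat) :
  (forall i j, u i j <= e)%N -> (forall i j, w i j <= e)%N -> stable_at e (box u w).
Proof.
move=> ue we x y exy xB i j l; have [x0 xb] := xB i j l; split=> H.
  by rewrite -(eqmE _ _ exy) ?x0 //; apply: leq_trans H _.
by rewrite -(eqmE _ _ exy) ?xb //; apply: leq_trans H _.
Qed.

Lemma box_stable p n (u w : 'I_p -> 'I_n -> nat) : stable (box u w).
Proof.
exists (\max_i \max_j maxn (u i j) (w i j))%N; apply: box_stable_at => i j.
  by apply: leq_trans (leq_bigmax i); apply: leq_trans (leq_bigmax j); rewrite leq_maxl.
by apply: leq_trans (leq_bigmax i); apply: leq_trans (leq_bigmax j); rewrite leq_maxr.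
Qed.

Lemma box_layers p n (u w : 'I_p -> 'I_n -> nat) c x :
  box u w (mxC c + mxT x) <->
  (forall i j, digit (u i j) (w i j) (c i j)) /\
  box (fun i j => (u i j).-1) (fun i j => (w i j).-1) x.
Proof.
have E i j l : (mxC c + mxT x) i j l = if l is l'.+1 then x i j l' else c i j.
  have -> : (mxC c + mxT x) i j l = layer l (mxC c + mxT x) i j by rewrite [RHS]mxE.
  rewrite layerD layer_mxC; case: l => [|l].
    by rewrite layer0_mxT addr0.
  by rewrite layerS_mxT add0r mxE.
split=> [H|[H H'] i j [|l]]; last first.
- by rewrite E; have := H' i j l; rewrite !ltn_predRL.
- rewrite E; have /andP[/implyP h /implyP h'] := H i j.
  by split=> // /h /eqP.
split=> [i j|i j l].
  have := H i j 0%N; rewrite E => -[h h'].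
  by apply/andP; split; apply/implyP => // /h ->.
by have := H i j l.+1; rewrite E !ltn_predRL.
Qed.

(** Peel off constant terms: each entry has density [q^-1] for every coefficient
    constrained to [F] and [q^-2] for every coefficient constrained to 0. *)
Lemma vol_box p n (u w : 'I_p -> 'I_n -> nat) :
  #|K| = (q ^ 2)%N -> (forall i j, u i j <= w i j)%N ->
  vol (box u w) = (\prod_i \prod_j q ^ (u i j + w i j))%N%:R^-1.
Proof.
move=> QE; have q0 : (0 < q)%N by apply/card_gt0P; exists 0.
have [e] : exists e, forall i j, (w i j <= e)%N.
  exists (\max_i \max_j w i j)%N => i j.
  by apply: leq_trans (leq_bigmax i); apply: (leq_bigmax j).
elim: e u w => [|e IHe] u w we uw.
  have w0 i j : w i j = 0%N by apply/eqP; rewrite -leqn0.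
  have u0 i j : u i j = 0%N by apply/eqP; rewrite -leqn0 -(w0 i j).
  rewrite vol_setT; last by move=> x i j l; rewrite u0 w0.
  by rewrite big1 ?invr1 // => i _; rewrite big1 // => j _; rewrite u0 w0.
have [_ ->] := vol_layers (box_stable _ _) (@box_layers p n u w).
rewrite IHe; first last.
- by move=> i j; have := uw i j; lia.
- by move=> i j; have := we i j; lia.
rewrite [X in X%:R / _](card_mx_family (fun i j => digit (u i j) (w i j))).
have nz k : (k%:R != 0 :> rat) = (0 < k)%N by rewrite pnatr_eq0 lt0n.
have P0 (G : 'I_p -> 'I_n -> nat) : (\prod_i \prod_j q ^ G i j)%N%:R != 0 :> rat.
  by rewrite nz prodn_gt0 // => i; rewrite prodn_gt0 // => j; rewrite expn_gt0 q0.
set A := (\prod_i \prod_j q ^ (u i j + w i j))%N.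
set B := (\prod_i \prod_j q ^ ((u i j).-1 + (w i j).-1))%N.
set D := (\prod_i \prod_j #|digit (u i j) (w i j)|)%N.
have H : (D * A = Q ^ (p * n) * B)%N.
  rewrite -[(_ ^ (p * n))%N](_ : \prod_(i < p) \prod_(j < n) Q = _)%N; last first.
    by rewrite !prod_nat_const !card_ord -expnM mulnC.
  rewrite -!big_split /=; apply: eq_bigr => i _; rewrite -!big_split /=.
  by apply: eq_bigr => j _; rewrite card_digit.
have -> : D%:R = (Q ^ (p * n))%:R * B%:R / A%:R :> rat.
  by apply: (canRL (mulfK (P0 _))); rewrite -!natrM H.
by field; rewrite !P0 Q_neq0.
Qed.

(** At a level where [M] and [L] are both stable, the truncations of [M] map onto
    the cosets, and every fiber is a translate of the truncations of [L]. *)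
Lemma card_cosets n (M L : set 'rV[{fps K}]_n) N :
  stable M -> stable L -> (forall x, L x -> M x) ->
  (forall x y, M x -> M y -> M (x + y)) -> (forall x y, L x -> L y -> L (x + y)) ->
  (forall x, L x -> L (- x)) -> L 0 ->
  (cosets M L #= `I_N) <-> N%:R * vol L = vol M.
Proof.
move=> [e0 eM] [e1 eL] LM MD LD LN L0; pose e := maxn e0 e1.
have {}eM : stable_at e M by apply: stable_atW eM; rewrite leq_maxl.
have {}eL : stable_at e L by apply: stable_atW eL; rewrite leq_maxr.
have LB x y : L x -> L y -> L (x - y) by move=> Lx Ly; apply: LD => //; apply: LN.
rewrite (volE eM) (volE eL) /vol_at.
pose f (c : {ffun 'I_e -> 'rV[K]_n}) : set 'rV[{fps K}]_n :=
  [set y | M y /\ L (y - lift_trunc c)].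
pose A := [set c : {ffun 'I_e -> 'rV[K]_n} | `[< M (lift_trunc c) >]]%SET.
have cosetE x y : M x -> M y ->
    [set z | M z /\ L (z - x)] = [set z | M z /\ L (z - y)] <-> L (y - x).
  move=> Mx My; split=> [/(congr1 (@^~ y)) E|Lyx].
    have : [set z | M z /\ L (z - y)] y by split; rewrite ?subrr.
    by rewrite -E => -[].
  apply/funext => z; apply/propext; split=> -[Mz Lz]; split=> //.
    by have := LB _ _ Lz Lyx; rewrite opprB addrA subrK.
  by have := LD _ _ Lz Lyx; rewrite addrA subrK.
have eqmB x y : eqm e x y -> L (x - y).
  move=> exy; apply: (eL 0) => // l le.
  by apply/matrixP => i j; rewrite !mxE fps_coefD fps_coefN (eqmE _ _ exy) ?subrr.
have [N0 cN0 N0E] : exists2 N0, cosets M L #= `I_N0 & (N0 * cnt e L)%N = #|A|.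
  apply: (@card_uniform_fibers _ _ A f).
  - move=> S; split=> [[x Mx <-]|[c]]; last first.
      by rewrite finset.in_set => /asboolP Mc <-; exists (lift_trunc c).
    have Mc : M (lift_trunc (trunc e x)) by apply: eM Mx; apply/eqm_sym/trunc_lift.
    exists (trunc e x); first by rewrite finset.in_set; apply/asboolP.
    by apply/cosetE => //; apply: eqmB; apply/eqm_sym/trunc_lift.
  - apply/card_gt0P; exists (trunc e 0); rewrite finset.in_set; apply/asboolP.
    by apply: eL L0; apply/eqm_sym/trunc_lift.
  move=> c; rewrite finset.in_set => /asboolP Mc.
  have rinj : injective (fun d => trunc e (@lift_trunc _ 1 n e d - lift_trunc c)).
    move=> d d' /trunc_eq E; rewrite -(lift_truncK d) -(lift_truncK d').
    apply/trunc_eq => l le; apply/matrixP => i j; move: (eqmE i j E le).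
    by rewrite !mxE !fps_coefD !fps_coefN => /addIr.
  rewrite (cnt_reindex eL rinj) ?card_truncs //; apply: eq_card => d.
  rewrite !finset.in_set /f; apply/andP/asboolP => [[/asboolP Md /eqP E]|Ld].
    by apply/cosetE.
  have Md : M (lift_trunc d).
    by rewrite -(subrK (lift_trunc c) (lift_trunc d)); apply: MD => //; apply: LM.
  by split; [apply/asboolP|apply/eqP/cosetE].
have cL0 : (0 < cnt e L)%N.
  apply/card_gt0P; exists (trunc e 0); rewrite finset.in_set; apply/asboolP.
  by apply: eL L0; apply/eqm_sym/trunc_lift.
have NE : N%:R * ((cnt e L)%:R / (Q ^ (1 * n * e))%:R) =
    (cnt e M)%:R / (Q ^ (1 * n * e))%:R :> rat <-> N = N0.
  rewrite mulrA -natrM; split=> [/(mulIf _) H|->]; last by rewrite N0E.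
  have {}H : (N * cnt e L)%N = cnt e M.
    by apply/eqP; rewrite -(eqr_nat rat); apply/eqP/H; rewrite invr_eq0 Q_neq0.
  by apply/eqP; rewrite -(eqn_pmul2r cL0) H -[cnt e M]N0E.
rewrite NE; split=> [cN|-> //].
by apply/card_eq_II; apply: card_eq_trans cN0; rewrite card_eq_sym.
Qed.

End Profile.

(** * Structure of the submodules of finite index *)

Section Structure.
Variables (F K : finFieldType) (iota : {rmorphism F -> K}) (alpha : K).
Local Notation base := (base_field iota).
Hypothesis alpha_notin : alpha \notin base.
Hypothesis alpha_span :
  forall y, exists ab : K * K, [/\ ab.1 \in base, ab.2 \in base & y = ab.1 + alpha * ab.2].
Local Notation "''N_' ( p , n )" := 'M[{fps K}]_(p, n) (at level 8, p, n at level 200).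
Local Notation T := (fpsX K).
Local Notation prof := (profile iota).

Definition order m : set {fps K} := [set f | prof 0 m f].

Definition based (f : {fps K}) := forall l, f l \in base.

Lemma based_profile m f : based f -> prof 0 m f.
Proof. by move=> fB l; split. Qed.

(** The family [1, alpha] is free over [F]. *)
Lemma alpha_based a : a \in base -> alpha * a \in base -> a = 0.
Proof.
move=> aB aaB; apply: contraNeq alpha_notin => an0.
by rewrite -[alpha](mulfK an0) rpred_div.
Qed.

Lemma based_split (f : {fps K}) : exists g h, [/\ based g, based h & f = g + fpsC alpha * h].
Proof.
have [c cP] := choice alpha_span.
exists (FPS (fun l => (c (f l)).1)), (FPS (fun l => (c (f l)).2)).
split; [by move=> l; case: (cP (f l))|by move=> l; case: (cP (f l))|].
by apply: fpsP => l; rewrite fps_coefD coef_fpsCM /=; case: (cP (f l)).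
Qed.

(** The ring [F[[T]] + T^k K[[T]]] is the [F[[T]]]-module generated by [1] and
    [alpha T^k]. *)
Lemma profile_split k (f : {fps K}) : prof 0 k f <->
  exists g h, [/\ based g, based h & f = g + fpsC alpha * T ^+ k * h].
Proof.
split=> [fP|[g [h [gB hB ->]]] l]; last first.
  split=> // lk; rewrite fps_coefD -mulrA coef_fpsCM coef_fpsXnM lk mulr0 addr0.
  exact: gB.
have [g [h [gB hB fE]]] := based_split f.
have hl l : (l < k)%N -> h l = 0.
  move=> lk; apply: alpha_based; first exact: hB.
  have <- : f l - g l = alpha * h l by rewrite fE fps_coefD coef_fpsCM addrC addKr.
  by rewrite rpredB ?gB // (fP l).2.
exists g, (fps_shift k h); split=> //; first by move=> l; apply: hB.
by rewrite -mulrA -fpsXn_shift.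
Qed.

Definition set_row n (b : 'N_(n, n)) i (y : 'N_(1, n)) : 'N_(n, n) :=
  \matrix_(k, j) if k == i then y 0 j else b k j.

Lemma row_set_row n (b : 'N_(n, n)) i y k :
  row k (set_row b i y) = if k == i then y else row k b.
Proof.
by apply/rowP => j; rewrite !mxE; case: eqP => // _; rewrite ?mxE ?ord1.
Qed.

(** Cramer's rule: in the expansion along the replaced row, the cofactors are
    those of [b]. *)
Lemma det_set_row n (b : 'N_(n, n)) i y : \det (set_row b i y) = (y *m \adj b) 0 i.
Proof.
have C j : row' i (col' j (set_row b i y)) = row' i (col' j b).
  by apply/matrixP => k l; rewrite !mxE eq_sym (negbTE (neq_lift _ _)).
rewrite (expand_det_row _ i) mxE; apply: eq_bigr => j _.
by rewrite [_ i j]mxE eqxx [\adj b j i]mxE /cofactor C.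
Qed.

Lemma det_set_row_mul n (b : 'N_(n, n)) i z :
  \det (set_row b i (z *m b)) = z 0 i * \det b.
Proof. by rewrite det_set_row -mulmxA mul_mx_adj mul_mx_scalar mxE mulrC. Qed.

Section Lattice.
Variables (m n : nat) (L : set 'rV[{fps K}]_n) (N : nat).
Hypothesis L_sub : is_submodule (order m) (free_module (order m) (n:=n)) L.
Hypothesis L_index : cosets (free_module (order m) (n:=n)) L #= `I_N.

Let L0 : L 0. Proof. by case: L_sub. Qed.
Let LD x y : L x -> L y -> L (x + y). Proof. by case: L_sub => _ _ H _; apply: H. Qed.
Let LZ a x : prof 0 m a -> L x -> L (a *: x).
Proof. by case: L_sub => _ _ _ H; apply: H. Qed.
Let LN x : L x -> L (- x).
Proof.
move=> Lx; rewrite -scaleN1r; apply: LZ => // l.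
split=> // _; rewrite fps_coefN fps_coef1 rpredN; case: eqP => _; first exact: rpred1.
exact: rpred0.
Qed.
Let Lsum (I : Type) (r : seq I) (P : pred I) (G : I -> 'rV[{fps K}]_n) :
  (forall i, P i -> L (G i)) -> L (\sum_(i <- r | P i) G i).
Proof. by move=> H; apply: big_ind. Qed.

(** By the pigeonhole principle, two vectors [T^j e_i] and [T^j' e_i] with [j < j']
    agree modulo [L], and [T^j - T^j'] has valuation [j]. *)
Lemma lattice_coord (i : 'I_n) : exists f, L (f *: delta_mx 0 i) /\ exists d, has_val d f.
Proof.
pose x (j : nat) : 'rV[{fps K}]_n := T ^+ j *: delta_mx 0 i.
have Mx j : free_module (order m) (n:=n) (x j).
  move=> k l; split=> // _; rewrite !mxE eqxx andTb mulr_natr mulrb.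
  by case: ifP => _; rewrite ?coef_fpsXn ?rpred_nat ?rpred0.
pose M := free_module (order m) (n:=n).
pose f j : set 'rV[{fps K}]_n := [set y | M y /\ L (y - x j)].
pose s := [seq f j | j <- seq.iota 0 N.+1].
have fin : finite_set (cosets M L) by apply/finite_setP; exists N.
have su : ~~ uniq s.
  apply/negP => su; have := uniq_leq_size (s2 := fset_set (cosets M L)) su.
  rewrite size_map size_iota (card_fset_set L_index) ltnn => H.
  suff : false by [].
  apply: H => y /mapP[j _ ->].
  by rewrite in_fset_set //; apply: mem_set; exists (x j) => //; exact: Mx.
have [j [j' [jj js fE]]] := uniqPn (f 0%N) su.
have {}js : (j' < N.+1)%N by move: js; rewrite size_map size_iota.
have {}fE : f j = f j'.
  move: fE; rewrite !(nth_map 0%N) ?size_iota ?nth_iota //; exact: ltn_trans jj js.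
have Lj : L (x j - x j').
  have fj : f j (x j) by split; [exact: Mx|rewrite subrr; exact: L0].
  by rewrite fE in fj; case: fj.
exists (T ^+ j - T ^+ j'); split; first by rewrite scalerBl.
have jj0 : (0%N == (j' - j)%N) = false by apply/negbTE/eqP; lia.
have c0 : (T ^+ (j' - j)) 0%N = 0 by rewrite coef_fpsXn jj0.
exists j; apply/has_valP; exists (1 - T ^+ (j' - j)).
  rewrite fps_unitE fps_coefD fps_coefN c0 subr0 fps_coef1; exact: oner_neq0.
have TE : T ^+ j' = T ^+ j * T ^+ (j' - j).
  exact: etrans (congr1 (GRing.exp T) (esym (subnKC (ltnW jj)))) (exprD _ _ _).
have gen (a b : {fps K}) : a - a * b = a * (1 - b) by rewrite mulrBr mulr1.
exact: etrans (congr1 (fun c => T ^+ j - c) TE) (gen _ _).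
Qed.

Let frame d b := (forall i, L (row i b)) /\ has_val d (\det b).

Lemma lattice_frame : exists d b, frame d b.
Proof.
have [g gP] := choice lattice_coord.
pose b := diag_mx (\row_i g i).
have [d dP] : exists d, has_val d (\det b).
  rewrite det_diag; apply: (big_ind (fun f => exists d, has_val d f)).
  - by exists 0%N; apply/has_val0; apply: unitr1.
  - by move=> f f' [d fd] [d' fd']; exists (d + d')%N; exact: has_valM fd fd'.
  - by move=> i _; rewrite mxE; case: (gP i).
exists d, b; split=> // i; rewrite row_diag_mx mxE; by case: (gP i).
Qed.

(** Take [d] least. Replacing a row of [b] by [y] multiplies the determinant by a
    coordinate of [y] in the frame [b], by Cramer's rule; since the new valuation
    is not smaller than [d], that coordinate is integral. *)
Lemma lattice_min_frame : exists d, (exists b, frame d b) /\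
  forall b, frame d b -> forall y, L y -> exists z, y = z *m b.
Proof.
have ex : exists d, `[< exists b, frame d b >].
  by have [d H] := lattice_frame; exists d; apply/asboolP.
case: (ex_minnP ex) => d /asboolP dP dmin; exists d; split=> // b [bL bd] y Ly.
have zP i : exists z, \det (set_row b i y) = \det b * z.
  apply: (has_val_dvd bd) => l ld.
  have [->//|/has_val_exists[d' d'P]] := eqVneq (\det (set_row b i y)) 0.
  apply: d'P.1; apply: leq_trans ld _; apply: dmin; apply/asboolP.
  exists (set_row b i y); split=> // k; rewrite row_set_row; case: eqP => // _.
have [z zE] := choice zP; exists (\row_i z i).
have : \det b *: y = \det b *: (\row_i z i *m b).
  rewrite scalemxAl -[LHS]mul_mx_scalar -mul_adj_mx mulmxA; congr (_ *m b).
  by apply/rowP => i; rewrite -det_set_row zE !mxE.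
move/rowP => E; apply/rowP => i; apply: (has_val_lreg bd).
by have := E i; rewrite !mxE.
Qed.

(** By [profile_split], [L] then contains [F[[T]] + T^(lam i) K[[T]]] times the
    [i]-th row of [b], and it will be the sum of these lines when the sum of the
    [lam i] is least. *)
Let adapted d b (lam : 'I_n -> nat) :=
  [/\ frame d b, forall i, (lam i <= m)%N &
      forall i, L ((fpsC alpha * T ^+ lam i) *: row i b)].

Lemma adapted_sub d b lam (x : 'rV[{fps K}]_n) : adapted d b lam ->
  (forall i, prof 0 (lam i) (x 0 i)) -> L (x *m b).
Proof.
move=> [[bL _] _ lamL] xP; rewrite mulmx_sum_row; apply: Lsum => i _.
have /profile_split[g [h [gB hB ->]]] := xP i.
rewrite scalerDl; apply: LD; first exact: LZ (based_profile m gB) (bL i).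
by rewrite mulrC -scalerA; apply: LZ (based_profile m hB) (lamL i).
Qed.

(** Take [d] least, then the sum of the [lam i] least. Modulo the lines given by
    [adapted_sub], an element of [L] has coordinates [alpha h'_i] where [h'_i] is a
    polynomial over [F] of degree less than [lam i]. If some [h'_i] is not 0, let
    [v] be the least valuation among them, attained at [i0], and replace the row
    [i0] of [b] by [T^-v h' b]: this is still a frame of [L], and [lam i0] can be
    lowered to [v], against minimality. *)
Lemma lattice_adapted : exists d (b : 'M[{fps K}]_n) lam, [/\ has_val d (\det b),
  forall i : 'I_n, (lam i <= m)%N &
  forall x, L x <-> exists2 y : 'rV[{fps K}]_n, (forall i, prof 0 (lam i) (y 0 i)) & x = y *m b].
Proof.
have [d [[b0 b0F] dspan]] := lattice_min_frame.
have ex : exists s, `[< exists b lam, adapted d b lam /\ \sum_i lam i = s >]%N.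
  exists (\sum_(i < n) m)%N; apply/asboolP; exists b0, (fun=> m); split=> //.
  split=> // i; apply: LZ; last by case: b0F.
  by move=> l; split=> // lm; rewrite coef_fpsCM coef_fpsXn (ltn_eqF lm) mulr0 rpred0.
case: (ex_minnP ex) => s /asboolP[b [lam [bA sE]]] smin.
have [[bL bd] lamm lamL] := bA.
exists d, b, lam; split=> // x; split=> [Lx|[y yP ->]]; last exact: adapted_sub bA yP.
have [z xE] := dspan b (conj bL bd) x Lx; exists z => //.
have Lz : L (z *m b) by rewrite -xE.
clear x Lx xE.
have [gh ghP] := choice (fun i => based_split (z 0 i)).
have {ghP}[h ghP] := choice ghP.
pose h' i : {fps K} := FPS (fun l => if (l < lam i)%N then h i l else 0).
have gB i : based (gh i) by case: (ghP i).
have hB i : based (h i) by case: (ghP i).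
have h'B i : based (h' i) by move=> l /=; case: ifP => _; [exact: hB|exact: rpred0].
have hE i : h i = h' i + T ^+ lam i * fps_shift (lam i) (h i).
  apply: fpsP => l; rewrite fps_coefD coef_fpsXnM /=.
  by case: ltnP => ll; rewrite ?addr0 // add0r subnKC.
have zE i : z 0 i = gh i + fpsC alpha * h i by case: (ghP i).
have zP i : prof 0 (lam i) (z 0 i - fpsC alpha * h' i).
  apply/profile_split; exists (gh i), (fps_shift (lam i) (h i)); split=> //.
    by move=> l; apply: hB.
  rewrite zE {1}(hE i) mulrDr -!mulrA; set u := fpsC _ * h' i.
  by rewrite [u + _]addrC addrA addrK.
have [h'0|] := pselect (forall i l, h' i l = 0).
  move=> i; have := zP i; have -> : h' i = 0 by apply: fpsP => l; rewrite h'0.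
  by rewrite mulr0 subr0.
move=> /existsNP[i1 /existsNP[l1 hl1]]; exfalso.
have exv : exists l, [exists i, h' i l != 0].
  by exists l1; apply/existsP; exists i1; apply/eqP.
case: (ex_minnP exv) => v /existsP[i0 hv] vmin.
have v0 i l : (l < v)%N -> h' i l = 0.
  move=> lv; apply/eqP/negPn/negP => H.
  have := vmin l; rewrite leqNgt lv => H'.
  by suff : false; [|apply: H'; apply/existsP; exists i].
have vlam : (v < lam i0)%N by move: hv; rewrite /=; case: ltnP => //; rewrite eqxx.
pose k : 'rV[{fps K}]_n := \row_i fps_shift v (h' i).
pose b' := set_row b i0 (k *m b).
pose lam' i := if i == i0 then v else lam i.
have kB i : prof 0 m (k 0 i) by apply: based_profile => l; rewrite mxE; apply: h'B.
(* The new row is in [L] since its coordinates are in [F[[T]]]; so is its multiple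
   by [alpha T^v], as the difference of [z b] and an element of the sum of lines. *)
have b'A : adapted d b' lam'.
  split.
  - split=> [i|].
      rewrite row_set_row; case: eqP => // _; rewrite mulmx_sum_row.
      by apply: Lsum => i' _; apply: LZ.
    rewrite det_set_row_mul has_val_unitM // fps_unitE mxE fps_shiftE addn0.
    exact: hv.
  - move=> i; rewrite /lam'; case: eqP => // _.
    by apply: ltnW; apply: leq_trans vlam (lamm _).
  move=> i; rewrite row_set_row /lam'; case: eqP => // _.
  have -> : (fpsC alpha * T ^+ v) *: (k *m b) =
      z *m b - (\row_i (z 0 i - fpsC alpha * h' i)) *m b.
    rewrite scalemxAl -mulmxBl; congr (_ *m _); apply/rowP => i'; rewrite !mxE.
    rewrite subKr -mulrA -fpsXn_shift //.
    by move=> l lv; apply: v0.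
  apply: LD; first exact: Lz.
  by apply: LN; apply: adapted_sub bA _ => i'; rewrite mxE.
have : (s <= \sum_i lam' i)%N by apply: smin; apply/asboolP; exists b', lam'.
rewrite -sE (bigD1 i0) //= [X in (_ <= X)%N](bigD1 i0) //= {1}/lam' eqxx.
rewrite [X in (_ <= _ + X)%N](eq_bigr lam) => [|i /negbTE ii].
  by rewrite leq_add2r leqNgt vlam.
by rewrite /lam' ii.
Qed.

End Lattice.
End Structure.

(** * Normal form of a submodule: existence, uniqueness, index *)

Section NormalForm.
Variables (F K : finFieldType) (iota : {rmorphism F -> K}) (alpha : K).
Local Notation base := (base_field iota).
Hypothesis alpha_notin : alpha \notin base.
Hypothesis alpha_span :
  forall y, exists ab : K * K, [/\ ab.1 \in base, ab.2 \in base & y = ab.1 + alpha * ab.2].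
Local Notation T := (fpsX K).
Local Notation prof := (profile iota).

(** The sum of the modules [T^(m - lam i) (F[[T]] + T^(lam i) K[[T]])] carried by
    the rows of [b]. The shift by [m - lam i] makes it a submodule of [R^n] as soon
    as the row [i] of [b] has entries in [F[[T]] + T^(lam i) K[[T]]]. *)
Definition lat n m (lam : 'I_n -> nat) (b : 'M[{fps K}]_n) : set 'rV[{fps K}]_n :=
  fun x => exists2 y : 'rV_n, (forall i, prof (m - lam i) m (y 0 i)) & x = y *m b.

(** Where [f] and [alpha T^k f] both have their coefficients in [F], those of [f]
    vanish. *)
Lemma profile_alpha u m k (f : {fps K}) : (u <= m)%N ->
  prof u m f -> prof u m (fpsC alpha * T ^+ k * f) -> prof (m - k) m f.
Proof.
move=> um fP aP l; split; last exact: (fP l).2.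
move=> lmk; have [lu|ul] := ltnP l u; first exact: (fP l).1.
apply: (alpha_based alpha_notin); first by apply: (fP l).2; lia.
have := (aP (k + l)%N).2; rewrite -mulrA coef_fpsCM coef_fpsXnM.
by rewrite [(_ + _ < k)%N]ltnNge leq_addr /= addKn; apply; lia.
Qed.

Lemma lat_perm n m lam (b : 'M[{fps K}]_n) (p : 'S_n) :
  lat m (fun i => lam (p i)) (row_perm p b) = lat m lam b.
Proof.
apply/funext => x; apply/propext; split=> -[y yP ->].
  exists (col_perm p^-1%g y); last by rewrite -mul_row_perm.
  by move=> i; rewrite mxE; have := yP (p^-1%g i); rewrite permKV.
exists (col_perm p y); first by move=> i; rewrite mxE.
by rewrite mul_row_perm -col_permM mulVg col_perm1.
Qed.

(** Start from an adapted frame. As [b_i] and [alpha T^(lam i) b_i] both have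
    entries in [R], [profile_alpha] shows that [b_i] is divisible by
    [T^(m - lam i)]; divide it out, then sort the [lam i]. *)
Lemma lattice_normal_form n m (L : set 'rV[{fps K}]_n) N :
  is_submodule (order iota m) (free_module (order iota m) (n:=n)) L ->
  cosets (free_module (order iota m) (n:=n)) L #= `I_N ->
  exists s d (b : 'M[{fps K}]_n), [/\ s \in box_partitions m n, has_val d (\det b),
    forall i j : 'I_n, prof 0 (nth 0%N s i) (b i j) &
    L = lat m (fun i : 'I_n => nth 0%N s i) b].
Proof.
move=> Lsub Lidx.
have [d [b [lam [bd lamm LE]]]] := lattice_adapted alpha_notin alpha_span Lsub Lidx.
have LM x : L x -> forall j, prof 0 m (x 0 j).
  by case: Lsub => H _ _ _ /H Mx j; apply: Mx.
have bP i j : prof (m - lam i) m (b i j).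
  have rowL a : prof 0 (lam i) a -> L (a *: row i b).
    move=> aP; apply/LE; exists (a *: delta_mx 0 i); last by rewrite -scalemxAl -rowE.
    move=> k; rewrite !mxE eqxx andTb mulr_natr mulrb.
    by case: ifP => [/eqP ->|_] //; apply: profile0.
  apply: (@profile_alpha 0) => //.
    have /rowL/LM/(_ j) : prof 0 (lam i) 1.
      by move=> l; split=> // _; rewrite fps_coef1 rpred_nat.
    by rewrite scale1r mxE.
  have /rowL/LM/(_ j) : prof 0 (lam i) (fpsC alpha * T ^+ lam i).
    move=> l; split=> // ll; rewrite coef_fpsCM coef_fpsXn (ltn_eqF ll) mulr0.
    exact: rpred0.
  by rewrite !mxE.
pose b1 : 'M[{fps K}]_n := \matrix_(i, j) fps_shift (m - lam i) (b i j).
have bE i j : b i j = T ^+ (m - lam i) * b1 i j.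
  by rewrite mxE -fpsXn_shift // => l /(bP i j l).1.
have b1P i j : prof 0 (lam i) (b1 i j).
  by rewrite -(profileXn _ (m - lam i)) -bE addn0 subnK.
have bD : b = diag_mx (\row_i T ^+ (m - lam i)) *m b1.
  by apply/matrixP => i j; rewrite mul_diag_mx [RHS]mxE bE; congr (_ * _); rewrite mxE.
have [d1 b1d] : exists d1, has_val d1 (\det b1).
  apply: has_val_exists; apply: contraTneq isT => b10.
  by move: (has_val_neq0 bd); rewrite bD det_mulmx b10 mulr0 eqxx.
pose lt := [tuple lam i | i < n].
have [p pE] : exists p : 'S_n, sort geq lt = [tuple tnth lt (p i) | i < n].
  by apply/tuple_permP; rewrite perm_sort.
have sE (i : 'I_n) : nth 0%N (sort geq lt) i = lam (p i).
  by rewrite pE -tnth_nth tnth_mktuple tnth_mktuple.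
exists (sort geq lt), d1, (row_perm p b1); split.
- rewrite mem_box_partitions size_sort size_tuple eqxx.
  rewrite sort_sorted; last by move=> x y; apply: leq_total.
  by rewrite all_sort; apply/allP => _ /mapP[i _ ->].
- by rewrite row_permE det_mulmx has_val_unitM // -unitmxE unitmx_perm.
- by move=> i j; rewrite sE mxE.
have -> : (fun i : 'I_n => nth 0%N (sort geq lt) i) = (fun i => lam (p i)).
  by apply/funext => i; rewrite sE.
rewrite lat_perm; apply/funext => x; apply/propext; rewrite LE; split=> -[y yP ->].
  exists (y *m diag_mx (\row_i T ^+ (m - lam i))); last by rewrite -mulmxA -bD.
  move=> i; rewrite mul_mx_diag !mxE mulrC -{1}[(m - lam i)%N]addn0.
  by rewrite -{2}(subnK (lamm i)) profileXn.
exists (\row_i fps_shift (m - lam i) (y 0 i)).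
  move=> i; rewrite mxE -(profileXn _ (m - lam i)) -fpsXn_shift.
    by rewrite addn0 subnK.
  by move=> l /(yP i l).1.
rewrite bD mulmxA; congr (_ *m _); apply/rowP => i; rewrite mul_mx_diag !mxE mulrC.
by rewrite -fpsXn_shift // => l /(yP i l).1.
Qed.

(** The coordinates of [b'_i] are tested on the elements [T^(m - lam' i) b'_i] and
    [alpha T^m b'_i] of the smaller lattice; [profile_alpha] combines the two. *)
Lemma lat_sub_frame n m lam lam' d (b b' : 'M[{fps K}]_n) :
  (forall i, lam i <= m)%N -> (forall i, lam' i <= m)%N -> has_val d (\det b) ->
  (forall x, lat m lam' b' x -> lat m lam b x) ->
  exists w : 'M[{fps K}]_n,
    b' = w *m b /\ forall i j, prof (lam' i - lam j) (lam' i) (w i j).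
Proof.
move=> lamm lamm' bd sub.
have rowL i a : prof (m - lam' i) m a -> lat m lam b (a *: row i b').
  move=> aP; apply: sub; exists (a *: delta_mx 0 i); last by rewrite -scalemxAl -rowE.
  move=> k; rewrite !mxE eqxx andTb mulr_natr mulrb.
  by case: ifP => [/eqP ->|_] //; apply: profile0.
have wP i : exists w : 'rV[{fps K}]_n,
    row i b' = w *m b /\ forall j, prof (lam' i - lam j) (lam' i) (w 0 j).
  have [Y YP YE] : lat m lam b (T ^+ (m - lam' i) *: row i b').
    apply: rowL => l; split=> H; rewrite coef_fpsXn ?rpred_nat //.
    by rewrite ltn_eqF.
  have [Z ZP ZE] : lat m lam b ((fpsC alpha * T ^+ m) *: row i b').
    apply: rowL => l; split=> H; rewrite coef_fpsCM coef_fpsXn.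
      by rewrite ltn_eqF ?mulr0 //; lia.
    by rewrite ltn_eqF // mulr0 rpred0.
  have ZY : Z = (fpsC alpha * T ^+ lam' i) *: Y.
    apply: (mulmx_rcancel bd); rewrite -ZE -scalemxAl -YE scalerA -mulrA -exprD.
    by rewrite subnKC.
  have YP' j : prof (m - minn (lam' i) (lam j)) m (Y 0 j).
    move=> l; split; last exact: (YP j l).2.
    have := @profile_alpha (m - lam j) m (lam' i) (Y 0 j) (leq_subr _ _) (YP j).
    have := ZP j; rewrite ZY mxE => H /(_ H) H' lm.
    have [|ml] := ltnP l (m - lam j); first exact: (YP j l).1.
    by apply: (H' l).1; move: lm ml; rewrite /minn; case: ifP; lia.
  have YT j : Y 0 j = T ^+ (m - lam' i) * fps_shift (m - lam' i) (Y 0 j).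
    apply: fpsXn_shift => l lm; apply: (YP' j l).1.
    by move: lm; rewrite /minn; case: ifP; lia.
  exists (\row_j fps_shift (m - lam' i) (Y 0 j)); split.
    have Tv : has_val (m - lam' i) (T ^+ (m - lam' i)).
      by rewrite -[T ^+ _]mulr1 -{1}[(m - _)%N]addn0 has_val_XnM; apply/has_val0; exact: unitr1.
    have YE' : Y = T ^+ (m - lam' i) *: \row_j fps_shift (m - lam' i) (Y 0 j).
      by apply/rowP => j; rewrite mxE [in RHS]mxE -YT.
    rewrite {}YE' -scalemxAl in YE; move/rowP: YE => YE.
    apply/rowP => j; apply: (has_val_lreg Tv).
    by have := YE j; rewrite mxE [in RHS]mxE.
  move=> j; rewrite mxE -(profileXn _ (m - lam' i)) -YT subnK //.
  by apply: profileW (YP' j) => //; rewrite /minn; case: ifP; have := lamm' i; have := lamm j; lia.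
have [w wE] := choice wP.
exists (\matrix_i w i); split=> [|i j]; last by rewrite mxE; apply: (wE i).2.
by apply/row_matrixP => i; rewrite row_mul rowK; apply: (wE i).1.
Qed.

(** Leibniz' formula turns an invertible change of frame into a domination
    between the two types. *)
Lemma frame_change_perm n lam lam' (w : 'M[{fps K}]_n) : w \in unitmx ->
  (forall i j, prof (lam' i - lam j) (lam' i) (w i j)) ->
  exists p : 'S_n, forall i, (lam' i <= lam (p i))%N.
Proof.
rewrite unitmx_layer0 unitmxE unitfE => dw wP.
apply: contrapT => /forallNP H; case/eqP: dw; apply: big1 => p _.
have /existsNP[i /negP] := H p; rewrite -ltnNge => ip.
rewrite (bigD1 i) //= mxE ((wP i (p i) 0%N).1) ?mul0r ?mulr0 //.
by rewrite subn_gt0.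
Qed.

(** The automorphism group of the sum of the rings [F[[T]] + T^(lam i) K[[T]]], as
    it acts on frames. *)
Definition aut n (lam : 'I_n -> nat) : set 'M[{fps K}]_n :=
  fun w => (forall i j, prof (lam i - lam j) (lam i) (w i j)) /\ w \in unitmx.

(** Equal lattices have mutually inverse changes of frame. By
    [frame_change_perm] their types dominate each other up to permutations, so
    they are equal, both being sorted. *)
Lemma lat_eq_type n m s s' d d' (b b' : 'M[{fps K}]_n) :
  let lam (i : 'I_n) := nth 0%N s i in let lam' (i : 'I_n) := nth 0%N s' i in
  s \in box_partitions m n -> s' \in box_partitions m n ->
  has_val d (\det b) -> has_val d' (\det b') ->
  lat m lam b = lat m lam' b' -> s = s' /\ exists2 w, aut lam w & b' = w *m b.
Proof.
move=> lam lam'; rewrite !mem_box_partitions.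
move=> /and3P[ss /eqP sz /allP sm] /and3P[ss' /eqP sz' /allP sm'] bd bd' E.
have lamm i : (lam i <= m)%N by apply: sm; rewrite mem_nth ?sz.
have lamm' i : (lam' i <= m)%N by apply: sm'; rewrite mem_nth ?sz'.
have [|w [bw wP]] := @lat_sub_frame _ m lam lam' d b b' lamm lamm' bd; first by rewrite E.
have [|v [bv vP]] := @lat_sub_frame _ m lam' lam d' b' b lamm' lamm bd'; first by rewrite E.
have wv : w *m v = 1%:M.
  by apply: (mulmx_rcancel bd'); rewrite mul1mx -mulmxA -bv -bw.
have [wU vU] := mulmx1_unit wv.
have [p pP] := frame_change_perm wU wP.
have [r rP] := frame_change_perm vU vP.
have sumE : (\sum_i lam i = \sum_i lam' i)%N.
  apply/eqP; rewrite eqn_leq; apply/andP; split.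
    by rewrite [X in (_ <= X)%N](reindex_inj (@perm_inj _ r)); apply: leq_sum => i _; apply: rP.
  by rewrite [X in (_ <= X)%N](reindex_inj (@perm_inj _ p)); apply: leq_sum => i _; apply: pP.
have lamE i : lam' i = lam (p i).
  have E' : (\sum_i lam' i == \sum_i lam (p i))%N.
    by rewrite -sumE [X in X == _](reindex_inj (@perm_inj _ p)).
  have [_] := leqif_sum (P := xpredT) (fun i _ => leqif_eq (pP i)).
  by rewrite E' => /esym/forallP/(_ i)/eqP.
have ssE : s = s'.
  apply: (sorted_eq (leT := geq)) => //.
  - by move=> x y z; rewrite /geq /= => xy /leq_trans; apply.
  - by move=> x y; rewrite /geq /= => /anti_leq.
  pose tl := [tuple lam i | i < n]; pose tl' := [tuple lam' i | i < n].
  have -> : s = tl.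
    apply: (@eq_from_nth _ 0%N) => [|i]; rewrite ?size_tuple // sz => ilt.
    by rewrite -[i]/(val (Ordinal ilt)) -tnth_nth tnth_mktuple.
  have -> : s' = tl'.
    apply: (@eq_from_nth _ 0%N) => [|i]; rewrite ?size_tuple // sz' => ilt.
    by rewrite -[i]/(val (Ordinal ilt)) -tnth_nth tnth_mktuple.
  rewrite perm_sym; apply/tuple_permP; exists p; congr tval.
  by apply: eq_from_tnth => i; rewrite !tnth_mktuple lamE.
split=> //; exists w => //; split=> // i j.
by have := wP i j; rewrite /lam' -ssE.
Qed.

End NormalForm.

Section LatticeVolume.
Variables (F K : finFieldType) (iota : {rmorphism F -> K}).
Local Notation prof := (profile iota).
Local Notation q := (#|F|).
Hypothesis QE : #|K| = (#|F| ^ 2)%N.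

(** The image under [b] of a box of row vectors. *)
Lemma lat_volume n m d lam (b : 'M[{fps K}]_n) : (forall i, lam i <= m)%N ->
  has_val d (\det b) -> stable (lat iota m lam b) /\
  vol (lat iota m lam b) = (q ^ (2 * d + \sum_i (2 * m - lam i)))%:R^-1.
Proof.
move=> lamm bd.
have [e eB] := box_stable iota (p := 1) (fun _ i => m - lam i)%N (fun _ _ => m).
have [|/stable_at_stable sS ->] := vol_image_mulr (S' := lat iota m lam b) eB bd.
  move=> x; split=> -[y yP ->].
    by exists y => // i j; rewrite ord1; apply: yP.
  by exists y => // i; exact: (yP 0 i).
split=> //; rewrite vol_box // => [|i j]; last exact: leq_subr.
rewrite big_ord1 -expn_sum -invfM -natrM QE -expnM -expnD mul1n.
by congr (_ ^ (_ + _))%N%:R^-1; apply: eq_bigr => i _; have := lamm i; lia.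
Qed.

Lemma free_volume n m : let M := free_module (order iota m) (n:=n) in
  stable M /\ vol M = (q ^ (m * n))%:R^-1.
Proof.
move=> M; have ME x : M x <-> box iota (p := 1) (fun _ _ => 0%N) (fun _ _ => m) x.
  by split=> [H i j|H j]; [rewrite ord1; apply: H|apply: H].
have [e eB] := box_stable iota (p := 1) (n := n) (fun _ _ => 0%N) (fun _ _ => m).
split; first by exists e => x y exy /ME /(eB _ _ exy) /ME.
rewrite (eq_vol ME) vol_box // big_ord1 add0n.
by rewrite big_const_ord iter_muln_1 -expnM.
Qed.

(** One inclusion is a computation, and both sides have the same volume. *)
Lemma lat_aut n m d lam (b w : 'M[{fps K}]_n) : (forall i, lam i <= m)%N ->
  has_val d (\det b) -> aut iota lam w -> lat iota m lam (w *m b) = lat iota m lam b.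
Proof.
move=> lamm bd [wP wU].
have wbd : has_val d (\det (w *m b)) by rewrite det_mulmx has_val_unitM // -unitmxE.
have sub x : lat iota m lam (w *m b) x -> lat iota m lam b x.
  move=> [y yP ->]; exists (y *m w); last by rewrite mulmxA.
  move=> j; rewrite mxE; apply: profile_sum => i _.
  by apply: profileW (profileM (yP i) (wP i j)); have := lamm i; have := lamm j; lia.
have [sS vS] := lat_volume lamm bd; have [sS' vS'] := lat_volume lamm wbd.
apply/funext => x; apply/propext; split; first exact: sub.
by apply: vol_sub_eq => //; rewrite vS vS'.
Qed.

(** The index is the ratio of the volumes of [R^n] and of the lattice. *)
Lemma lat_index n m d k s (b : 'M[{fps K}]_n) :
  let lam (i : 'I_n) := nth 0%N s i in s \in box_partitions m n ->
  has_val d (\det b) -> (forall i j, prof 0 (lam i) (b i j)) ->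
  submodules_of_index (order iota m) (n:=n) (q ^ k) (lat iota m lam b) <->
  (k + sumn s = 2 * d + m * n)%N.
Proof.
move=> lam; rewrite mem_box_partitions => /and3P[ss /eqP sz /allP sm] bd bP.
have lamm i : (lam i <= m)%N by apply: sm; rewrite mem_nth ?sz.
have [sL vL] := lat_volume lamm bd; have [sM vM] := free_volume n m.
have LM x : lat iota m lam b x -> free_module (order iota m) (n:=n) x.
  move=> [y yP ->] j; rewrite mxE; apply: profile_sum => i _.
  by apply: profileW (profileM (yP i) (bP i j)); have := lamm i; lia.
have LD x y : lat iota m lam b x -> lat iota m lam b y -> lat iota m lam b (x + y).
  move=> [u uP ->] [v vP ->]; exists (u + v); last by rewrite mulmxDl.
  by move=> i; rewrite mxE; apply: profileD.
have LZ a x : prof 0 m a -> lat iota m lam b x -> lat iota m lam b (a *: x).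
  move=> aP [u uP ->]; exists (a *: u); last by rewrite scalemxAl.
  by move=> i; rewrite mxE; apply: profileW (profileM aP (uP i)); lia.
have L0 : lat iota m lam b 0.
  by exists 0; rewrite ?mul0mx // => i; rewrite mxE; apply: profile0.
have sub : is_submodule (order iota m) (free_module (order iota m) (n:=n)) (lat iota m lam b).
  by split=> // a x aP; apply: LZ.
have MD x y : free_module (order iota m) (n:=n) x ->
    free_module (order iota m) (n:=n) y -> free_module (order iota m) (n:=n) (x + y).
  by move=> Mx My j; rewrite mxE; apply: profileD; [apply: Mx|apply: My].
have LN x : lat iota m lam b x -> lat iota m lam b (- x).
  by move=> [u uP ->]; exists (- u); rewrite ?mulNmx // => i; rewrite mxE; apply: profileN.
have q1 : (1 < q)%N by apply: finNzRing_gt1.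
have -> : submodules_of_index (order iota m) (n:=n) (q ^ k) (lat iota m lam b) <->
    (q ^ k)%:R * vol (lat iota m lam b) = vol (free_module (order iota m) (n:=n)).
  by rewrite -card_cosets //; split=> [[]|].
have nz j : (q ^ j)%:R != 0 :> rat by rewrite pnatr_eq0 -lt0n expn_gt0 (ltnW q1).
have sumE : (\sum_(i < n) (2 * m - lam i) + sumn s = 2 * (m * n))%N.
  have -> : sumn s = (\sum_(i < n) lam i)%N.
    by rewrite sumnE (big_nth 0%N) sz big_mkord.
  rewrite -big_split /= (eq_bigr (fun=> 2 * m)%N).
    by rewrite sum_nat_const card_ord mulnC mulnA.
  by move=> i _; have := lamm i; lia.
have qinj (x y : nat) : (q ^ x)%:R = (q ^ y)%:R :> rat <-> x = y.
  split=> [/eqP|-> //]; rewrite eqr_nat => /eqP; exact: (expnI q1).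
have -> : (k + sumn s = 2 * d + m * n)%N <->
    (k + m * n = 2 * d + \sum_i (2 * m - lam i))%N.
  by move: sumE; move: (\sum_(i < n) _)%N (sumn s) (m * n)%N => x y z; lia.
have divE (x y z : rat) : y != 0 -> z != 0 -> x * y^-1 = z^-1 <-> x * z = y.
  move=> y0 z0; rewrite -[z^-1]mul1r.
  split=> [/eqP|E]; first by rewrite eqr_div // mul1r => /eqP.
  by apply/eqP; rewrite eqr_div // E mul1r.
by rewrite vL vM divE // -natrM -expnD qinj.
Qed.

End LatticeVolume.

(** * The number of submodules of a given type *)

Section Frames.
Variables (F K : finFieldType) (iota : {rmorphism F -> K}).
Local Notation prof := (profile iota).

Definition frames n (lam : 'I_n -> nat) d : set 'M[{fps K}]_n :=
  fun b => (forall i j, prof 0 (lam i) (b i j)) /\ has_val d (\det b).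

Lemma has_val_det_stable n d :
  stable_at d.+1 (fun b : 'M[{fps K}]_n => has_val d (\det b)).
Proof.
move=> x y exy [x0 xd]; split; last by rewrite -(eqm_det exy).
by move=> l ld; rewrite -(eqm_det exy) ?x0 //; apply: ltnW.
Qed.

Lemma frames_stable n (lam : 'I_n -> nat) d : stable (frames lam d).
Proof.
apply: stableI; last by exists d.+1; apply: has_val_det_stable.
exact: (box_stable iota (fun _ _ => 0%N) (fun i _ => lam i)).
Qed.

Lemma aut_stable n (lam : 'I_n -> nat) : stable (aut iota lam).
Proof.
apply: stableI; first exact: (box_stable iota (fun i j => lam i - lam j)%N (fun i _ => lam i)).
by exists 1%N => x y exy; rewrite !unitmx_layer0 (exy 0%N).
Qed.

Lemma aut_frames n (lam : 'I_n -> nat) d (w b : 'M[{fps K}]_n) :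
  aut iota lam w -> frames lam d b -> frames lam d (w *m b).
Proof.
move=> [wP wU] [bP bd]; split; last by rewrite det_mulmx has_val_unitM // -unitmxE.
move=> i j; rewrite mxE; apply: profile_sum => k _.
by apply: profileW (profileM (wP i k) (bP k j)); lia.
Qed.

End Frames.

Section CountType.
Variables (F K : finFieldType) (iota : {rmorphism F -> K}) (alpha : K).
Local Notation base := (base_field iota).
Hypothesis alpha_notin : alpha \notin base.
Hypothesis QE : #|K| = (#|F| ^ 2)%N.
Local Notation Q := (#|K|).

(** The map from frames to lattices has the orbits of the automorphism group as
    fibers. Right multiplication by a frame scales volumes by [Q^-(n d)], so all
    the orbits have the same volume. *)
Lemma card_lattices_type m n s d : s \in box_partitions m n ->
  let lam (i : 'I_n) := nth 0%N s i in
  exists2 N, [set L | exists2 b, frames iota lam d b & L = lat iota m lam b] #= `I_N &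
    N%:R * ((Q ^ (n * d))%:R^-1 * vol (aut iota lam)) = vol (frames iota lam d).
Proof.
move=> sb lam.
have lamm i : (lam i <= m)%N.
  by move: sb; rewrite mem_box_partitions => /and3P[_ /eqP sz /allP sm]; apply: sm; rewrite mem_nth ?sz.
have [e0 eA] := aut_stable iota lam; have [e1 eB] := frames_stable iota lam d.
pose e := maxn (e0 + d) e1.
pose fib (b b' : 'M[{fps K}]_n) := exists2 w, aut iota lam w & b' = w *m b.
have fibP b : frames iota lam d b -> stable_at e (fib b) /\
    vol (fib b) = (Q ^ (n * d))%:R^-1 * vol (aut iota lam).
  move=> [_ bd]; have [|eF vF] := vol_image_mulr (S' := fib b) eA bd; first by [].
  by split=> //; apply: stable_atW eF; rewrite leq_maxl.
have {}eB : stable_at e (frames iota lam d) by apply: stable_atW eB; rewrite leq_maxr.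
have fib_refl b : fib b b.
  exists 1%:M; last by rewrite mul1mx.
  split=> [i j l|]; last exact: unitmx1.
  split=> H; rewrite mxE; case: eqP => ij; rewrite ?mulr0n ?mulr1n ?fps_coef0 ?rpred0 //.
    by move: H; rewrite ij subnn.
  by rewrite fps_coef1 rpred_nat.
have fib_lat b b' : frames iota lam d b ->
    fib b b' <-> frames iota lam d b' /\ lat iota m lam b = lat iota m lam b'.
  move=> bF; have [bP bd] := bF; split=> [[w wA ->]|[[b'P b'd] E]].
    by split; [exact: aut_frames|rewrite (lat_aut QE lamm bd wA)].
  by have [_ H] := lat_eq_type alpha_notin sb sb bd b'd E.
have [[b0 b0F]|] := pselect (exists b, frames iota lam d b); last first.
  move=> /forallNP nF; exists 0%N; last by rewrite mul0r vol_set0.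
  rewrite (_ : mkset _ = set0) ?II0 //.
  by apply/funext => L; apply/propext; split=> // -[b /nF].
pose A := [set c : {ffun 'I_e -> 'M[K]_n} | `[< frames iota lam d (lift_trunc c) >]]%SET.
have cfib b : frames iota lam d b -> cnt e (fib b) = cnt e (fib b0).
  move=> bF; have [eF vF] := fibP b bF; have [eF0 vF0] := fibP b0 b0F.
  apply/eqP; rewrite -(eqr_nat rat); apply/eqP.
  have : vol (fib b) = vol (fib b0) by rewrite vF vF0.
  rewrite (volE eF) (volE eF0) /vol_at; apply: mulIf.
  by rewrite invr_eq0 Q_neq0.
have [N cN NE] : exists2 N, [set L | exists2 b, frames iota lam d b & L = lat iota m lam b] #= `I_N
    & (N * cnt e (fib b0))%N = #|A|.
  apply: (@card_uniform_fibers _ _ A (fun c => lat iota m lam (lift_trunc c))).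
  - move=> L; split=> [[b bF ->]|[c]]; last first.
      by rewrite finset.in_set => /asboolP cF <-; exists (lift_trunc c).
    have /fib_lat[//|cF E] : fib b (lift_trunc (trunc e b)).
      by have [eF _] := fibP b bF; apply: eF (fib_refl b); apply/eqm_sym/trunc_lift.
    by exists (trunc e b); rewrite ?E // finset.in_set; apply/asboolP.
  - apply/card_gt0P; exists (trunc e b0); rewrite finset.in_set; apply/asboolP.
    by have [eF _] := fibP b0 b0F; apply: eF (fib_refl b0); apply/eqm_sym/trunc_lift.
  move=> c; rewrite finset.in_set => /asboolP cF; rewrite -(cfib _ cF).
  apply: eq_card => c'; rewrite !finset.in_set; apply/andP/asboolP.
    by move=> [/asboolP c'F /eqP E]; apply/fib_lat.
  by move=> /fib_lat[//|c'F E]; split; [apply/asboolP|apply/eqP].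
exists N => //; have [eF0 <-] := fibP b0 b0F.
by rewrite (volE eF0) (volE eB) /vol_at mulrA -natrM NE.
Qed.

End CountType.

(** * The volume of the frames: recursion *)

Section FrameVolume.
Variables (F K : finFieldType) (iota : {rmorphism F -> K}).
Hypothesis QE : #|K| = (#|F| ^ 2)%N.
Local Notation T := (fpsX K).
Local Notation prof := (profile iota).
Local Notation q := (#|F|).
Local Notation Q := (#|K|).

Lemma profileV x (u : {fps K}) : u \is a GRing.unit -> prof 0 x u -> prof 0 x u^-1.
Proof.
move=> uU uP; have u0 : u 0%N != 0 by rewrite -fps_unitE.
elim/ltn_ind => l IH; split=> // lx.
have : (u * u^-1) l = (l == 0%N)%:R by rewrite divrr // fps_coef1.
rewrite fps_coefM big_ord_recl subn0 => /(canRL (addrK _)) /(canRL (mulKf u0)) ->.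
rewrite rpredM ?rpredV ?rpredB ?rpred_nat //; first by apply: (uP 0%N).2; lia.
apply: rpred_sum => -[i il] _; rewrite rpredM //.
  by apply: (uP _).2 => /=; rewrite /bump /=; lia.
by apply: (IH _ _).2; rewrite /= /bump /=; lia.
Qed.

(** Move a unit entry to the front and clear the others by column operations. As
    [F[[T]] + T^x K[[T]]] is a local ring, the operations and their inverses stay
    over it. *)
Lemma unimodular_row n x (r : 'M[{fps K}]_(1, 1 + n)) :
  (forall j, prof 0 x (r 0 j)) -> layer 0 r != 0 ->
  exists G H, [/\ G *m H = 1%:M, r *m G = row_mx (1%:M : 'M_1) (0 : 'M_(1, n)),
    forall i j, prof 0 x (G i j) & forall i j, prof 0 x (H i j)].
Proof.
move=> rP r0.
have prof1 (b : bool) : prof 0 x (b%:R).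
  by case: b; [move=> l; split=> // _; rewrite fps_coef1 rpred_nat|apply: profile0].
have profMx p1 p2 p3 (A : 'M[{fps K}]_(p1, p2)) (B : 'M[{fps K}]_(p2, p3)) :
    (forall i j, prof 0 x (A i j)) -> (forall i j, prof 0 x (B i j)) ->
    forall i j, prof 0 x ((A *m B) i j).
  move=> AP BP i j; rewrite mxE; apply: profile_sum => k _.
  by apply: profileW (profileM (AP i k) (BP k j)); rewrite ?minnn.
have [j rj] : exists j, (r 0 j) 0%N != 0.
  apply: contrapT => /forallNP H; case/eqP: r0; apply/rowP => j.
  by rewrite !mxE; apply/eqP/negPn/negP/H.
pose P := perm_mx (tperm 0 j) : 'M[{fps K}]_(1 + n).
have PP : P *m P = 1%:M by rewrite -perm_mxM tperm2 perm_mx1.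
have Pprof i k : prof 0 x (P i k) by rewrite !mxE.
pose s := r *m P.
have sP k : prof 0 x (s 0 k) by apply: profMx => // i k'; rewrite ord1.
pose u := lsubmx s 0 0; pose v := rsubmx s.
have uE : u = r 0 j.
  rewrite /u mxE (_ : lshift n 0 = 0); last exact: val_inj.
  have -> : s = col_perm (tperm 0 j) r by rewrite /s /P -{1}(tpermV 0 j) -col_permE.
  by rewrite mxE tpermL.
have uU : u \is a GRing.unit by rewrite fps_unitE uE.
have uP : prof 0 x u by rewrite /u mxE.
have vP k : prof 0 x (v 0 k) by rewrite /v mxE.
have sE : s = row_mx u%:M v by rewrite -[LHS]hsubmxK -mx11_scalar.
pose blk a (w : 'M[{fps K}]_(1, n)) : 'M[{fps K}]_(1 + n) := block_mx a%:M w 0 1%:M.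
have blkP a (w : 'M[{fps K}]_(1, n)) : prof 0 x a -> (forall k, prof 0 x (w 0 k)) ->
    forall i k, prof 0 x (blk a w i k).
  move=> aP wP i k; rewrite -(splitK i) -(splitK k).
  case: (fintype.split i) => i'; case: (fintype.split k) => k'; rewrite /blk /unsplit.
  - by rewrite block_mxEul !ord1 mxE eqxx mulr1n.
  - by rewrite block_mxEur ord1.
  - by rewrite block_mxEdl mxE; apply: profile0.
  by rewrite block_mxEdr mxE.
exists (P *m blk u^-1 (- u^-1 *: v)), (blk u v *m P); split.
- rewrite mulmxA -[P *m _ *m _]mulmxA /blk mulmx_block !mul0mx !mulmx0 !mulmx1 !addr0 !add0r.
  rewrite -scalar_mxM mulVr // mul_scalar_mx scaleNr subrr -scalar_mx_block.
  by rewrite mulmx1 PP.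
- rewrite mulmxA -/s sE /blk mul_row_block !mulmx0 mulmx1 addr0 -scalar_mxM divrr //.
  by rewrite mul_scalar_mx scalerA mulrN divrr // scaleN1r addNr.
- apply: profMx => //; apply: blkP; first exact: profileV.
  move=> k; rewrite mxE mulNr; apply: profileN.
  by apply: profileW (profileM (profileV uU uP) (vP k)); rewrite ?minnn.
by apply: profMx => //; apply: blkP.
Qed.

Definition typ (s : seq nat) n (i : 'I_n) := nth 0%N s i.

Lemma frames_vol_perm n s s' d : size s = n -> perm_eq s s' ->
  vol (frames iota (@typ s n) d) = vol (frames iota (@typ s' n) d).
Proof.
move=> sz pss'; have sz' : size s' = n by rewrite -(perm_size pss').
pose t := [tuple @typ s n i | i < n]; pose t' := [tuple @typ s' n i | i < n].
have tE u : size u = n -> [tuple @typ u n i | i < n] = u :> seq nat.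
  move=> su; apply: (@eq_from_nth _ 0%N) => [|i]; rewrite ?size_tuple // => ilt.
  by rewrite -[i]/(val (Ordinal ilt)) -tnth_nth tnth_mktuple.
have [p pE] : exists p : 'S_n, t = [tuple tnth t' (p i) | i < n] :> seq nat.
  by apply/tuple_permP; rewrite !tE.
have lamE i : @typ s n i = @typ s' n (p i).
  have /(congr1 (fun u => tnth u i)) : t = [tuple tnth t' (p i) | i < n] by apply: val_inj.
  by rewrite !tnth_mktuple.
rewrite -(@vol_mull _ _ _ (perm_mx p) (frames iota (@typ s n) d)); first last.
- exact: frames_stable.
- exact: unitmx_perm.
apply: eq_vol => b; rewrite /frames det_mulmx has_val_unitM -?unitmxE ?unitmx_perm //.
rewrite -row_permE; split=> -[bP bd]; split=> // i j.
  by have := bP (p^-1%g i) j; rewrite mxE lamE permKV.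
by rewrite mxE lamE.
Qed.

Lemma vol_rowM p n1 n2 (A : set 'M[{fps K}]_(p, n1)) (B : set 'M[{fps K}]_(p, n2)) :
  stable A -> stable B ->
  let S := fun x => A (lsubmx x) /\ B (rsubmx x) in
  stable S /\ vol S = vol A * vol B.
Proof.
move=> sA sB S; have [sAt <-] := vol_tr sA; have [sBt <-] := vol_tr sB.
have [sS <-] := vol_colM sAt sBt; have [sSt <-] := vol_tr sS.
have E x : S x <-> A (usubmx x^T)^T /\ B (dsubmx x^T)^T.
  by rewrite /S !trmx_usub !trmx_dsub !trmxK.
split; last exact: eq_vol.
by have [e eS] := sSt; exists e => x y exy /E /(eS _ _ exy) /E.
Qed.

Lemma profile_T x (f : {fps K}) : prof 0 x (T * f) <-> prof 0 x.-1 f.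
Proof.
split=> H l; split=> // lx; first by have := (H l.+1).2; rewrite coef_fpsXM; apply; lia.
by rewrite coef_fpsXM; case: l lx => [|l] lx; [apply: rpred0|apply: (H l).2; lia].
Qed.

Lemma frames_vol0 s d : vol (frames iota (@typ s 0) d) = (d == 0%N)%:R.
Proof.
case: d => [|d].
  rewrite vol_setT // => b; split=> [[]//|].
  by apply/has_val0; rewrite det_mx00 unitr1.
rewrite vol_set0 // => b [_ []]; rewrite det_mx00 => /(_ 0%N isT) /eqP.
by rewrite fps_coef1 oner_eq0.
Qed.

(** The first row is either unimodular or divisible by [T]. In the second case,
    dividing it lowers [x] and [d] by 1. In the first case column operations over
    [F[[T]] + T^x K[[T]]] clear it; they preserve the conditions on the other rows
    because [x] is the largest part, and what remains is a frame of size [n] with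
    a free first column. *)
Lemma frames_vol_step n x r d : size r = n -> all (leq^~ x) r ->
  let V k s e := vol (frames iota (@typ s k) e) in
  V n.+1 (x :: r) d =
    ((q ^ (n.+1 * x))%:R^-1 - (Q ^ n.+1)%:R^-1 * (q ^ (n.+1 * x.-1))%:R^-1)
      * (q ^ sumn r)%:R^-1 * V n r d
  + (if d is e.+1 then (Q ^ n.+1)%:R^-1 * V n.+1 (x.-1 :: r) e else 0).
Proof.
move=> rs rx V.
pose A0 := box iota (p := 1) (n := 1 + n) (fun _ _ => 0%N) (fun _ _ => x).
pose A1 (y : 'M[{fps K}]_(1, 1 + n)) := A0 y /\ layer 0 y = 0.
pose A (y : 'M[{fps K}]_(1, 1 + n)) := A0 y /\ layer 0 y != 0.
pose S0 := frames iota (@typ (x :: r) (1 + n)) d.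
pose S (b : 'M[{fps K}]_(1 + n)) := S0 b /\ layer 0 (usubmx b) != 0.
pose S1 (b : 'M[{fps K}]_(1 + n)) := S0 b /\ layer 0 (usubmx b) = 0.
pose B := box iota (p := n) (n := 1 + n) (fun _ _ => 0%N) (fun i _ => typ r i).
have frE (y : 'M[{fps K}]_(1, 1 + n)) z x' e :
    frames iota (@typ (x' :: r) (1 + n)) e (col_mx y z) <->
    [/\ forall j, prof 0 x' (y 0 j), B z & has_val e (\det (col_mx y z))].
  split=> [[bP bd]|[yP zB bd]].
    split=> // [j|i j]; first by have := bP (lshift n 0) j; rewrite col_mxEu.
    by have := bP (rshift 1 i) j; rewrite col_mxEd.
  split=> // i j; rewrite -(splitK i); case: (fintype.split i) => k /=.
    by rewrite col_mxEu ord1.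
  by rewrite col_mxEd; apply: zB.
have sA0 : stable A0 by apply: box_stable.
have st0 p n' : stable (fun y : 'M[{fps K}]_(p, n') => layer 0 y = 0).
  by exists 1%N => y z /(_ 0%N isT) ->.
have st0' p n' : stable (fun y : 'M[{fps K}]_(p, n') => layer 0 y != 0).
  by exists 1%N => y z /(_ 0%N isT) ->.
have sA : stable A by apply: stableI.
have sA1 : stable A1 by apply: stableI.
have su (P : set 'M[{fps K}]_(1, 1 + n)) : stable P ->
    stable (fun b : 'M[{fps K}]_(1 + n) => P (usubmx b)).
  move=> [e eP]; exists e => y z; rewrite -[y]vsubmxK -[z]vsubmxK eqm_col !col_mxKu.
  by case=> E _; apply: eP.
have sS0 : stable S0 by apply: frames_stable.
have sS : stable S by apply: stableI => //; apply: (su (fun y => layer 0 y != 0)).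
have sS1 : stable S1 by apply: stableI => //; apply: (su (fun y => layer 0 y = 0)).
have -> : V n.+1 (x :: r) d = vol S + vol S1.
  rewrite -vol_disjointU //; last by move=> b [_ /eqP H] [_ /H].
  apply: eq_vol => b; split=> [H|[[]|[]]] //.
  by case: (eqVneq (layer 0 (usubmx (b : 'M_(1 + n, 1 + n)))) 0); [right|left].
congr (_ + _); last first.
  case: d @S0 @S @S1 sS0 sS sS1 => [|d] S0 S S1 sS0 sS sS1.
    apply: vol_set0 => b [[_ bd] b0].
    have := bd; rewrite -[b]vsubmxK (mxT_shift b0) det_mxT_row => -[_].
    by rewrite coef_fpsXM eqxx.
  have [e eS] := frames_stable iota (@typ (x.-1 :: r) (1 + n)) d.
  suff H b : S1 b <-> frames iota (@typ (x.-1 :: r) (1 + n)) d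
      (col_mx (map_mx (fps_shift 1) (usubmx b)) (dsubmx b)) /\ layer 0 (usubmx b) = 0.
    by have [_ ->] := vol_scale_row eS H.
  rewrite -[b]vsubmxK /S1 !col_mxKu !col_mxKd; move: (usubmx b) (dsubmx b) => y z.
  have yE : layer 0 y = 0 -> forall j, y 0 j = T * map_mx (fps_shift 1) y 0 j.
    by move=> y0 j; rewrite {1}(mxT_shift y0) mxTE mxE.
  have dE : layer 0 y = 0 -> has_val d.+1 (\det (col_mx y z)) <->
      has_val d (\det (col_mx (map_mx (fps_shift 1) y) z)).
    by move=> y0; rewrite {1}(mxT_shift y0) det_mxT_row; apply: has_val_XM.
  split=> -[/frE[yP zB bd] y0]; split; try exact: y0; apply/frE; split; try exact: zB.
  - by move=> j; apply/profile_T; rewrite -yE.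
  - by have [H _] := dE y0; apply: H.
  - by move=> j; rewrite yE //; apply/profile_T.
  by have [_ H] := dE y0; apply: H.
have vA0 k : vol (box iota (p := 1) (n := 1 + n) (fun _ _ => 0%N) (fun _ _ => k)) =
    (q ^ (n.+1 * k))%:R^-1.
  by rewrite vol_box // big_ord1 add0n big_const_ord iter_muln_1 -expnM mulnC.
have vA : vol A = (q ^ (n.+1 * x))%:R^-1 - (Q ^ n.+1)%:R^-1 * (q ^ (n.+1 * x.-1))%:R^-1.
  rewrite -!vA0; apply/eqP; rewrite eq_sym subr_eq; apply/eqP.
  have -> : vol A0 = vol A + vol A1.
    rewrite -vol_disjointU //; last by move=> y [_ /eqP H] [_ /H].
    apply: eq_vol => y; split=> [H|[[]|[]]] //.
    by case: (eqVneq (layer 0 y) 0); [right|left].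
  congr (_ + _); set A2 := box iota _ _.
  have [|_ ->] := @vol_layer0 _ _ _ A1 A2 (box_stable _ _ _); last by rewrite mul1n.
  move=> y; split=> [[yP y0]|[y' yP ->]].
    exists (map_mx (fps_shift 1) y); last exact: mxT_shift.
    by move=> i j; apply/profile_T; have := yP i j; rewrite {1}(mxT_shift y0) mxTE mxE.
  split; last exact: layer0_mxT.
  by move=> i j; rewrite mxTE mxE; apply/profile_T.
rewrite -vA -mulrA; apply: vol_col_const => //.
  by move=> y z [/frE[yP _ _]]; rewrite col_mxKu => y0; split=> // i j; rewrite ord1.
(* Right multiplication by [G] preserves volumes, so that the volume of the
   fiber over a unimodular first row does not depend on that row. *)
move=> y [yP y0]; have [G [H [GH yG GP HP]]] := unimodular_row (yP 0) y0.
have [GU HU] := mulmx1_unit GH.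
pose S2 (z : 'M[{fps K}]_(n, 1 + n)) :=
  B z /\ has_val d (\det (col_mx (row_mx (1%:M : 'M_1) (0 : 'M_(1, n))) z)).
have sS2 : stable S2.
  apply: stableI; first exact: box_stable.
  exists d.+1 => z z' ezz; apply: has_val_det_stable.
  by apply/eqm_col.
have rx' i : (typ r (i : 'I_n) <= x)%N.
  by apply: (allP rx); rewrite mem_nth // rs.
have BM (M : 'M[{fps K}]_(1 + n)) z : (forall i j, prof 0 x (M i j)) -> B z -> B (z *m M).
  move=> MP zB i j; rewrite mxE; apply: profile_sum => k _.
  by apply: profileW (profileM (zB i k) (MP k j)); have := rx' i; lia.
have -> : vol (fun z => S (col_mx y z)) = vol S2.
  rewrite -(vol_mulr GU sS2); apply: eq_vol => z.
  rewrite /S /S0 frE col_mxKu /S2 -yG -mul_col_mx det_mulmx mulrC has_val_unitM -?unitmxE //.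
  split=> [[[_ zB zd] _]|[zB zd]]; first by split=> //; apply: BM.
  split=> //; split; [exact: (yP 0)| |exact: zd].
  by rewrite -[z]mulmx1 -GH mulmxA; apply: BM.
pose B1 := box iota (p := n) (n := 1) (fun _ _ => 0%N) (fun i _ => typ r i).
have sB1 : stable B1 by apply: box_stable.
have sF := frames_stable iota (@typ r n) d.
have [_] := vol_rowM sB1 sF.
rewrite (_ : vol B1 = (q ^ sumn r)%:R^-1); last first.
  rewrite vol_box //; congr (_%:R^-1); rewrite sumnE (big_nth 0%N) rs big_mkord expn_sum.
  by apply: eq_bigr => i _; rewrite big_ord1 add0n.
move=> <-; apply: eq_vol => z; rewrite -[z]hsubmxK row_mxKl row_mxKr /S2.
move: (lsubmx z) (rsubmx z) => z1 z2.
have -> : \det (col_mx (row_mx 1%:M 0) (row_mx z1 z2)) = \det z2.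
  by rewrite -[col_mx _ _]/(block_mx 1%:M 0 z1 z2) det_lblock det1 mul1r.
split=> [[zB zd]|[z1B [z2B zd]]].
  split; first by move=> i j; have := zB i (lshift n j); rewrite row_mxEl.
  by split=> // i j; have := zB i (rshift 1 j); rewrite row_mxEr.
split=> // i j; rewrite -(splitK j); case: (fintype.split j) => k /=.
  by rewrite row_mxEl; apply: z1B.
by rewrite row_mxEr; apply: z2B.
Qed.

End FrameVolume.

(** * The volume of the automorphism groups *)

Section RowChains.
Variable K : finFieldType.

Lemma row_free_col1 k n (v : 'rV[K]_n) (c : 'M[K]_(k, n)) :
  row_free (col_mx v c) = row_free c && ~~ (v <= c)%MS.
Proof.
rewrite /row_free -addsmxE; have := mxrank_sum_cap v c; have rc := rank_leq_row c.
have [vc|vc] /= := boolP (v <= c)%MS.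
  rewrite (addsmx_idPr vc) andbF => _.
  by apply/negbTE; rewrite neq_ltn add1n ltnS rc.
have v0 : v != 0 by apply: contraNneq vc => ->; apply: sub0mx.
have -> : \rank (v :&: c)%MS = 0%N.
  apply/eqP; rewrite -leqn0 leqNgt; apply/negP => r0; case/negP: vc.
  have [le1 eq1] := mxrank_leqif_sup (capmxSl v c).
  apply: submx_trans (capmxSr v c); rewrite -eq1.
  by move: le1 r0; rewrite rank_rV v0; case: (\rank _) => [|[|]].
by rewrite addn0 rank_rV v0 andbT => ->; rewrite eqn_add2l.
Qed.

(** Rows are added on top, which is why [row a] comes from [W (i.-1 - a)]: for
    each choice of the rows below, the dependent choices for the new row are those
    in the span of the rows below. *)
Lemma card_row_chain n (W : nat -> {set 'rV[K]_n}) (N : nat -> nat) k :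
  let X i := [set c : 'M[K]_(i, n) |
    row_free c && [forall a : 'I_i, row a c \in W (i.-1 - a)%N]]%SET in
  (forall i c, (i < k)%N -> c \in X i -> #|[set v in W i | (v <= c)%MS]%SET| = N i) ->
  #|X k| = (\prod_(i < k) (#|W i| - N i))%N.
Proof.
move=> X; elim: k => [|k IHk] H.
  rewrite big_ord0 (@fintype.eq_card1 _ (0 : 'M[K]_(0, n))) // => c; rewrite !inE.
  rewrite [c]flatmx0 eqxx /row_free mxrank0 eqxx /=.
  by apply/forallP => -[].
rewrite big_ord_recr /= -IHk; last by move=> i c ik; apply: H; apply: ltnW.
pose Y := [set vc : 'rV[K]_n * 'M[K]_(k, n) |
  (vc.2 \in X k) && ((vc.1 \in W k) && ~~ (vc.1 <= vc.2)%MS)]%SET.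
have -> : X k.+1 = [set (col_mx vc.1 vc.2 : 'M_(1 + k, n)) | vc in Y]%SET.
  apply/setP => c; apply/idP/imsetP => [|[[v c'] /= H' ->]].
    rewrite -[c](@vsubmxK _ 1 k); move: (usubmx _) (dsubmx _) => v c'.
    rewrite inE (@row_free_col1 k n) => /andP[/andP[fc vc] /forallP].
    move=> cW0; have cW (a : 'I_(1 + k)) : row a (col_mx v c') \in W (k - a)%N := cW0 a.
    exists (v, c') => //; rewrite !inE /= fc vc andbT /=.
    have := cW (lshift k (0 : 'I_1)); rewrite rowKu row_id /= subn0 => ->; rewrite andbT.
    apply/forallP => a; have := cW (rshift 1 a); rewrite rowKd.
    by congr (_ \in W _); rewrite /= add1n; lia.
  rewrite inE (@row_free_col1 k n); move: H'; rewrite !inE /= => /andP[/andP[-> cW] /andP[vW ->]] /=.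
  apply/forallP => /= a0; have /(_ a0) // : forall a : 'I_(1 + k), row a (col_mx v c') \in W (k - a)%N.
  move=> a; rewrite -(@splitK 1 k a); case: (fintype.split a) => b; rewrite /unsplit.
    by rewrite rowKu row_id /= ord1 subn0.
  rewrite rowKd; move/forallP: cW => /(_ b); congr (_ \in W _).
  by rewrite /= add1n; lia.
rewrite card_in_imset; last first.
  by move=> [v c] [v' c'] _ _ E; have [-> ->] := @eq_col_mx _ 1 k n v c v' c' E.
rewrite -sum1_card -[#|X k|]sum1_card big_distrl /=.
under eq_bigl do rewrite inE.
rewrite -(pair_big_dep xpredT (fun v c => (c \in X k) && ((v \in W k) && ~~ (v <= c)%MS)) (fun _ _ => 1%N)) /=.
rewrite (exchange_big_dep (mem (X k))) //=; last by move=> v c _ /andP[].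
apply: eq_bigr => c cX; rewrite mul1n -(H k c) //.
under eq_bigl do rewrite cX /=.
rewrite sum1_card -(cardsID [set v | (v <= c)%MS]%SET (W k)).
rewrite [X in (X + _ - _)%N](_ : _ = #|[set v in W k | (v <= c)%MS]%SET|); last first.
  by apply: eq_card => v; rewrite !inE.
by rewrite addKn; apply: eq_card => v; rewrite !inE andbC.
Qed.

End RowChains.

Section AutVolume.
Variables (F K : finFieldType) (iota : {rmorphism F -> K}).
Hypothesis QE : #|K| = (#|F| ^ 2)%N.
Local Notation base := (base_field iota).
Local Notation q := (#|F|).
Local Notation Q := (#|K|).

Lemma based_mx p n (c : 'M[K]_(p, n)) :
  (forall i j, c i j \in base) -> exists c0 : 'M[F]_(p, n), c = map_mx iota c0.
Proof.
move=> cB; have [f fE] := choice (fun ij : 'I_p * 'I_n => base_fieldP iota _ (cB ij.1 ij.2)).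
by exists (\matrix_(i, j) f (i, j)); apply/matrixP => i j; rewrite !mxE -fE.
Qed.

(** Among the possible constant terms of the [i]-th row of an automorphism, the
    fraction that depends on the [i] previous rows. For a positive part these
    constant terms form an [F]-space, and the previous rows have entries in [F];
    for a zero part they are all of [K^n]. *)
Definition dep_ratio (s : seq nat) n i : rat :=
  if (0 < nth 0%N s i)%N then (q ^ i)%:R / (q ^ conjpart s (nth 0%N s i))%:R
  else (Q ^ i)%:R / (Q ^ n)%:R.

Variables (n : nat) (s : seq nat).
Hypotheses (s_sorted : sorted geq s) (s_size : size s = n).
Local Notation si i := (nth 0%N s i).

Let s_anti i j : (i <= j)%N -> (j < n)%N -> (si j <= si i)%N.
Proof.
move=> ij jn; apply: (sorted_leq_nth (leT := geq)) => //.
- by move=> a b c /= ba ac; apply: leq_trans ac ba.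
- by move=> a /=.
- by rewrite inE s_size; apply: leq_ltn_trans ij jn.
by rewrite inE s_size.
Qed.

Let W i : {set 'rV[K]_n} :=
  [set v : 'rV[K]_n | `[< forall (a : 'I_1) (j : 'I_n), digit iota (si i - si j) (si i) (v a j) >]]%SET.

Let conjE x : conjpart s x = (\sum_(j < n) (x <= si j))%N.
Proof.
rewrite /conjpart -sum1_count [LHS]big_mkcond /= (big_nth 0%N) s_size big_mkord.
by apply: eq_bigr => j _; case: leq.
Qed.

Let cardW i : (i < n)%N ->
  #|W i| = (if (0 < si i)%N then q ^ conjpart s (si i) else Q ^ n)%N.
Proof.
move=> ilt; rewrite /W (card_mx_family (fun (_ : 'I_1) j => digit iota (si i - si (j : 'I_n)) (si i))).
rewrite big_ord1; case: ltnP => [s0|]; last first.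
  rewrite leqn0 => /eqP ->; rewrite -[in RHS](card_ord n) -prod_nat_const.
  by apply: eq_bigr => j _; apply: eq_card => c; rewrite !inE.
rewrite conjE expn_sum; apply: eq_bigr => j _; have [sij|sij] := leqP (si i) (si j).
  move: sij; rewrite -subn_eq0 => /eqP ->; rewrite expn1 -(card_base_field iota).
  by apply: eq_card => c; rewrite !inE s0.
rewrite expn0 (@fintype.eq_card1 _ (0 : K)) // => c; rewrite !inE subn_gt0 sij s0 /=.
by rewrite andb_idr // => /eqP ->; apply: (rpred0 base).
Qed.

Let Ndep i := (if (0 < si i)%N then q ^ i else Q ^ i)%N.

(* The span of the previous rows is contained in the space allowed for the next
   one, because the parts decrease. *)
Let dep_count i (c : 'M[K]_(i, n)) : (i < n)%N -> row_free c ->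
  (forall a : 'I_i, row a c \in W (i.-1 - a)%N) ->
  #|[set v in W i | (v <= c)%MS]%SET| = Ndep i.
Proof.
move=> ilt fc cW; rewrite /Ndep.
have cD (a : 'I_i) (j : 'I_n) : digit iota (si (i.-1 - a) - si j) (si (i.-1 - a)) (c a j).
  have := cW a; rewrite finset.in_set => /asboolP/(_ 0 j).
  by rewrite mxE.
case: ltnP => [s0|]; last first.
  rewrite leqn0 => /eqP s0; rewrite -[in RHS](mul1n i) -card_mx.
  rewrite -(card_imset _ (row_free_inj fc : injective (fun u : 'rV_i => u *m c))).
  apply: eq_card => v; rewrite !finset.in_set; apply/andP/imsetP => [[_ /submxP[u ->]]|[u _ ->]].
    by exists u.
  split; last exact: submxMl.
  by apply/asboolP => a j; rewrite s0 sub0n.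
have sa (a : 'I_i) : (si i <= si (i.-1 - a))%N.
  by apply: s_anti => //; have := ltn_ord a; lia.
have [c0 cE] : exists c0 : 'M[F]_(i, n), c = map_mx iota c0.
  apply: based_mx => a j; have /andP[_ /implyP] := cD a j; apply.
  exact: leq_trans s0 (sa a).
have fc0 : row_free c0 by move: fc; rewrite cE /row_free mxrank_map.
have injm : injective (fun u : 'rV[F]_i => map_mx iota (u *m c0)).
  by move=> u u' /map_mx_inj; apply: (row_free_inj fc0).
rewrite -[in RHS](mul1n i) -card_mx -(card_imset _ injm).
apply: eq_card => v; rewrite !finset.in_set; apply/andP/imsetP => [[/asboolP vD vc]|[u _ ->]].
  have [v0 vE] : exists v0 : 'M[F]_(1, n), v = map_mx iota v0.
    by apply: based_mx => a j; have /andP[_ /implyP] := vD a j; apply.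
  move: vc; rewrite vE cE map_submx => /submxP[u uE].
  by exists u; rewrite // uE.
split; last by rewrite cE map_submx submxMl.
apply/asboolP => a j; apply/andP; split; apply/implyP; last first.
  by move=> _; rewrite mxE; apply/base_fieldP; exists ((u *m c0) a j).
rewrite subn_gt0 => sji; rewrite map_mxM -cE mxE big1 // => b _.
have /andP[/implyP H _] := cD b j; rewrite (eqP (H _)) ?mulr0 // subn_gt0.
exact: leq_trans sji (sa b).
Qed.

Let dep_le i : (i < n)%N -> (Ndep i <= #|W i|)%N.
Proof.
move=> ilt; rewrite cardW // /Ndep.
case: ifP => s0; last by rewrite leq_exp2l ?(ltnW ilt) // finNzRing_gt1.
rewrite leq_exp2l ?finNzRing_gt1 // conjE -[X in (X <= _)%N]card_ord -sum1_card.
rewrite (big_ord_widen n (fun=> 1%N)) ?(ltnW ilt) // big_mkcond /=.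
by apply: leq_sum => j _; case: ltnP => // ji; rewrite s_anti // ltnW.
Qed.

(** Turned upside down, these matrices are the chains of rows of
    [card_row_chain]. *)
Lemma card_aut_layer0 :
  #|[set c : 'M[K]_n | `[< (forall i j : 'I_n, digit iota (si i - si j) (si i) (c i j))
      /\ c \in unitmx >]]%SET| = (\prod_(i < n) (#|W i| - Ndep i))%N.
Proof.
rewrite -(@card_row_chain K n W Ndep n); last first.
  by move=> i c ilt; rewrite finset.in_set => /andP[fc /forallP cW]; apply: dep_count.
pose rv := perm (@rev_ord_inj n).
have rvK i : rv (rv i) = i by rewrite !permE rev_ordK.
rewrite -[RHS](card_imset _ (can_inj (g := row_perm rv) (f := row_perm rv) _)); last first.
  by move=> c; apply/matrixP => i j; rewrite !mxE rvK.
apply: eq_card => c; rewrite finset.in_set; apply/asboolP/imsetP.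
  move=> [cD cU]; exists (row_perm rv c).
    rewrite finset.in_set row_free_unit; apply/andP; split.
      by rewrite row_permE unitmx_mul unitmx_perm cU.
    apply/forallP => a; rewrite finset.in_set; apply/asboolP => a' j.
    rewrite !mxE.
    have -> : (n.-1 - a)%N = rv a by rewrite permE /=; have := ltn_ord a; lia.
    exact: (cD (rv a) j).
  by apply/matrixP => i j; rewrite !mxE rvK.
move=> [c']; rewrite finset.in_set row_free_unit => /andP[cU /forallP cW] ->.
split; last by rewrite row_permE unitmx_mul unitmx_perm.
move=> i j; have := cW (rv i); rewrite finset.in_set => /asboolP/(_ 0 j).
rewrite !mxE; have -> // : (n.-1 - rv i)%N = i.
by rewrite permE /=; have := ltn_ord i; lia.
Qed.

(** Invertibility depends on the constant term only, so the volume is that of a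
    box times the proportion of invertible constant terms. *)
Lemma vol_aut : vol (aut iota (@typ s n)) =
  (\prod_(i < n) \prod_(j < n) q ^ (si i - si j + si i))%N%:R^-1
    * \prod_(i < n) (1 - dep_ratio s n i).
Proof.
pose u (i j : 'I_n) := (si i - si j)%N; pose w (i j : 'I_n) := si i.
have uw i j : (u i j <= w i j)%N by apply: leq_subr.
rewrite -(vol_box iota QE uw).
have [_ ->] := vol_layers (box_stable iota _ _) (@box_layers _ _ iota _ _ u w).
pose A (c : 'M[K]_n) := (forall i j, digit iota (u i j) (w i j) (c i j)) /\ c \in unitmx.
have [|_ ->] := @vol_layers _ _ _ A (aut iota (@typ s n)) _ (box_stable iota (fun i j => (u i j).-1) (fun i j => (w i j).-1)).
  move=> c x; rewrite /A; have L0 : layer 0 (mxC c + mxT x) = c.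
    by rewrite layerD layer0_mxT addr0 layer_mxC eqxx.
  have := box_layers iota u w c x; rewrite /box => E; split.
    by move=> [/E[cD xB]]; rewrite unitmx_layer0 L0.
  by move=> [[cD cU] xB]; split; [apply/E|rewrite unitmx_layer0 L0].
rewrite [in LHS]card_aut_layer0 [in RHS](card_mx_family (fun i j => digit iota (u i j) (w i j))).
rewrite [RHS]mulrAC; congr (_ * _); rewrite [RHS]mulrAC; congr (_ * _).
have WE (i : 'I_n) : (\prod_j #|digit iota (u i j) (w i j)|)%N = #|W i|.
  by rewrite /W (card_mx_family (fun (_ : 'I_1) j => digit iota (si i - si (j : 'I_n)) (si i))) big_ord1.
rewrite [X in _ = X%:R * _](eq_bigr (fun i : 'I_n => #|W i|)) //.
rewrite !natr_prod -big_split /=.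
apply: eq_bigr => i _; rewrite natrB ?dep_le // mulrBr mulr1; congr (_ - _).
have q1 := finNzRing_gt1 F; have Q1 := finNzRing_gt1 K.
rewrite cardW // /dep_ratio /Ndep; case: ifP => _.
  by rewrite mulrC divfK // pnatr_eq0 -lt0n expn_gt0 ltnW.
by rewrite mulrC divfK // Q_neq0.
Qed.

End AutVolume.

(** * Partitions in a box and Hall polynomials *)

Section Boxes.

Lemma big_nat_idx (R : Type) (idx : R) (op : Monoid.law idx) a b (G : nat -> R) :
  (forall i, (a <= i < b)%N -> G i = idx) -> \big[op/idx]_(a <= i < b) G i = idx.
Proof. by move=> H; rewrite big_nat_cond big1 // => i /andP[/H]. Qed.

Lemma conjpart_nseq a k i : conjpart (nseq a k) i = if (i <= k)%N then a else 0%N.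
Proof. by rewrite /conjpart count_nseq; case: leq; rewrite ?mul1n ?mul0n. Qed.

Lemma conjpart_cat s1 s2 i : conjpart (s1 ++ s2) i = (conjpart s1 i + conjpart s2 i)%N.
Proof. exact: count_cat. Qed.

Lemma conjpart_box0 m n s i : s \in box_partitions m n -> (m < i)%N -> conjpart s i = 0%N.
Proof.
rewrite mem_box_partitions => /and3P[_ _ /allP sm] mi.
apply/eqP; rewrite -leqn0 leqNgt -has_count; apply/negP => /hasP[j /sm jm ij].
by move: (leq_trans ij jm); rewrite leqNgt mi.
Qed.

Lemma conjpart_le s i : (conjpart s i <= size s)%N.
Proof. exact: count_size. Qed.

Lemma conjpart_anti s i j : (i <= j)%N -> (conjpart s j <= conjpart s i)%N.
Proof. by move=> ij; apply: sub_count => k /=; apply: leq_trans. Qed.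

Lemma box_size m n s : s \in box_partitions m n -> size s = n.
Proof. by rewrite mem_box_partitions => /and3P[_ /eqP]. Qed.

Lemma box_head m n s : s \in box_partitions m n -> (head 0%N s <= m)%N.
Proof.
rewrite mem_box_partitions => /and3P[_ _ /allP sm].
by case: s sm => //= a s sm; apply: sm; rewrite inE eqxx.
Qed.

Lemma conjpart_head0 m n s i :
  s \in box_partitions m n -> (head 0%N s < i)%N -> conjpart s i = 0%N.
Proof.
rewrite mem_box_partitions => /and3P[ss _ _] hi.
apply/eqP; rewrite -leqn0 leqNgt -has_count; apply/hasP => -[j js ij].
case: s ss hi js => //= a s; rewrite path_sortedE; last first.
  by move=> k j' l /= h h'; apply: leq_trans h' h.
move=> /andP[/allP sa _] ai; rewrite inE => /orP[/eqP ja|/sa /= ja].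
  by move: ij; rewrite ja leqNgt ai.
by move: (leq_trans ij ja); rewrite leqNgt ai.
Qed.

Lemma sumn_conjpart m n s : s \in box_partitions m n ->
  sumn s = (\sum_(1 <= i < m.+1) conjpart s i)%N.
Proof.
rewrite mem_box_partitions => /and3P[_ _ sm].
elim: s sm => [_|a s IHs /= /andP[am /IHs ->]]; first by rewrite big1_seq.
rewrite big_split /=; congr (_ + _)%N.
rewrite (@big_cat_nat _ _ _ a.+1) //= [X in (_ + X)%N]big_nat_idx; last first.
  by move=> i /andP[ai _]; rewrite leqNgt ai.
rewrite addn0 big_nat_cond (eq_bigr (fun=> 1%N)); last first.
  by move=> i /andP[/andP[_ ia] _]; rewrite -ltnS ia.
by rewrite -big_nat_cond sum_nat_const_nat muln1 subn1.
Qed.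

Lemma box_partitions0 n : box_partitions 0 n = [:: nseq n 0%N].
Proof.
apply: perm_small_eq => //; apply: uniq_perm => //; first exact: uniq_box_partitions.
move=> s; rewrite mem_box_partitions inE; apply/and3P/eqP => [[_ /eqP sn /allP s0]|->].
  apply: (@eq_from_nth _ 0%N) => [|i]; rewrite ?size_nseq // => ilt.
  by rewrite nth_nseq if_same; apply/eqP; rewrite -leqn0; apply: s0; rewrite mem_nth.
rewrite size_nseq eqxx; split=> //; last by apply/allP => i /nseqP[->].
by elim: n => //= -[|n].
Qed.

Lemma sorted_geq_nseq a k s :
  sorted geq s -> all (leq^~ k) s -> sorted geq (nseq a k ++ s).
Proof.
move=> ss sk; elim: a => // a IHa; rewrite /= path_sortedE; last first.
  by move=> i j l /= ij li; apply: leq_trans li ij.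
rewrite IHa andbT all_cat sk andbT.
by apply/allP => i /nseqP[->] /=.
Qed.

Lemma mem_box_cat m n a s : (a <= n)%N -> s \in box_partitions m (n - a) ->
  nseq a m.+1 ++ s \in box_partitions m.+1 n.
Proof.
move=> an; rewrite !mem_box_partitions => /and3P[ss /eqP sz sm].
have sm' : all (leq^~ m.+1) s by apply: sub_all sm => i /= /leqW.
rewrite sorted_geq_nseq // size_cat size_nseq sz subnKC // eqxx all_cat sm' andbT.
by apply/allP => i /nseqP[->].
Qed.

Lemma box_catP m n s : s \in box_partitions m.+1 n ->
  exists a s', [/\ (a <= n)%N, s' \in box_partitions m (n - a) & s = nseq a m.+1 ++ s'].
Proof.
rewrite mem_box_partitions => /and3P[ss /eqP sz sm].
elim: s n ss sz sm => [|i s IHs] n ss sz /=.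
  by exists 0%N, [::]; split=> //; rewrite -sz mem_box_partitions.
move=> /andP[im sm]; case: n sz => //= n [sz].
have ss' : sorted geq s by apply: path_sorted ss.
have [->|im'] := eqVneq i m.+1.
  have [a [s' [an s'b ->]]] := IHs n ss' sz sm.
  by exists a.+1, s'; rewrite subSS; split.
exists 0%N, (i :: s); split=> //; rewrite subn0 mem_box_partitions ss /= sz eqxx /=.
have {}im : (i <= m)%N by rewrite -ltnS ltn_neqAle im' im.
rewrite im; apply/allP => j js; apply: leq_trans im.
have := ss; rewrite /= path_sortedE; last by move=> x y z /= xy zx; apply: leq_trans zx xy.
by case/andP => /allP/(_ j js).
Qed.

Lemma box_cat_count m n a s : s \in box_partitions m n ->
  count_mem m.+1 (nseq a m.+1 ++ s) = a.
Proof.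
rewrite mem_box_partitions => /and3P[_ _ /allP sm].
rewrite count_cat count_nseq /= eqxx mul1n -[RHS]addn0; congr (_ + _)%N.
by apply/eqP; rewrite -leqn0 leqNgt -has_count; apply/hasP => -[j /sm jm /eqP jE]; rewrite jE ltnn in jm.
Qed.

(** The tool for inductions on the largest part: [a] is the multiplicity of the
    part [m.+1]. *)
Lemma big_box m n (V : nmodType) (G : seq nat -> V) :
  \sum_(s <- box_partitions m.+1 n) G s =
  \sum_(a < n.+1) \sum_(s <- box_partitions m (n - a)) G (nseq a m.+1 ++ s).
Proof.
transitivity (\sum_(a < n.+1) \sum_(s <- box_partitions m.+1 n | count_mem m.+1 s == a) G s).
  rewrite (exchange_big_dep xpredT) //= big_seq [RHS]big_seq; apply: eq_bigr => s sb.
  have cl : (count_mem m.+1 s < n.+1)%N by rewrite ltnS -(box_size sb) count_size.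
  rewrite (big_pred1 (Ordinal cl)) //.
apply: eq_bigr => a _; rewrite -big_filter -(big_map (fun s => nseq a m.+1 ++ s) xpredT G).
apply: perm_big; apply: uniq_perm.
- by apply: filter_uniq; apply: uniq_box_partitions.
- rewrite map_inj_uniq ?uniq_box_partitions // => s s' /eqP.
  by rewrite eqseq_cat // => /andP[_ /eqP].
have an : (a <= n)%N by rewrite -ltnS.
move=> s; rewrite mem_filter; apply/andP/mapP => [[/eqP sa sb]|[s' s'b ->]].
  have [b [s' [bn s'b sE]]] := box_catP sb; exists s'.
    by move: sa; rewrite sE (box_cat_count _ s'b) => <-.
  by move: sa; rewrite sE (box_cat_count _ s'b) => ->.
by rewrite (box_cat_count _ s'b) eqxx mem_box_cat.
Qed.

End Boxes.

Section HallPolynomials.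
Variable x : rat.
Hypothesis x_gt1 : 1 < x.
Local Notation y := (x^-1).

Let x0 : x != 0. Proof. by rewrite gt_eqF // (lt_trans ltr01). Qed.

Lemma qpoch0 (A b : rat) : qpoch A b 0 = 1. Proof. by rewrite /qpoch big_ord0. Qed.

Lemma qpochS (b : rat) k : qpoch b b k.+1 = qpoch b b k * (1 - b ^+ k.+1).
Proof. by rewrite /qpoch big_ord_recr /= -exprS. Qed.

Lemma qpoch_neq0 k : qpoch y y k != 0.
Proof.
elim: k => [|k IHk]; first by rewrite qpoch0 oner_neq0.
rewrite qpochS mulf_neq0 // subr_eq0 eq_sym exprVn lt_eqF //.
by rewrite invf_lt1 ?exprn_gt0 ?(lt_trans ltr01) // exprn_egt1.
Qed.

Lemma qbinomE (a b : nat) : (b <= a)%N ->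
  qbinom y a%:Z b%:Z = qpoch y y a / (qpoch y y b * qpoch y y (a - b)).
Proof.
move=> ba; rewrite /qbinom /= lez_nat ba /=.
by rewrite subzn // absz_nat.
Qed.

Lemma qbinom_sub (a b c : nat) : (c <= b)%N -> (b <= a)%N ->
  qbinom y (a%:Z - c%:Z) (a%:Z - b%:Z) =
  qpoch y y (a - c) / (qpoch y y (a - b) * qpoch y y (b - c)).
Proof.
move=> cb ba; rewrite !subzn ?(leq_trans cb) // qbinomE ?leq_sub2l //.
by congr (_ / (_ * qpoch _ _ _)); lia.
Qed.

Lemma qbinom_neg N M : (M < 0)%R -> qbinom y N M = 0.
Proof. by rewrite /qbinom ltNge => /negbTE ->. Qed.

Section InBox.
Variables m n : nat.

Lemma hallgE s mu : s \in box_partitions m n -> mu \in box_partitions m n ->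
  hallg s mu x =
  x ^ (\sum_(1 <= i < m.+1) (conjpart mu i)%:Z * ((conjpart s i)%:Z - (conjpart mu i)%:Z)) *
  \prod_(1 <= i < m.+1)
    qbinom y ((conjpart s i)%:Z - (conjpart mu i.+1)%:Z) ((conjpart s i)%:Z - (conjpart mu i)%:Z).
Proof.
move=> sb mub; rewrite /hallg.
set b := (maxn _ _).+1; have bm : (b <= m.+1)%N by rewrite ltnS geq_max !(box_head sb, box_head mub).
have Z i : (b <= i)%N -> conjpart s i = 0%N /\ conjpart mu i = 0%N.
  rewrite /b => bi; split; [apply: (conjpart_head0 sb)|apply: (conjpart_head0 mub)]; apply: leq_trans bi.
    by rewrite ltnS leq_maxl.
  by rewrite ltnS leq_maxr.
congr (x ^ _ * _).
  rewrite [RHS](@big_cat_nat _ _ _ b) //= [X in _ = _ + X]big_nat_idx ?addr0 //.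
  by move=> i /andP[/Z[-> ->] _]; rewrite mul0r.
rewrite [RHS](@big_cat_nat _ _ _ b) //= [X in _ = _ * X]big_nat_idx ?mulr1 //.
move=> i /andP[bi _]; have [-> ->] := Z i bi; have [_ ->] := Z i.+1 (leqW bi).
by rewrite subrr (qbinomE (leqnn 0)) subnn !qpoch0; field.
Qed.

Lemma aut_polyE s : s \in box_partitions m n ->
  aut_poly s x = x ^+ (\sum_(1 <= i < m.+1) conjpart s i ^ 2)%N *
  \prod_(1 <= i < m.+1) qpoch y y (conjpart s i - conjpart s i.+1)%N.
Proof.
move=> sb; rewrite /aut_poly; set b := (head 0%N s).+1.
have bm : (b <= m.+1)%N by rewrite ltnS (box_head sb).
have Z i : (b <= i)%N -> conjpart s i = 0%N by apply: conjpart_head0 sb.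
congr (_ ^+ _ * _).
  rewrite [RHS](@big_cat_nat _ _ _ b) //= [X in _ = (_ + X)%N]big_nat_idx ?addn0 //.
  by move=> i /andP[/Z -> _].
rewrite [RHS](@big_cat_nat _ _ _ b) //= [X in _ = _ * X]big_nat_idx ?mulr1 //.
by move=> i /andP[/Z -> _]; rewrite sub0n qpoch0.
Qed.

Lemma aut_poly_neq0 s : s \in box_partitions m n -> aut_poly s x != 0.
Proof.
move=> sb; rewrite aut_polyE // mulf_neq0 ?expf_neq0 //.
by rewrite prodf_seq_neq0; apply/allP => i _; apply: qpoch_neq0.
Qed.

(** If [x] is the order of the residue field of [V], both sides count the
    injections of a module of type [mu] into [(V/pi^m)^n]: on the left by their
    images. The product of binomials telescopes. *)
Lemma hall_aut_poly mu : mu \in box_partitions m n ->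
  hallg (nseq n m) mu x * aut_poly mu x =
  x ^+ (n * sumn mu) * (qpoch y y n / qpoch y y (n - conjpart mu 1)).
Proof.
move=> mub; have nb : nseq n m \in box_partitions m n.
  rewrite mem_box_partitions size_nseq eqxx all_nseq leqnn orbT andbT.
  by have := @sorted_geq_nseq n m [::] isT isT; rewrite cats0 => ->.
have un i : (conjpart mu i <= n)%N by rewrite -(box_size mub) conjpart_le.
rewrite hallgE // aut_polyE // mulrACA; congr (_ * _).
  rewrite !exprnP -expfzDr //; congr (x ^ _).
  rewrite (sumn_conjpart mub) big_distrr /= -!natz !natr_sum -big_split /=.
  rewrite [LHS]big_nat_cond [RHS]big_nat_cond; apply: eq_bigr => i /andP[/andP[_ im] _].
  rewrite conjpart_nseq; move: im; rewrite ltnS => ->.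
  by rewrite !natz; have := un i; nia.
rewrite -big_split /= big_nat_cond.
pose h i : rat := qpoch y y (n - conjpart mu i).
rewrite (eq_bigr (fun i => h i.+1 / h i)) => [|i /andP[/andP[_ im] _]]; last first.
  rewrite conjpart_nseq; move: im; rewrite ltnS => ->.
  rewrite qbinom_sub ?un ?conjpart_anti // /h.
  by field; rewrite !qpoch_neq0.
rewrite -big_nat_cond; have hm : h m.+1 = qpoch y y n.
  by rewrite /h (conjpart_box0 mub) ?subn0.
have [m0|m0] := posnP m; last first.
  by rewrite telescope_prodf ?hm // => i _; apply: qpoch_neq0.
by rewrite -hm m0 big_geq // divff // qpoch_neq0.
Qed.

(** If the Hall polynomial is not 0, then [mu] is contained in [s]; otherwise one
    of the binomials has a negative lower index. *)
Lemma hallg_sub s mu : s \in box_partitions m n -> mu \in box_partitions m n ->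
  hallg s mu x != 0 -> (sumn mu <= sumn s)%N.
Proof.
move=> sb mub; rewrite hallgE // mulf_eq0 negb_or => /andP[_ nz].
rewrite (sumn_conjpart sb) (sumn_conjpart mub).
rewrite big_nat_cond [X in (_ <= X)%N]big_nat_cond.
apply: leq_sum => i /andP[im _]; rewrite leqNgt; apply: contra nz => lt.
rewrite (bigD1_seq i) ?mem_index_iota ?iota_uniq //= qbinom_neg ?mul0r //.
by rewrite subr_lt0 ltz_nat.
Qed.

End InBox.

End HallPolynomials.

(** * The volume of the automorphism groups in terms of the conjugate partition *)

Section AutClosedForm.
Variables (F K : finFieldType) (iota : {rmorphism F -> K}).
Hypothesis QE : #|K| = (#|F| ^ 2)%N.
Local Notation q := (#|F|).
Local Notation Q := (#|K|).
Local Notation x := (q%:R : rat).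
Local Notation y := (x^-1).
Local Notation Y := ((Q%:R : rat)^-1).

(** The rows with a given part [i] contribute one Pochhammer symbol. *)
Lemma prod_dep_ratio m n s : s \in box_partitions m n ->
  \prod_(i < n) (1 - dep_ratio F K s n i) =
  \prod_(1 <= i < m.+1) qpoch y y (conjpart s i - conjpart s i.+1) * qpoch Y Y (n - conjpart s 1).
Proof.
have q0 k : (q ^ k)%:R != 0 :> rat by rewrite pnatr_eq0 -lt0n expn_gt0 ltnW ?finNzRing_gt1.
have Q0 k : (Q ^ k)%:R != 0 :> rat by rewrite pnatr_eq0 -lt0n expn_gt0 ltnW ?finNzRing_gt1.
have qpochE (b : nat) k : (forall j, (b ^ j)%:R != 0 :> rat) ->
    qpoch (b%:R^-1 : rat) b%:R^-1 k = \prod_(i < k) (1 - (b ^ i)%:R / (b ^ k)%:R).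
  move=> b0; rewrite /qpoch (reindex_inj rev_ord_inj) /=; apply: eq_bigr => i _.
  rewrite -exprS -subSn // subSS exprVn -natrX; congr (_ - _).
  rewrite -[X in _ / (b ^ X)%:R](subnK (ltnW (ltn_ord i))) expnD natrM.
  by field; rewrite !b0.
elim: m n s => [|m IHm] n s.
  rewrite box_partitions0 inE => /eqP ->; rewrite big_geq // mul1r conjpart_nseq subn0.
  rewrite qpochE //; apply: eq_bigr => i _.
  by rewrite /dep_ratio nth_nseq if_same.
move=> /box_catP[a [s' [an sb ->]]].
have sz := box_size sb; pose f i := 1 - dep_ratio F K (nseq a m.+1 ++ s') n i.
have -> : \prod_(i < n) f i = \prod_(i < a + (n - a)) f i by rewrite subnKC.
rewrite big_split_ord /= /f.
rewrite (eq_bigr (fun i : 'I_a => 1 - (q ^ i)%:R / (q ^ a)%:R)); last first.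
  move=> i _; rewrite /dep_ratio nth_cat size_nseq ltn_ord nth_nseq ltn_ord.
  by rewrite conjpart_cat conjpart_nseq leqnn (conjpart_box0 sb) ?addn0.
rewrite -qpochE // (eq_bigr (fun i : 'I_(n - a) => 1 - dep_ratio F K s' (n - a) i)); last first.
  move=> i _; have N : nth 0%N (nseq a m.+1 ++ s') (a + i) = nth 0%N s' i.
    by rewrite nth_cat size_nseq ltnNge leq_addr /= addKn.
  rewrite /dep_ratio N; congr (_ - _); case: ifP => s0.
    have s'm : (nth 0%N s' i <= m.+1)%N.
      move: sb; rewrite mem_box_partitions => /and3P[_ _ /allP H].
      by apply: leqW; apply: H; rewrite mem_nth // sz.
    rewrite conjpart_cat conjpart_nseq s'm !expnD !natrM.
    by field; rewrite !q0.
  have -> : (Q ^ n = Q ^ a * Q ^ (n - a))%N by rewrite -expnD subnKC.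
  by rewrite expnD !natrM; field; rewrite !Q0.
rewrite (IHm _ _ sb) [\prod_(1 <= i < m.+2) _]big_nat_recr //= !conjpart_cat !conjpart_nseq leqnn ltnn.
have c1 : conjpart s' m.+1 = 0%N by exact: (conjpart_box0 sb).
have c2 : conjpart s' m.+2 = 0%N by exact: (conjpart_box0 sb).
rewrite c1 c2 /= !addn0 subn0 subnDA mulrA; congr (_ * _).
rewrite mulrC; congr (_ * _).
apply: eq_big_nat => i /andP[_ im].
by rewrite !conjpart_cat !conjpart_nseq im (ltnW im) subnDl.
Qed.

(** Up to the term [2 s_i], the summand is [- min(s_i, s_j)], and the minimum of
    two parts is the number of columns that meet both rows. *)
Lemma sum_min_conjpart m n s : s \in box_partitions m n ->
  (\sum_(i < n) \sum_(j < n) (nth 0 s i - nth 0 s j + nth 0 s i) +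
   \sum_(1 <= i < m.+1) conjpart s i ^ 2 = 2 * (n * sumn s))%N.
Proof.
move=> sb; have sz := box_size sb.
have sE : sumn s = (\sum_(i < n) nth 0 s i)%N by rewrite sumnE (big_nth 0%N) sz big_mkord.
have cE k : conjpart s k = (\sum_(i < n) (k <= nth 0 s i))%N.
  rewrite /conjpart -sum1_count [LHS]big_mkcond /= (big_nth 0%N) sz big_mkord.
  by apply: eq_bigr => i _; case: leq.
have minE i j : (nth 0 s i <= m)%N ->
    minn (nth 0 s i) (nth 0 s j) = (\sum_(1 <= k < m.+1) (k <= nth 0 s i) * (k <= nth 0 s j))%N.
  move=> im; set a := minn _ _.
  have am : (a <= m)%N by apply: leq_trans im; apply: geq_minl.
  rewrite (@big_cat_nat _ _ _ a.+1) //= [X in (_ + X)%N]big_nat_idx ?addn0; last first.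
    move=> k /andP[ak _]; have := ak; rewrite /a gtn_min => /orP[] h.
      by rewrite [(k <= nth 0 s i)%N]leqNgt h.
    by rewrite [(k <= nth 0 s j)%N]leqNgt h muln0.
  rewrite (@eq_big_nat _ _ _ _ _ _ (fun=> 1%N)) ?sum_nat_const_nat ?muln1 ?subn1 // => k /andP[_].
  by rewrite ltnS leq_min => /andP[-> ->].
have -> : (\sum_(1 <= k < m.+1) conjpart s k ^ 2 =
    \sum_(i < n) \sum_(j < n) minn (nth 0 s i) (nth 0 s j))%N.
  rewrite (eq_bigr (fun k => \sum_(i < n) \sum_(j < n) (k <= nth 0 s i) * (k <= nth 0 s j)))%N.
    rewrite exchange_big; apply: eq_bigr => i _; rewrite exchange_big; apply: eq_bigr => j _.
    rewrite minE //; move: sb; rewrite mem_box_partitions => /and3P[_ _ /allP]; apply.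
    by rewrite mem_nth // sz.
  by move=> k _; rewrite -mulnn cE big_distrlr.
rewrite -big_split /= sE big_distrr big_distrr /=; apply: eq_bigr => i _.
rewrite -big_split /= (eq_bigr (fun=> 2 * nth 0 s i)%N).
  by rewrite sum_nat_const card_ord; lia.
by move=> j _; rewrite /minn; case: ifP; lia.
Qed.

Lemma vol_aut_closed m n s : s \in box_partitions m n ->
  vol (aut iota (@typ s n)) =
  aut_poly s x * qpoch Y Y (n - conjpart s 1) / x ^+ (2 * (n * sumn s)).
Proof.
move=> sb; have := sb; rewrite mem_box_partitions => /and3P[ss /eqP sz _].
rewrite (vol_aut iota QE ss sz) (prod_dep_ratio sb) (aut_polyE _ sb).
have q0 k : x ^+ k != 0 by rewrite expf_neq0 // pnatr_eq0 -lt0n ltnW ?finNzRing_gt1.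
rewrite -(sum_min_conjpart sb) exprD.
have -> : (\prod_(i < n) \prod_(j < n) q ^ (nth 0 s i - nth 0 s j + nth 0 s i))%N%:R =
    x ^+ (\sum_(i < n) \sum_(j < n) (nth 0 s i - nth 0 s j + nth 0 s i))%N.
  by rewrite -natrX expn_sum; congr (_%:R); apply: eq_bigr => i _; rewrite expn_sum.
move: (q0 (\sum_(i < n) \sum_(j < n) (nth 0 s i - nth 0 s j + nth 0 s i))%N).
move: (q0 (\sum_(1 <= i < m.+1) conjpart s i ^ 2)%N).
by move: (x ^+ _) (x ^+ _) (\prod_(1 <= i < _) _) (qpoch Y Y _) => u v P R u0 v0; field; rewrite u0.
Qed.

End AutClosedForm.

(** * Solution of the recursion by peeling off layers *)

Section Layers.
Variable x : rat.
Hypothesis x_gt1 : 1 < x.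
Local Notation y := (x^-1).
Local Notation C := (@fpsC rat).

Let x0 : x != 0. Proof. by rewrite gt_eqF // (lt_trans ltr01). Qed.

Lemma mem_box_cat_max m k a s : s \in box_partitions m k ->
  nseq a m ++ s \in box_partitions m (a + k).
Proof.
rewrite !mem_box_partitions => /and3P[ss /eqP sz sm].
rewrite sorted_geq_nseq // size_cat size_nseq sz eqxx all_cat sm andbT /=.
by apply/allP => i /nseqP[->].
Qed.

(** If [a <= n], this is the probability that a random matrix with [a] rows and
    [n] columns over a field with [x] elements has rank [r]. *)
Definition rank_prob a n r : rat :=
  if (r <= a)%N then
    y ^+ ((a - r) * (n - r)) * (qpoch y y a / (qpoch y y r * qpoch y y (a - r)))
      * (qpoch y y n / qpoch y y (n - r))
  else 0.

Lemma rank_prob00 n : rank_prob 0 n 0 = 1.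
Proof.
rewrite /rank_prob leqnn !subn0 qpoch0 mul0n expr0.
by have := qpoch_neq0 x_gt1 n; move: (qpoch y y n) => P P0; field.
Qed.

Lemma rank_prob_gt a n r : (a < r)%N -> rank_prob a n r = 0.
Proof. by rewrite /rank_prob ltnNge => /negbTE ->. Qed.

Lemma rank_prob0 a n : rank_prob a.+1 n 0 = y ^+ n * rank_prob a n 0.
Proof.
rewrite /rank_prob !leq0n !subn0 qpoch0 mulSn exprD.
have := qpoch_neq0 x_gt1; move: (qpoch y y) => P P0.
by move: (y ^+ n) (y ^+ (a * n)) => u v; field; rewrite !P0.
Qed.

(** The first row of a random matrix is 0 with probability [y^(n+1)]; otherwise
    column operations clear it and leave a random matrix with [a] rows and [n]
    columns. *)
Lemma rank_probS a n r : (a <= n)%N -> (r <= a)%N ->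
  rank_prob a.+1 n.+1 r.+1 =
  (1 - y ^+ n.+1) * rank_prob a n r + y ^+ n.+1 * rank_prob a n.+1 r.+1.
Proof.
move=> an ra; rewrite /rank_prob ltnS ra !subSS.
have [ra'|ar] := ltnP r a; last first.
  have -> : r = a by apply/eqP; rewrite eqn_leq ra.
  rewrite mulr0 addr0 subnn mul0n expr0 qpoch0 !qpochS.
  have := qpoch_neq0 x_gt1 a.+1; rewrite qpochS mulf_eq0 negb_or => /andP[? ?].
  by field; rewrite ?qpoch_neq0.
have [k aE] : exists k, a = (r + k.+1)%N by exists (a - r.+1)%N; lia.
have rn : (r <= n)%N by apply: leq_trans an.
rewrite aE {a aE an ra ra'}.
have -> : (r + k.+1 - r = k.+1)%N by lia.
have -> : (r + k.+1 - r.+1 = k)%N by lia.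
set N := (n - r)%N; have -> : n = (r + N)%N by rewrite /N; lia.
rewrite !qpochS.
have H1 := qpoch_neq0 x_gt1 r.+1; rewrite qpochS mulf_eq0 negb_or in H1.
have H2 := qpoch_neq0 x_gt1 k.+1; rewrite qpochS mulf_eq0 negb_or in H2.
case/andP: H1 => H1 H1'; case/andP: H2 => H2 H2'.
have -> : y ^+ (k.+1 * N) = y ^+ (k * N) * y ^+ N by rewrite mulSnr exprD.
have -> : y ^+ (r + k.+1).+1 = y ^+ r.+1 * y ^+ k.+1 by rewrite -exprD addSn.
have -> : y ^+ (r + N).+1 = y ^+ r.+1 * y ^+ N by rewrite -exprD addSn.
have HN := qpoch_neq0 x_gt1 N; move: H1 H1' H2 H2' HN.
move: (y ^+ r.+1) (y ^+ k.+1) (y ^+ N) (y ^+ (k * N)) => Y1 Y2 Y3 Y4.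
move: (qpoch y y r) (qpoch y y k) (qpoch y y N) (qpoch y y (r + N)) (qpoch y y (r + k.+1)).
by move=> P1 P2 P3 P4 P5 ? ? ? ? ?; field; apply/and5P; split.
Qed.

(** The product over all layers of the probabilities [rank_prob]; see
    [layer_coef_cat]. *)
Definition layer_coef n s mu : rat :=
  x ^ (- (n%:Z * ((sumn s)%:Z - (sumn mu)%:Z)))
    * (qpoch y y n / qpoch y y (n - conjpart mu 1)) * hallg s mu x.

Lemma sumn_cat_nseq a k s : sumn (nseq a k ++ s) = (a * k + sumn s)%N.
Proof. by rewrite sumn_cat sumn_nseq mulnC. Qed.

Lemma hallg_cat m n a r s mu : (a <= n)%N -> (r <= n)%N ->
  s \in box_partitions m (n - a) -> mu \in box_partitions m (n - r) ->
  hallg (nseq a m.+1 ++ s) (nseq r m.+1 ++ mu) x =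
  if (r <= a)%N then
    x ^ (r%:Z * (a%:Z - r%:Z + (sumn (nseq (a - r) m ++ s))%:Z - (sumn mu)%:Z))
      * (qpoch y y a / (qpoch y y r * qpoch y y (a - r)))
      * hallg (nseq (a - r) m ++ s) mu x
  else 0.
Proof.
move=> an rn sb mub.
have sb1 := mem_box_cat an sb; have mub1 := mem_box_cat rn mub.
have su i : (i <= m)%N -> conjpart (nseq r m.+1 ++ mu) i = (r + conjpart mu i)%N.
  by move=> im; rewrite conjpart_cat conjpart_nseq (leqW im).
have suS : conjpart (nseq r m.+1 ++ mu) m.+1 = r.
  by rewrite conjpart_cat conjpart_nseq leqnn (conjpart_box0 mub) ?addn0.
have sl i : (i <= m)%N -> conjpart (nseq a m.+1 ++ s) i = (a + conjpart s i)%N.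
  by move=> im; rewrite conjpart_cat conjpart_nseq (leqW im).
have slS : conjpart (nseq a m.+1 ++ s) m.+1 = a.
  by rewrite conjpart_cat conjpart_nseq leqnn (conjpart_box0 sb) ?addn0.
rewrite (hallgE x sb1 mub1) [\sum_(1 <= i < m.+2) _]big_nat_recr //=.
rewrite [\prod_(1 <= i < m.+2) _]big_nat_recr //= slS suS (conjpart_box0 mub1) // subr0.
case: leqP => [ra|ar]; last first.
  by rewrite [X in _ * (_ * X)]qbinom_neg ?mulr0 // subr_lt0 ltz_nat.
have sb2 : nseq (a - r) m ++ s \in box_partitions m (n - r).
  by have := mem_box_cat_max (a - r) sb; congr (_ \in box_partitions _ _); lia.
rewrite (hallgE x sb2 mub) subzn // qbinomE ?leq_subr // subKn //.
have sl2 i : (i <= m)%N -> conjpart (nseq (a - r) m ++ s) i = (a - r + conjpart s i)%N.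
  by move=> im; rewrite conjpart_cat conjpart_nseq im.
have expE : (\sum_(1 <= i < m.+1) (conjpart (nseq r m.+1 ++ mu) i)%:Z *
     ((conjpart (nseq a m.+1 ++ s) i)%:Z - (conjpart (nseq r m.+1 ++ mu) i)%:Z)
     + r%:Z * (a - r)%N%:Z =
   r%:Z * ((a - r)%N%:Z + (sumn (nseq (a - r) m ++ s))%:Z - (sumn mu)%:Z) +
   \sum_(1 <= i < m.+1) (conjpart mu i)%:Z *
     ((conjpart (nseq (a - r) m ++ s) i)%:Z - (conjpart mu i)%:Z))%R.
  have -> : (sumn (nseq (a - r) m ++ s))%:Z = \sum_(1 <= i < m.+1) (conjpart (nseq (a - r) m ++ s) i)%:Z.
    by rewrite (sumn_conjpart sb2) -natz natr_sum; apply: eq_bigr => i _; rewrite natz.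
  have -> : (sumn mu)%:Z = \sum_(1 <= i < m.+1) (conjpart mu i)%:Z.
    by rewrite (sumn_conjpart mub) -natz natr_sum; apply: eq_bigr => i _; rewrite natz.
  rewrite -[_ + _ - _]addrA -sumrB mulrDr big_distrr /= -addrA -big_split /= addrC.
  congr (_ + _); apply: eq_big_nat => i /andP[_ im]; rewrite ltnS in im.
  rewrite (su _ im) (sl _ im) (sl2 _ im) !PoszD -(subzn ra).
  by move: (Posz _) (Posz _) (Posz _) (Posz _) => ? ? ? ?; ring.
rewrite expE expfzDr // [X in _ * (X * _) = _](_ : _ = \prod_(1 <= i < m.+1)
    qbinom y ((conjpart (nseq (a - r) m ++ s) i)%:Z - (conjpart mu i.+1)%:Z)
      ((conjpart (nseq (a - r) m ++ s) i)%:Z - (conjpart mu i)%:Z)).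
  rewrite [qpoch y y (a - r) * _]mulrC.
  move: (qpoch y y a / _) (\prod_(1 <= i < m.+1) _) => u v.
  by move: (x ^ _) => e1; move: (x ^ _) => e2; ring.
apply: eq_big_nat => i /andP[_ im]; rewrite ltnS in im.
rewrite (su _ im) (sl _ im) (sl2 _ im).
have -> : conjpart (nseq r m.+1 ++ mu) i.+1 = (r + conjpart mu i.+1)%N.
  by rewrite conjpart_cat conjpart_nseq ltnS im.
by congr (qbinom _ _ _); lia.
Qed.

(** The passage from [m.+1] to [m] takes [r] of the [a] largest parts of [s] away
    and lowers the [a - r] others by 1. *)
Lemma layer_coef_cat m n a r s mu : (a <= n)%N -> (r <= n)%N ->
  s \in box_partitions m (n - a) -> mu \in box_partitions m (n - r) ->
  layer_coef n (nseq a m.+1 ++ s) (nseq r m.+1 ++ mu) =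
  rank_prob a n r * layer_coef (n - r) (nseq (a - r) m ++ s) mu.
Proof.
move=> an rn sb mub; rewrite /layer_coef (hallg_cat an rn sb mub) /rank_prob.
case: leqP => [ra|_]; last by rewrite mulr0 mul0r.
have -> : conjpart (nseq r m.+1 ++ mu) 1 = (r + conjpart mu 1)%N.
  by rewrite conjpart_cat conjpart_nseq.
rewrite subnDA !sumn_cat_nseq; set e1 := - _; set e2 := r%:Z * _; set e3 := (X in _ = _ * (x ^ X * _ * _)).
have E : x ^ e1 * x ^ e2 = y ^+ ((a - r) * (n - r)) * x ^ e3.
  rewrite exprVn exprnN -!expfzDr //; congr (x ^ _); rewrite /e1 /e2 /e3.
  have [k aE] : exists k, a = (r + k)%N by exists (a - r)%N; lia.
  have [j nE] : exists j, n = (r + j)%N by exists (n - r)%N; lia.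
  rewrite aE nE !addKn !(PoszD, PoszM) -[m.+1]addn1 !PoszD.
  by move: (Posz r) (Posz k) (Posz j) (Posz m) (Posz (sumn s)) (Posz (sumn mu)) => *; ring.
move: E; have := qpoch_neq0 x_gt1; move: (qpoch y y) (hallg _ mu x) => P h P0.
move: (x ^ e1) (x ^ e2) (x ^ e3) (y ^+ _) => f1 f2 f3 f4 E.
transitivity (f1 * f2 * (P a / (P r * P (a - r)%N)) * (P n / P (n - r - conjpart mu 1)%N) * h).
  by ring.
by rewrite E; field; rewrite !P0.
Qed.

(* [G] stands for the generating series of the frames of a given type, and the
   step is the dichotomy of [frames_vol_step]: a part [k.+1] is taken away, or
   lowered by 1 at the price of a factor [z]. *)
Variables (G : seq nat -> {fps rat}) (z : {fps rat}).
Hypothesis G_perm : forall s s', perm_eq s s' -> G s = G s'.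
Hypothesis G_step : forall k r, all (leq^~ k.+1) r ->
  G (k.+1 :: r) = C (1 - y ^+ (size r).+1) * G r + C (y ^+ (size r).+1) * z * G (k :: r).

(** The number of rows taken away obeys the recursion [rank_probS] of the rank of
    a random matrix. *)
Lemma peel_layer a k s : all (leq^~ k) s ->
  G (nseq a k.+1 ++ s) =
  \sum_(r < a.+1) C (rank_prob a (a + size s) r) * z ^+ (a - r) * G (nseq (a - r) k ++ s).
Proof.
elim: a s => [|a IHa] s sk.
  by rewrite big_ord1 rank_prob00 rmorph1 subn0 expr0 !mul1r.
have sk' : all (leq^~ k.+1) s by apply: sub_all sk => i /= /leqW.
rewrite [LHS]G_step; last by rewrite all_cat sk' andbT; apply/allP => i /nseqP[->].
have -> : G (k :: nseq a k.+1 ++ s) = G (nseq a k.+1 ++ k :: s).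
  by apply: G_perm; rewrite -cat_cons perm_sym -cat1s perm_catCA.
rewrite (IHa s) // (IHa (k :: s)) /= ?leqnn // size_cat size_nseq addnS addSn.
set n := (a + size s)%N; have an : (a <= n)%N by apply: leq_addr.
pose H r := z ^+ (a.+1 - r) * G (nseq (a.+1 - r) k ++ s).
rewrite (eq_bigr (fun r : 'I_a.+1 => C (rank_prob a n r) * H r.+1)); last first.
  by move=> r _; rewrite /H subSS mulrA.
rewrite [X in _ + _ * X](eq_bigr (fun r : 'I_a.+1 => C (rank_prob a n.+1 r) * (z ^+ (a - r) * G (nseq (a.+1 - r) k ++ s)))); last first.
  move=> r _; rewrite -mulrA; congr (_ * (_ * _)); apply: G_perm.
  by rewrite subSn ?leq_ord //; apply: permEl (perm_catCA (nseq (a - r) k) [:: k] s).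
rewrite [RHS](eq_bigr (fun r : 'I_a.+2 => C (rank_prob a.+1 n.+1 r) * H r)); last first.
  by move=> r _; rewrite /H mulrA.
have T2 : C (y ^+ n.+1) * z * (\sum_(r < a.+1) C (rank_prob a n.+1 r) *
    (z ^+ (a - r) * G (nseq (a.+1 - r) k ++ s))) =
    \sum_(r < a.+2) C (y ^+ n.+1 * rank_prob a n.+1 r) * H r.
  rewrite [RHS]big_ord_recr /= rank_prob_gt // mulr0 rmorph0 mul0r addr0 mulr_sumr.
  apply: eq_bigr => r _; rewrite /H rmorphM /= subSn ?leq_ord // [z ^+ _.+1]exprS.
  by move: (C _) (C _) (G _) (z ^+ _) => c1 c2 c3 c4; ring.
rewrite {}T2 addrC [X in X + _ = _]big_ord_recl [RHS]big_ord_recl rank_prob0 -addrA.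
congr (_ + _); rewrite mulr_sumr addrC -big_split; apply: eq_bigr => r _ /=; rewrite /bump /= add1n.
rewrite rank_probS ?leq_ord // [in RHS]rmorphD [RHS]mulrDl; congr (_ + _).
by rewrite [in RHS]rmorphM mulrA.
Qed.

(** The partition [mu] records the rows taken away: its parts equal to [k] are the
    rows that were taken away when the largest part was [k]. The rows that are
    lowered down to 0 remain. *)
Lemma peel_layers m n s : s \in box_partitions m n ->
  G s = \sum_(mu <- box_partitions m n)
    C (layer_coef n s mu) * z ^+ (sumn s - sumn mu) * G (nseq (n - conjpart mu 1) 0%N).
Proof.
elim: m n s => [|m IHm] n s.
  rewrite box_partitions0 inE => /eqP ->; rewrite big_seq1 /layer_coef subrr mulr0 oppr0 expr0z mul1r.
  rewrite conjpart_nseq subn0 subnn expr0 mulr1 divff ?qpoch_neq0 // mul1r.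
  have nb : nseq n 0%N \in box_partitions 0 n by rewrite box_partitions0 inE.
  by rewrite (hallgE x nb nb) !big_geq // expr0z mulr1 rmorph1 mul1r.
move=> /box_catP[a [s' [an sb ->]]].
have sz := box_size sb; have s'm : all (leq^~ m) s'.
  by move: sb; rewrite mem_box_partitions => /and3P[].
rewrite peel_layer // sz subnKC // big_box.
rewrite (big_ord_widen n.+1 (fun r => C (rank_prob a n r) * z ^+ (a - r) *
  G (nseq (a - r) m ++ s'))) // big_mkcond; apply: eq_bigr => r _.
have rn : (r <= n)%N by rewrite -ltnS.
rewrite ltnS; case: leqP => ra; last first.
  rewrite big_seq big1 // => mu mub.
  by rewrite (layer_coef_cat an rn sb mub) rank_prob_gt // mul0r rmorph0 !mul0r.
have sb' : nseq (a - r) m ++ s' \in box_partitions m (n - r).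
  by have := mem_box_cat_max (a - r) sb; congr (_ \in box_partitions _ _); lia.
rewrite (IHm _ _ sb') mulr_sumr big_seq [RHS]big_seq; apply: eq_bigr => mu mub.
rewrite (layer_coef_cat an rn sb mub) conjpart_cat conjpart_nseq /= subnDA.
set K := layer_coef _ _ _; set S := nseq (a - r) m ++ s' in sb' K *.
have [K0|K0] := eqVneq K 0; first by rewrite K0 mulr0 rmorph0 !mul0r mulr0.
have muS : (sumn mu <= sumn S)%N.
  apply: (hallg_sub sb' mub (x := x)).
  by move: K0; rewrite /K /layer_coef !mulf_eq0 !negb_or => /andP[].
have -> : (sumn (nseq a m.+1 ++ s') - sumn (nseq r m.+1 ++ mu) = (a - r) + (sumn S - sumn mu))%N.
  by move: muS; rewrite /S !sumn_cat_nseq; nia.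
by rewrite [in RHS]rmorphM exprD -!mulrA; congr (_ * _); rewrite mulrCA.
Qed.

End Layers.

(** * The generating series of frames *)

Section FrameSeries.
Variables (F K : finFieldType) (iota : {rmorphism F -> K}).
Hypothesis QE : #|K| = (#|F| ^ 2)%N.
Local Notation q := (#|F|).
Local Notation Q := (#|K|).
Local Notation x := (q%:R : rat).
Local Notation y := (x^-1).
Local Notation Y := ((Q%:R : rat)^-1).
Local Notation C := (@fpsC rat).
Local Notation t := (fpsX rat).

Section Rescaled.
Variable c : rat.
Local Notation z := (C c * t ^+ 2).

(** The volumes of frames of type [s] as a series in [c t^2]. The power of [q]
    turns the recursion [frames_vol_step] into one whose coefficients depend only
    on the number of rows. *)
Definition frame_series s : {fps rat} :=
  FPS (fun k => if odd k then 0 else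
    c ^+ k./2 * x ^+ (size s * sumn s) * vol (frames iota (@typ s (size s)) k./2)).

Lemma frame_series_perm s s' : perm_eq s s' -> frame_series s = frame_series s'.
Proof.
move=> ss; apply: fpsP => k /=; case: odd => //.
rewrite -(perm_size ss) -(perm_sumn ss); congr (_ * _).
exact: frames_vol_perm.
Qed.

Lemma coef_square a (f : {fps rat}) d :
  (C a * z * f) d.*2 = if d is e.+1 then a * c * f e.*2 else 0.
Proof.
have -> : C a * z * f = C (a * c) * (t ^+ 2 * f) by rewrite rmorphM /= !mulrA.
rewrite coef_fpsCM coef_fpsXnM; case: d => [|d]; first by rewrite mulr0.
by rewrite doubleS subn2.
Qed.

Lemma coef_square_odd a (f : {fps rat}) k : (forall l, odd l -> f l = 0) ->
  odd k -> (C a * z * f) k = 0.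
Proof.
move=> f0 ok; have -> : C a * z * f = C (a * c) * (t ^+ 2 * f) by rewrite rmorphM /= !mulrA.
rewrite coef_fpsCM coef_fpsXnM; case: ltnP => [_|k2]; first by rewrite mulr0.
by rewrite f0 ?mulr0 // oddB ?ok.
Qed.

Lemma frame_series_odd s l : odd l -> frame_series s l = 0.
Proof. by move=> /= ->. Qed.

Lemma frame_series_even s d : frame_series s d.*2 =
  c ^+ d * x ^+ (size s * sumn s) * vol (frames iota (@typ s (size s)) d).
Proof. by rewrite /= odd_double half_double. Qed.

Let x_neq0 : x != 0. Proof. by rewrite pnatr_eq0 -lt0n ltnW ?finNzRing_gt1. Qed.
Let QX : Q%:R = x ^+ 2 :> rat. Proof. by rewrite QE natrX. Qed.

Lemma frame_series_step k r : all (leq^~ k.+1) r ->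
  frame_series (k.+1 :: r) =
  C (1 - y ^+ (size r).+1) * frame_series r +
  C (y ^+ (size r).+1) * z * frame_series (k :: r).
Proof.
move=> rk; apply: fpsP => l; rewrite fps_coefD coef_fpsCM.
have [ol|el] := boolP (odd l).
  by rewrite coef_square_odd ?frame_series_odd //; [ring|exact: frame_series_odd].
have -> : l = (l./2).*2 by rewrite -[LHS]odd_double_half (negbTE el).
rewrite coef_square !frame_series_even /= (frames_vol_step iota QE _ (erefl (size r)) rk) /=.
move: (l./2) => {l el} d; set n := size r; set sr := sumn r.
have e1 : x ^+ (n.+1 * (k.+1 + sr)) = x ^+ n.+1 * x ^+ (n.+1 * k) * (x ^+ (n * sr) * x ^+ sr).
  by rewrite -!exprD; congr (x ^+ _); lia.
have e2 : x ^+ (n.+1 * (k + sr)) = x ^+ (n.+1 * k) * (x ^+ (n * sr) * x ^+ sr).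
  by rewrite -!exprD; congr (x ^+ _); lia.
rewrite e1 natrX mulnS natrX exprD !natrX QX exprAC exprVn.
move: (expf_neq0 n.+1 x_neq0) (expf_neq0 (n.+1 * k) x_neq0) (expf_neq0 sr x_neq0).
case: d => [|d]; last rewrite /= odd_double half_double e2 [c ^+ d.+1]exprS;
  move: (x ^+ n.+1) (x ^+ (n.+1 * k)) (x ^+ (n * sr)) (x ^+ sr) (vol _) => X1 X2 X3 X4 v ? ? ?.
  by field; apply/and3P; split.
move: (vol _) (c ^+ d) => w cd.
by field; apply/and3P; split.
Qed.

(** Frames of type 0 are all the matrices over [K[[T]]]; here the second term of
    the recursion lowers the valuation only, which gives a geometric series for
    each row. *)
Lemma frame_series_nseq0 n :
  frame_series (nseq n 0%N) * \prod_(i < n) (1 - C (Y ^+ i.+1) * z) = C (qpoch Y Y n).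
Proof.
elim: n => [|n IHn].
  rewrite big_ord0 mulr1 qpoch0 rmorph1; apply: fpsP => l; rewrite fps_coef1.
  have [ol|el] := boolP (odd l).
    by rewrite frame_series_odd //; case: l ol.
  have -> : l = (l./2).*2 by rewrite -[LHS]odd_double_half (negbTE el).
  rewrite frame_series_even /= frames_vol0 expr0 mulr1; move: (l./2) => {l el} d.
  by case: d => [|d]; rewrite ?expr0 ?mul1r // mulr0.
have step : frame_series (nseq n.+1 0%N) * (1 - C (Y ^+ n.+1) * z) =
    C (1 - Y ^+ n.+1) * frame_series (nseq n 0%N).
  rewrite mulrBr mulr1; apply/eqP; rewrite subr_eq; apply/eqP.
  rewrite [X in _ = _ + X]mulrC.
  apply: fpsP => l; rewrite fps_coefD coef_fpsCM.
  have [ol|el] := boolP (odd l).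
    by rewrite coef_square_odd ?frame_series_odd //; [ring|exact: frame_series_odd].
  have -> : l = (l./2).*2 by rewrite -[LHS]odd_double_half (negbTE el).
  have sz : size (nseq n 0%N) = n by rewrite size_nseq.
  have a0 : all (leq^~ 0%N) (nseq n 0%N) by apply/allP => i /nseqP[->].
  rewrite coef_square !frame_series_even /= sz (frames_vol_step iota QE _ sz a0) /=.
  rewrite sumn_nseq !(mul0n, muln0, expr0, mulr1, expn0, invr1) natrX -exprVn.
  move: (l./2) => {l el} [|d]; first by ring.
  rewrite /= odd_double half_double ?sz ?(sumn_nseq, mul0n, muln0, expr0, mulr1) [c ^+ d.+1]exprS.
  by move: (Y ^+ _) (vol _) (vol _) (c ^+ d) => *; ring.
rewrite (_ : \prod_(i < n.+1) _ =
  \prod_(i < n) (1 - C (Y ^+ i.+1) * z) * (1 - C (Y ^+ n.+1) * z)); last exact: big_ord_recr.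
rewrite [LHS]mulrA [LHS]mulrAC step -mulrA IHn -rmorphM qpochS.
by rewrite mulrC.
Qed.

End Rescaled.

(** With [c = Q^N], the denominators of the frame series of [N - b] rows of type 0
    are the last [N - b] factors of [(t^2; q^2)_N], in reverse order. *)
Lemma qpoch_frame_series N b : (b <= N)%N ->
  qpoch (t ^+ 2) ((q ^ 2)%:R) N * frame_series (Q%:R ^+ N) (nseq (N - b) 0%N) =
  qpoch (t ^+ 2) ((q ^ 2)%:R) b * C (qpoch Y Y (N - b)).
Proof.
move=> bN; have Q0 : Q%:R != 0 :> rat by rewrite pnatr_eq0 -lt0n ltnW ?finNzRing_gt1.
rewrite -(frame_series_nseq0 (Q%:R ^+ N)) mulrCA [in LHS]mulrC; congr (_ * _).
have -> : qpoch (t ^+ 2) ((q ^ 2)%:R : {fps rat}) N =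
    \prod_(j < b + (N - b)) (1 - t ^+ 2 * (q ^ 2)%:R ^+ j) by rewrite subnKC.
rewrite big_split_ord /=; congr (_ * _).
rewrite (reindex_inj rev_ord_inj) /=; apply: eq_bigr => i _.
congr (_ - _); rewrite mulrC mulrA; congr (_ * _).
rewrite -QE -(rmorph_nat C) -rmorphXn -rmorphM; congr (C _).
have -> : Q%:R ^+ N = Q%:R ^+ i.+1 * Q%:R ^+ (b + (N - b - i.+1)) :> rat.
  by rewrite -exprD; congr (_ ^+ _); have := ltn_ord i; lia.
by rewrite exprVn mulKf // expf_neq0.
Qed.

End FrameSeries.

(** * The zeta function as a sum over types *)

Lemma card_fset_set_disjoint (I : eqType) (T : choiceType) (r : seq I) (B : I -> set T) :
  uniq r -> (forall i, i \in r -> finite_set (B i)) ->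
  (forall i j L, i \in r -> j \in r -> B i L -> B j L -> i = j) ->
  #|` fset_set [set L | exists2 i, i \in r & B i L]| = (\sum_(i <- r) #|` fset_set (B i)|)%N.
Proof.
elim: r => [|i r IHr] /=.
  move=> _ _ _; rewrite big_nil (_ : mkset _ = set0) ?fset_set0 ?cardfs0 //.
  by apply/funext => L; apply/propext; split=> // -[].
move=> /andP[ir ur] fin dis; rewrite big_cons -IHr //; first last.
- by move=> j k L jr kr; apply: dis; rewrite inE ?jr ?kr orbT.
- by move=> j jr; apply: fin; rewrite inE jr orbT.
set U := [set L | exists2 j, j \in r & B j L].
have -> : [set L | exists2 j, j \in i :: r & B j L] = B i `|` U.
  apply/funext => L; apply/propext; split=> [[j]|[BL|[j jr BL]]].
  - by rewrite inE => /orP[/eqP ->|jr] BL; [left|right; exists j].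
  - by exists i; rewrite // inE eqxx.
  by exists j; rewrite // inE jr orbT.
have finU : finite_set U.
  have -> : U = \bigcup_(j in [set` r]) B j by [].
  apply: bigcup_finite => [|j jr]; first exact: finite_seq.
  by apply: fin; rewrite inE [_ \in r]jr orbT.
have finB : finite_set (B i) by apply: fin; rewrite inE eqxx.
rewrite fset_setU // cardfsU; rewrite (_ : (_ `&` _)%fset = fset0) ?cardfs0 ?subn0 //.
apply/fsetP => L; rewrite in_fset0 in_fsetI; apply/negbTE/negP => /andP[].
rewrite !in_fset_set // !in_setE => BL [j jr BjL].
have E : i = j by apply: (dis _ _ L); rewrite ?inE ?eqxx ?jr ?orbT.
by move: ir; rewrite E jr.
Qed.

Section ZetaExpansion.
Variables (F K : finFieldType) (iota : {rmorphism F -> K}) (alpha : K).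
Local Notation base := (base_field iota).
Hypothesis alpha_notin : alpha \notin base.
Hypothesis alpha_span :
  forall y, exists ab : K * K, [/\ ab.1 \in base, ab.2 \in base & y = ab.1 + alpha * ab.2].
Hypothesis QE : #|K| = (#|F| ^ 2)%N.
Local Notation q := (#|F|).
Local Notation Q := (#|K|).
Local Notation x := (q%:R : rat).
Local Notation Y := ((Q%:R : rat)^-1).
Local Notation C := (@fpsC rat).
Local Notation t := (fpsX rat).

Definition lattices_of_type m n k s : set (set 'rV[{fps K}]_n) :=
  [set L | exists2 d, (k + sumn s = 2 * d + m * n)%N &
    exists2 b, frames iota (@typ s n) d b & L = lat iota m (@typ s n) b].

Arguments lattices_of_type : clear implicits.

(** The series of frames divided by the volume of the automorphism group; the
    power of [t] accounts for the index [q^(2 d + m n - |s|)]. *)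
Definition type_series m n s : {fps rat} :=
  C (x ^+ (n * sumn s) / (aut_poly s x * qpoch Y Y (n - conjpart s 1)))
    * t ^+ (m * n - sumn s) * frame_series iota (Q%:R ^+ n) s.

Lemma sumn_box m n s : s \in box_partitions m n -> (sumn s <= m * n)%N.
Proof.
rewrite mem_box_partitions => /and3P[_ /eqP <- sm].
elim: s sm => //= a s IHs /andP[am /IHs]; rewrite mulnS; exact: leq_add.
Qed.

(** The index determines the valuation [d] of the frames, so that the lattices of
    one type and index are those counted by [card_lattices_type]. *)
Lemma card_lattices_of_type m n k s : s \in box_partitions m n ->
  finite_set (lattices_of_type m n k s) /\
  (#|` fset_set (lattices_of_type m n k s)|)%:R = type_series m n s k.
Proof.
move=> sb; have sz := box_size sb; have smn := sumn_box sb.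
have q1 : (1 < q)%N by apply: finNzRing_gt1.
have x1 : 1 < x by rewrite ltr1n.
have Y1 : 1 < Q%:R :> rat by rewrite ltr1n finNzRing_gt1.
have x0 : x != 0 by rewrite gt_eqF // (lt_trans ltr01).
have Q0 : Q%:R != 0 :> rat by rewrite gt_eqF // (lt_trans ltr01).
have none : (forall d, (k + sumn s)%N <> (2 * d + m * n)%N) ->
    finite_set (lattices_of_type m n k s) /\ (#|` fset_set (lattices_of_type m n k s)|)%:R = 0 :> rat.
  move=> H; have -> : lattices_of_type m n k s = set0.
    by apply/funext => L; apply/propext; split=> // -[d /H].
  by rewrite fset_set0 cardfs0.
rewrite /type_series -mulrA coef_fpsCM coef_fpsXnM.
case: ltnP => [lt|ge]; first by rewrite mulr0; apply: none => d; lia.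
set l := (k - _)%N; have [ol|el] := boolP (odd l).
  rewrite frame_series_odd // mulr0; apply: none => d E.
  by move: ol; rewrite (_ : l = d.*2) ?odd_double // /l; lia.
have lE : l = (l./2).*2 by rewrite -[LHS]odd_double_half (negbTE el).
rewrite lE frame_series_even sz; set d := l./2.
have E : (k + sumn s = 2 * d + m * n)%N by move: lE; rewrite /l -/d; lia.
have [N cN NE] := card_lattices_type alpha_notin QE d sb.
have -> : lattices_of_type m n k s =
    [set L | exists2 b, frames iota (@typ s n) d b & L = lat iota m (@typ s n) b].
  apply/funext => L; apply/propext; split=> [[d' E' H]|H]; last by exists d.
  by have -> : d = d' by lia.
split; first by apply/finite_setP; exists N.
rewrite (card_fset_set cN).
have aut0 := aut_poly_neq0 x1 sb.
have Yn0 := qpoch_neq0 Y1 (n - conjpart s 1).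
move: NE; rewrite (vol_aut_closed iota QE sb) => <-.
rewrite natrX -exprM mul2n -addnn exprD.
move: (expf_neq0 (n * sumn s) x0) (expf_neq0 (n * d) Q0) aut0 Yn0.
move: (x ^+ _) (_ ^+ (n * d)) (aut_poly _ _) (qpoch _ _ _) => X Z a P X0 Z0 a0 P0.
by field; apply/and4P; split.
Qed.

Lemma zeta_expansion m n :
  zeta q (order iota m) n = \sum_(s <- box_partitions m n) type_series m n s.
Proof.
apply: fpsP => k.
have -> : (\sum_(s <- box_partitions m n) type_series m n s) k =
    \sum_(s <- box_partitions m n) type_series m n s k.
  by elim/big_rec2: _ => // i y z _ <-.
transitivity ((\sum_(s <- box_partitions m n) #|` fset_set (lattices_of_type m n k s)|)%N%:R : rat);
  last first.
  rewrite natr_sum big_seq [RHS]big_seq; apply: eq_bigr => s sb.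
  by have [] := card_lattices_of_type k sb.
rewrite -card_fset_set_disjoint ?uniq_box_partitions //; first last.
- move=> s s' L sb s'b [d _ [b [bP bd] ->]] [d' _ [b' [b'P b'd] E]].
  by have [] := lat_eq_type alpha_notin sb s'b bd b'd E.
- by move=> s sb; have [] := card_lattices_of_type k sb.
rewrite /zeta /=; congr (#|` fset_set _|%:R); apply/funext => L; apply/propext; split.
  move=> LP; have [Lsub Lidx] := LP.
  have [s [d [b [sb bd bP LE]]]] := lattice_normal_form alpha_notin alpha_span Lsub Lidx.
  exists s => //; exists d; last by exists b.
  by move: LP; rewrite LE => /(lat_index QE k sb bd bP).
move=> [s sb [d E [b [bP bd] ->]]].
by apply/(lat_index QE k sb bd bP).
Qed.

End ZetaExpansion.

(** * The coefficients of the formula *)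

Section Coefficients.
Variable x : rat.
Hypothesis x_gt1 : 1 < x.
Local Notation X := (x ^+ 2).
Local Notation Y := (X^-1).

(** The Hall polynomial of [s] and [mu] occurs once on each side, and
    [hall_aut_poly] evaluates the other ones: at [x] and at [x^2] for [mu], and at
    [x^2] for [s]. *)
Lemma coef_identity m n s mu :
  s \in box_partitions m n -> mu \in box_partitions m n -> (sumn mu <= sumn s)%N ->
  x ^+ (n * sumn s) / (aut_poly s x * qpoch Y Y (n - conjpart s 1)) * layer_coef x n s mu
    * (X ^+ n) ^+ (sumn s - sumn mu) * qpoch Y Y (n - conjpart mu 1) =
  hallg (nseq n m) mu x * Bcoef m n s mu x.
Proof.
move=> sb mub le.
have x0 : x != 0 by rewrite gt_eqF // (lt_trans ltr01).
have X1 : 1 < X by rewrite exprn_egt1.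
have HsA := hall_aut_poly X1 sb; have HuA := hall_aut_poly X1 mub.
have hua := hall_aut_poly x_gt1 mub.
have as0 := aut_poly_neq0 x_gt1 sb; have au0 := aut_poly_neq0 x_gt1 mub.
have As0 := aut_poly_neq0 X1 sb; have Au0 := aut_poly_neq0 X1 mub.
have [k kE] : exists k, sumn s = (sumn mu + k)%N by exists (sumn s - sumn mu)%N; lia.
have P0 := qpoch_neq0 x_gt1; have PP0 := qpoch_neq0 X1.
have Xe e : X ^+ e = (x ^+ e) ^+ 2 by rewrite exprAC.
have u0 := expf_neq0 (n * sumn mu) x0; have w0 := expf_neq0 (n * k) x0.
have Hu0 : hallg (nseq n m) mu X != 0.
  apply: contraTneq isT => H; move/eqP: HuA; rewrite H mul0r eq_sym.
  by rewrite !mulf_eq0 invr_eq0 !(negbTE (PP0 _)) !orbF Xe !expf_eq0 /= (negbTE x0) andbF.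
rewrite /Bcoef; set h := hallg s mu x.
transitivity ((hallg (nseq n m) s X * aut_poly s X) * h / aut_poly s x *
   (hallg (nseq n m) mu x * aut_poly mu x) / (hallg (nseq n m) mu X * aut_poly mu X)); last first.
  by move: (hallg _ s X) (hallg _ mu x) => g1 g2; field; apply/and4P; split.
rewrite HsA HuA hua /layer_coef -/h.
have -> : x ^ (- (n%:Z * ((sumn s)%:Z - (sumn mu)%:Z))) = (x ^+ (n * k))^-1.
  by rewrite exprnN kE PoszD [X in n%:Z * X]addrC addKr -PoszM.
have -> : (X ^+ n) ^+ (sumn s - sumn mu) = (x ^+ (n * k)) ^+ 2.
  by rewrite -exprM kE addKn Xe.
rewrite !Xe kE mulnDr exprD.
move: u0 w0 as0 P0 PP0; move: (x ^+ (n * sumn mu)) (x ^+ (n * k)) (aut_poly s x) => u w a.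
move: (qpoch x^-1 x^-1) (qpoch Y Y) => P PP u0 w0 a0 P0 PP0.
by field; rewrite !PP0 P0 u0 w0 a0.
Qed.

End Coefficients.

Section QuadraticOrder.
Variables (F K : finFieldType) (iota : {rmorphism F -> K}) (alpha : K).
Local Notation base := (base_field iota).
Hypothesis alpha_notin : alpha \notin base.
Hypothesis alpha_span :
  forall y, exists ab : K * K, [/\ ab.1 \in base, ab.2 \in base & y = ab.1 + alpha * ab.2].
Hypothesis QE : #|K| = (#|F| ^ 2)%N.
Local Notation q := (#|F|).
Local Notation Q := (#|K|).
Local Notation x := (q%:R : rat).
Local Notation C := (@fpsC rat).
Local Notation t := (fpsX rat).
Local Notation q2 := ((q ^ 2)%:R : {fps rat}).

(** Expand the frame series of [s] by [peel_layers], then evaluate the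
    remaining series of type 0 by [qpoch_frame_series]. *)
Lemma qpoch_type_series m n s : s \in box_partitions m n ->
  qpoch (t ^+ 2) q2 n * type_series iota m n s =
  \sum_(mu <- box_partitions m n) qpoch (t ^+ 2) q2 (conjpart mu 1)
    * C (hallg (nseq n m) mu x * Bcoef m n s mu x)
    * t ^+ (m * n + sumn s - 2 * sumn mu).
Proof.
move=> sb; have smn := sumn_box sb.
have x1 : 1 < x by rewrite ltr1n; apply: finNzRing_gt1.
have QX : Q%:R = x ^+ 2 :> rat by rewrite QE natrX.
have step := frame_series_step iota QE (Q%:R ^+ n).
rewrite /type_series (peel_layers x1 (@frame_series_perm _ _ iota (Q%:R ^+ n)) step sb).
rewrite !mulr_sumr big_seq [RHS]big_seq; apply: eq_bigr => mu mub.
have un : (conjpart mu 1 <= n)%N by rewrite -(box_size mub) conjpart_le.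
have E := qpoch_frame_series iota QE un.
have [h0|h0] := eqVneq (hallg s mu x) 0.
  by rewrite /layer_coef /Bcoef h0 !(mulr0, mul0r, rmorph0).
have le := hallg_sub sb mub h0.
rewrite -(coef_identity x1 sb mub le) -QX.
have -> : (m * n + sumn s - 2 * sumn mu = (m * n - sumn s) + 2 * (sumn s - sumn mu))%N by lia.
rewrite exprD [t ^+ (2 * _)]exprM.
set c := _ / _; set L := layer_coef _ _ _ _; set k := (sumn s - sumn mu)%N.
rewrite exprMn -rmorphXn /=.
transitivity ((qpoch (t ^+ 2) q2 n * frame_series iota (Q%:R ^+ n) (nseq (n - conjpart mu 1) 0%N)) *
  (C c * C L * C ((Q%:R ^+ n) ^+ k)) * (t ^+ (m * n - sumn s) * (t ^+ 2) ^+ k)).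
  move: (qpoch _ _ n) (frame_series _ _ _) (C c) (C L) (C (_ ^+ k)) => A G c1 c2 c3.
  by move: (t ^+ (_ - _)) ((t ^+ 2) ^+ k) => t1 t2; ring.
rewrite E -!rmorphM.
rewrite !rmorphM /=; move: (qpoch _ _ _) (C c) (C L) (C (_ ^+ k)) (C (qpoch _ _ _)) => A c1 c2 c3 c4.
by move: (t ^+ (_ - _)) ((t ^+ 2) ^+ k) => t1 t2; ring.
Qed.

Lemma zeta_order m n :
  qpoch (t ^+ 2) q2 n * zeta q (order iota m) n =
  \sum_(lam <- box_partitions m n) \sum_(mu <- box_partitions m n)
    qpoch (t ^+ 2) q2 (conjpart mu 1)
    * C (hallg (nseq n m) mu x * Bcoef m n lam mu x)
    * t ^+ (m * n + sumn lam - 2 * sumn mu).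
Proof.
rewrite (zeta_expansion alpha_notin alpha_span QE) mulr_sumr big_seq [RHS]big_seq.
by apply: eq_bigr => s sb; apply: qpoch_type_series.
Qed.

End QuadraticOrder.

(** * Quadratic extensions *)

Section QuadraticExtension.
Variables (F K : finFieldType) (iota : {rmorphism F -> K}).
Local Notation base := (base_field iota).
Hypothesis QE : #|K| = (#|F| ^ 2)%N.

(** As [q < q^2], some [alpha] is not in [F]; the map sending [(a, b)] to
    [a + alpha b] is then injective between sets of cardinal [q^2]. *)
Lemma quadratic_basis : exists2 alpha, alpha \notin base &
  forall y, exists ab : K * K, [/\ ab.1 \in base, ab.2 \in base & y = ab.1 + alpha * ab.2].
Proof.
have q1 : (1 < #|F|)%N := finNzRing_gt1 F.
have [alpha aN] : exists alpha, alpha \notin base.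
  apply: contrapT => /forallNP H; have := card_base_field iota.
  have -> : #|base| = #|K| by apply: eq_card => a; rewrite [RHS]inE; apply/negPn/negP/H.
  by rewrite QE => E; have /(expnI q1) : (#|F| ^ 2 = #|F| ^ 1)%N by rewrite expn1.
exists alpha => // y.
pose f (ab : F * F) := iota ab.1 + alpha * iota ab.2.
have inj : injective f.
  move=> [a b] [a' b'] /eqP; rewrite /f /= -subr_eq0 opprD addrACA -mulrBr -!rmorphB.
  have bI c : iota c \in base by apply/base_fieldP; exists c.
  rewrite addr_eq0 => /eqP E.
  have bb : iota (b - b') = 0.
    by apply: (alpha_based aN) => //; rewrite -rpredN -E.
  move: E; rewrite bb mulr0 oppr0 => /eqP; rewrite fmorph_eq0 subr_eq0 => /eqP ->.
  by move/eqP: bb; rewrite fmorph_eq0 subr_eq0 => /eqP ->.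
have /codomP[[a b] ->] : y \in codom f.
  by apply: inj_card_onto => //; rewrite card_prod QE mulnn.
by exists (iota a, iota b); split=> //; apply/base_fieldP; [exists a|exists b].
Qed.

End QuadraticExtension.

Section FieldExtension.
Variables (F : finFieldType) (K : fieldExtType F).
Let iota : {rmorphism F -> finvect_type K} := in_alg K.

Lemma card_finvect : #|finvect_type K| = (#|F| ^ \dim {:K})%N.
Proof.
rewrite -(@card_vspacef F _ (Vector.class (finvect_type K))).
exact: (@card_vspace F _ (Vector.class (finvect_type K)) fullv).
Qed.

Lemma mem_base_field (a : K) : (a \in 1%VS) = (a \in base_field iota).
Proof. by apply/vlineP/base_fieldP. Qed.

Lemma order_ringE m : order_ring K m = order iota m.
Proof.
apply/funext => f; apply/propext; split=> [[g [h [gB ->]]] l|fP].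
  split=> // lm; rewrite -mem_base_field fps_coefD coef_fpsXnM lm addr0; exact: gB.
exists (FPS (fun l => if (l < m)%N then f l else 0)), (FPS (fun l => f (m + l)%N)).
split=> [l|].
  by rewrite /=; case: ifP => [lm|_]; rewrite ?mem0v // mem_base_field; apply: (fP l).2.
apply: fpsP => l; rewrite fps_coefD coef_fpsXnM /=.
by case: ltnP => lm; rewrite ?addr0 // add0r subnKC.
Qed.

Lemma normalizationE : normalization K = order_ring K 0.
Proof.
apply/funext => f; apply/propext; split=> // _.
by exists 0, f; split=> [l|]; rewrite ?mem0v // add0r expr0 mul1r.
Qed.

End FieldExtension.

Theorem theorem3p15 (q m n : nat) (F : finFieldType) (K : fieldExtType F)
    (hq : #|F| = q) (hK : \dim {:K} = 2%N) (hm : (1 <= m)%N) (hn : (1 <= n)%N) :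
  let t : {fps rat} := fpsX rat in
  let q2 : {fps rat} := (q ^ 2)%:R in
  nu K q m n = qpoch (t ^+ 2) q2 n * zeta q (order_ring K m) n /\
  qpoch (t ^+ 2) q2 n * zeta q (order_ring K m) n =
    \sum_(lam <- box_partitions m n) \sum_(mu <- box_partitions m n)
      qpoch (t ^+ 2) q2 (conjpart mu 1)
      * fpsC (hallg (nseq n m) mu q%:R * Bcoef m n lam mu q%:R)
      * t ^+ (m * n + sumn lam - 2 * sumn mu).
Proof.
move=> t q2; pose iota : {rmorphism F -> finvect_type K} := in_alg K.
have QE : #|finvect_type K| = (#|F| ^ 2)%N by rewrite card_finvect hK.
have [alpha aN aS] := quadratic_basis iota QE.
have Z k := @zeta_order _ _ iota alpha aN aS QE k n.
rewrite /t /q2 -hq; split; last by rewrite order_ringE; apply: Z.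
(* The normalization is the order with [m = 0]. The box then contains only the
   zero partition, and the sum is reduced to the term 1. *)
have Z0 : qpoch (fpsX rat ^+ 2) ((#|F| ^ 2)%:R) n * zeta #|F| (normalization K) n = 1.
  rewrite normalizationE order_ringE [LHS]Z box_partitions0 !big_seq1.
  have x1 : 1 < #|F|%:R :> rat by rewrite ltr1n finNzRing_gt1.
  have X1 : 1 < #|F|%:R ^+ 2 :> rat by rewrite exprn_egt1.
  have nb : nseq n 0%N \in box_partitions 0 n by rewrite box_partitions0 inE.
  have h1 (u : rat) : 1 < u -> hallg (nseq n 0) (nseq n 0) u = 1.
    by move=> u1; rewrite (hallgE u nb nb) !big_geq // expr0z mulr1.
  have a0 := aut_poly_neq0 x1 nb; have A0 := aut_poly_neq0 X1 nb.
  have r0 := mulf_neq0 A0 (invr_neq0 a0).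
  rewrite /Bcoef !h1 // !mul1r (divff r0).
  rewrite conjpart_nseq /qpoch big_ord0 sumn_nseq mul0n muln0 subnn expr0.
  by rewrite rmorph1 !mulr1.
rewrite /nu; set P := qpoch _ _ n in Z0 *.
have ZU : zeta #|F| (normalization K) n \is a GRing.unit.
  by apply/unitrP; exists P; split; rewrite // mulrC.
by apply: (mulIr ZU); rewrite divrK // mulrAC Z0 mul1r.
Qed.
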